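(* Let $k\ge 1$ and let $c,r\ge 1$ be integers with $c+r=k+1$, and let $R=(c^r)$ be the rectangular partition with $r$ rows of length $c$. Then, in the affine nilCoxeter algebra $\mathbb{A}$, $$s_R^{(k)}=X_R:=\sum_{\nu\subseteq R}{\bf u}\big(V_{(R,\nu)/\nu}\big),$$ where the sum is over all partitions $\nu$ whose Young diagram is contained in $R$.
   Context: Indices of generators are taken modulo $k+1$. $W$ is the affine symmetric group with generators $s_0,\dots,s_k$ and relations $s_i^2=1$, $s_is_j=s_js_i$ if $i-j\not\equiv\pm1$, $s_is_{i+1}s_i=s_{i+1}s_is_{i+1}$. The affine nilCoxeter algebra $\mathbb{A}$ is generated by $u_0,\dots,u_k$ with relations $u_i^2=0$, $u_iu_j=u_ju_i$ if $i-j\not\equiv\pm1$, $u_iu_{i+1}u_i=u_{i+1}u_iu_{i+1}$. For $w\in W$ with reduced word $s_{i_1}\cdots s_{i_m}$, ${\bf u}(w)=u_{i_1}\cdots u_{i_m}$ (independent of the reduced word). The content of the box in row $i$, column $j$ of a Young diagram is $(j-i)\bmod (k+1)$. $\mathbb{A}$ acts on the free abelian group with basis the $(k+1)$-cores: $u_i\nu$ is the core obtained by adding all addable boxes of content $i$ if $\nu$ has at least one such box, and $0$ otherwise. $W$ acts on $(k+1)$-cores: $s_i\nu$ adds all addable boxes of content $i$ if there are any, removes all removable boxes of content $i$ if there are any, and is $\nu$ otherwise. Let $W_0=\langle s_1,\dots,s_k\rangle$ and $W^0$ the set of minimal length coset representatives of $W/W_0$; $w\mapsto w\emptyset$ is a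 bijection from $W^0$ to $(k+1)$-cores. A partition $\lambda$ is $k$-bounded if $\lambda_1\le k$; $\mathfrak{c}(\lambda)$ is the $(k+1)$-core corresponding to $\lambda$ under the Lapointe–Morse bijection (whose inverse sends a core to the partition whose $i$-th part is the number of cells in row $i$ of hook length $\le k$), and $w_\lambda\in W^0$ is the element with $w_\lambda\emptyset=\mathfrak{c}(\lambda)$; set $u_\lambda={\bf u}(w_\lambda)$. For a proper subset $D\subsetneq\{0,\dots,k\}$, $u_D$ is the product of the $u_m$, $m\in D$, each once, ordered so that whenever $j,j+1\in D$, $u_{j+1}$ occurs to the left of $u_j$ (cyclically decreasing). Put ${\bf h}_i=\sum_{|D|=i}u_D$. The $k$-Schur functions $s^{(k)}_\lambda$ ($\lambda$ $k$-bounded) are the unique elements of the subalgebra generated by ${\bf h}_1,\dots,{\bf h}_k$ with $s^{(k)}_\emptyset=1$ and ${\bf h}_is^{(k)}_\lambda=\sum_\mu s^{(k)}_\mu$, summed over $k$-bounded $\mu$ with $u_\mu=u_Du_\lambda$ for some $D$ with $|D|=i$. For a skew shape $\nu/\mu$, $V_{\nu/\mu}\in W$ is the product of $s_{\text{content}}$ over its boxes, read row by row starting from the last (highest-indexed) row and ending with row 1, each row read from right to left. For $\nu\subseteq R$, $(R,\nu)$ denotes the partition $(c,\dots,c,\nu_1,\nu_2,\dots)$ with $r$ parts equal to $c$ followed by the parts of $\nu$.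
   Formalization: For k = 1 the braid relations are omitted in both the affine symmetric group and the nilCoxeter algebra: with them the stated action on 2-cores would not exist (u_0u_1u_0 sends the empty core to (3,2,1), u_1u_0u_1 sends it to 0). *)

(* Defs.v *)
From HB Require Import structures.
From mathcomp Require Import all_boot all_order all_algebra.
From mathcomp Require Import boolp classical_sets cardinality fsbigop.

Set Implicit Arguments.
Unset Strict Implicit.
Unset Printing Implicit Defensive.

Import GRing.Theory.
Local Open Scope quotient_scope.
Local Open Scope ring_scope.

(* Residues modulo k+1 are elements of 'I_k.+1; ordS is the cyclic successor. *)
Definition adjacent (k : nat) (i j : 'I_k.+1) : bool :=
  (j == ordS i) || (i == ordS j).

(* The affine symmetric group, presented by generators and relations.
   As s_i^2 = 1, the group presentation is also a monoid presentation, so the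
   elements are words modulo the congruence generated by the relations.
   For k = 1 there is no braid relation, here and in the nilCoxeter algebra:
   s_0 and s_1 generate the infinite dihedral group, the affine Weyl group of
   type A_1. *)

Inductive cox_rel (k : nat) : seq 'I_k.+1 -> seq 'I_k.+1 -> Prop :=
| cox_sq i : cox_rel [:: i; i] [::]
| cox_comm i j : ~~ adjacent i j -> cox_rel [:: i; j] [:: j; i]
| cox_braid i : (1 < k)%N -> cox_rel [:: i; ordS i; i] [:: ordS i; i; ordS i].

Inductive cox_cong (k : nat) : seq 'I_k.+1 -> seq 'I_k.+1 -> Prop :=
| cox_cong_rel v w : cox_rel v w -> cox_cong v w
| cox_cong_refl v : cox_cong v v
| cox_cong_sym v w : cox_cong v w -> cox_cong w v
| cox_cong_trans v w x : cox_cong v w -> cox_cong w x -> cox_cong v x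
| cox_cong_cat v v' w w' :
    cox_cong v v' -> cox_cong w w' -> cox_cong (v ++ w) (v' ++ w').

Section AffineSym.
Variable k : nat.
Implicit Types v w : seq 'I_k.+1.

Definition cox_congb v w : bool := `[< cox_cong v w >].

Lemma cox_congb_equiv : equiv_class_of cox_congb.
Proof.
split=> [v|v w|w v x]; first by apply/asboolP; exact: cox_cong_refl.
  by apply/asboolP/asboolP; exact: cox_cong_sym.
by move=> /asboolP vw /asboolP wx; apply/asboolP; exact: cox_cong_trans vw wx.
Qed.

Canonical cox_congb_equivRel := EquivRelPack cox_congb_equiv.

Definition affSym : Type := {eq_quot cox_congb}.
HB.instance Definition _ := Choice.on affSym.
HB.instance Definition _ := EqQuotient.on affSym.

Definition affSym_of_word v : affSym := \pi_affSym v.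

Lemma affSym_of_wordP v w :
  affSym_of_word v = affSym_of_word w <-> cox_cong v w.
Proof.
split=> [/eqP|vw]; last apply/eqP; rewrite /affSym_of_word piE.
  by move/asboolP.
exact/asboolP.
Qed.

Lemma cox_cong_repr v : cox_cong (repr (affSym_of_word v)) v.
Proof. by apply/affSym_of_wordP; rewrite /affSym_of_word reprK. Qed.

Definition affSym_mul (x y : affSym) : affSym :=
  affSym_of_word (repr x ++ repr y).
Definition affSym_inv (x : affSym) : affSym := affSym_of_word (rev (repr x)).

Lemma cox_cong_rev v w : cox_cong v w -> cox_cong (rev v) (rev w).
Proof.
elim=> {v w}.
- move=> v w [i|i j ij|i k1]; apply: cox_cong_rel.
  + exact: cox_sq.
  + by apply: cox_comm; rewrite /adjacent orbC.
  + exact: cox_braid.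
- by move=> v; exact: cox_cong_refl.
- by move=> v w _; exact: cox_cong_sym.
- by move=> v w x _ vw _; exact: cox_cong_trans vw.
- by move=> v v' w w' _ vv' _ ww'; rewrite !rev_cat; exact: cox_cong_cat.
Qed.

Lemma affSym_of_word_cat v w :
  affSym_of_word (v ++ w) = affSym_mul (affSym_of_word v) (affSym_of_word w).
Proof.
by apply/affSym_of_wordP/cox_cong_sym/cox_cong_cat; exact: cox_cong_repr.
Qed.

Lemma affSym_of_word_rev v :
  affSym_of_word (rev v) = affSym_inv (affSym_of_word v).
Proof.
by apply/affSym_of_wordP/cox_cong_sym/cox_cong_rev; exact: cox_cong_repr.
Qed.

Lemma affSym_reprK (x : affSym) : affSym_of_word (repr x) = x.
Proof. exact: reprK. Qed.

Lemma affSym_mulA : associative affSym_mul.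
Proof.
move=> x y z; rewrite -[x]affSym_reprK -[y]affSym_reprK -[z]affSym_reprK.
by rewrite -!affSym_of_word_cat catA.
Qed.

Lemma affSym_mul1 : left_id (affSym_of_word [::]) affSym_mul.
Proof. by move=> x; rewrite -[x]affSym_reprK -affSym_of_word_cat. Qed.

Lemma affSym_mulr1 : right_id (affSym_of_word [::]) affSym_mul.
Proof. by move=> x; rewrite -[x]affSym_reprK -affSym_of_word_cat cats0. Qed.

Lemma cox_cong_revl v : cox_cong (rev v ++ v) [::].
Proof.
elim: v => [|i v IH]; first exact: cox_cong_refl.
rewrite rev_cons cat_rcons; apply: cox_cong_trans IH.
apply: cox_cong_cat; first exact: cox_cong_refl.
rewrite -[i :: i :: v]/([:: i; i] ++ v) -[X in cox_cong _ X]cat0s.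
apply: cox_cong_cat; last exact: cox_cong_refl.
exact/cox_cong_rel/cox_sq.
Qed.

Lemma affSym_mulV :
  left_inverse (affSym_of_word [::]) affSym_inv affSym_mul.
Proof.
move=> x; rewrite -[x]affSym_reprK -affSym_of_word_rev -affSym_of_word_cat.
exact/affSym_of_wordP/cox_cong_revl.
Qed.

Lemma affSym_mulrV :
  right_inverse (affSym_of_word [::]) affSym_inv affSym_mul.
Proof.
move=> x; rewrite -[x]affSym_reprK -affSym_of_word_rev -affSym_of_word_cat.
by apply/affSym_of_wordP; rewrite -{1}[repr x]revK; exact: cox_cong_revl.
Qed.

HB.instance Definition _ :=
  isGroup.Build affSym affSym_mulA affSym_mul1 affSym_mulr1
    affSym_mulV affSym_mulrV.

Definition affSym_gen (i : 'I_k.+1) : affSym := affSym_of_word [:: i].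

Definition word_prod w : affSym := (\prod_(i <- w) affSym_gen i)%g.

Definition reduced w : Prop :=
  forall v, word_prod v = word_prod w -> (size w <= size v)%N.

Definition reduced_word (x : affSym) : seq 'I_k.+1 :=
  xget [::] [set w | word_prod w = x /\ reduced w]%classic.

Definition cox_length (x : affSym) : nat := size (reduced_word x).

(* The generators are involutions, so the subgroup generated by s_1, ..., s_k
   consists of the products of words avoiding 0. *)
Definition in_W0 (x : affSym) : Prop :=
  exists2 w, all (fun i => i != ord0) w & word_prod w = x.

Definition min_coset_rep (x : affSym) : Prop :=
  forall y, in_W0 y -> (cox_length x <= cox_length (x * y)%g)%N.

End AffineSym.

(* The affine nilCoxeter algebra over the integers, presented by generators
   and relations: formal ring expressions in the generators, modulo the least
   congruence containing the ring axioms and the relations. *)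

Inductive nil_term (k : nat) : Type :=
| NGen of 'I_k.+1
| NZero
| NOne
| NOpp of nil_term k
| NAdd of nil_term k & nil_term k
| NMul of nil_term k & nil_term k.
Arguments NZero {k}.
Arguments NOne {k}.

HB.instance Definition _ (k : nat) := gen_eqMixin (nil_term k).
HB.instance Definition _ (k : nat) := gen_choiceMixin (nil_term k).

Inductive nil_rel (k : nat) : nil_term k -> nil_term k -> Prop :=
| nil_sq i : nil_rel (NMul (NGen i) (NGen i)) NZero
| nil_comm i j : ~~ adjacent i j ->
    nil_rel (NMul (NGen i) (NGen j)) (NMul (NGen j) (NGen i))
| nil_braid i : (1 < k)%N ->
    nil_rel (NMul (NMul (NGen i) (NGen (ordS i))) (NGen i))
            (NMul (NMul (NGen (ordS i)) (NGen i)) (NGen (ordS i))).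

Inductive nil_cong (k : nat) : nil_term k -> nil_term k -> Prop :=
| nil_cong_rel x y : nil_rel x y -> nil_cong x y
| nil_cong_refl x : nil_cong x x
| nil_cong_sym x y : nil_cong x y -> nil_cong y x
| nil_cong_trans x y z : nil_cong x y -> nil_cong y z -> nil_cong x z
| nil_cong_opp x x' : nil_cong x x' -> nil_cong (NOpp x) (NOpp x')
| nil_cong_add x x' y y' : nil_cong x x' -> nil_cong y y' ->
    nil_cong (NAdd x y) (NAdd x' y')
| nil_cong_mul x x' y y' : nil_cong x x' -> nil_cong y y' ->
    nil_cong (NMul x y) (NMul x' y')
| nil_cong_addA x y z : nil_cong (NAdd x (NAdd y z)) (NAdd (NAdd x y) z)
| nil_cong_addC x y : nil_cong (NAdd x y) (NAdd y x)
| nil_cong_add0 x : nil_cong (NAdd NZero x) x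
| nil_cong_addN x : nil_cong (NAdd (NOpp x) x) NZero
| nil_cong_mulA x y z : nil_cong (NMul x (NMul y z)) (NMul (NMul x y) z)
| nil_cong_mul1l x : nil_cong (NMul NOne x) x
| nil_cong_mul1r x : nil_cong (NMul x NOne) x
| nil_cong_mulDl x y z :
    nil_cong (NMul (NAdd x y) z) (NAdd (NMul x z) (NMul y z))
| nil_cong_mulDr x y z :
    nil_cong (NMul x (NAdd y z)) (NAdd (NMul x y) (NMul x z)).

Section NilCoxeter.
Variable k : nat.
Implicit Types x y z : nil_term k.

Definition nil_congb x y : bool := `[< nil_cong x y >].

Lemma nil_congb_equiv : equiv_class_of nil_congb.
Proof.
split=> [x|x y|y x z]; first by apply/asboolP; exact: nil_cong_refl.
  by apply/asboolP/asboolP; exact: nil_cong_sym.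
by move=> /asboolP xy /asboolP yz; apply/asboolP; exact: nil_cong_trans xy yz.
Qed.

Canonical nil_congb_equivRel := EquivRelPack nil_congb_equiv.

Definition nilCox : Type := {eq_quot nil_congb}.
HB.instance Definition _ := Choice.on nilCox.
HB.instance Definition _ := EqQuotient.on nilCox.

Definition nil_pi x : nilCox := \pi_nilCox x.

Lemma nil_piP x y : nil_pi x = nil_pi y <-> nil_cong x y.
Proof.
split=> [/eqP|xy]; last apply/eqP; rewrite /nil_pi piE.
  by move/asboolP.
exact/asboolP.
Qed.

Lemma nil_reprK (a : nilCox) : nil_pi (repr a) = a.
Proof. exact: reprK. Qed.

Lemma nil_cong_repr x : nil_cong (repr (nil_pi x)) x.
Proof. by apply/nil_piP; rewrite nil_reprK. Qed.

Definition nil_opp (a : nilCox) := nil_pi (NOpp (repr a)).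
Definition nil_add (a b : nilCox) := nil_pi (NAdd (repr a) (repr b)).
Definition nil_mul (a b : nilCox) := nil_pi (NMul (repr a) (repr b)).

Lemma nil_piN x : nil_opp (nil_pi x) = nil_pi (NOpp x).
Proof. by apply/nil_piP/nil_cong_opp; exact: nil_cong_repr. Qed.

Lemma nil_piD x y : nil_add (nil_pi x) (nil_pi y) = nil_pi (NAdd x y).
Proof. by apply/nil_piP/nil_cong_add; exact: nil_cong_repr. Qed.

Lemma nil_piM x y : nil_mul (nil_pi x) (nil_pi y) = nil_pi (NMul x y).
Proof. by apply/nil_piP/nil_cong_mul; exact: nil_cong_repr. Qed.

Let nil_piE := (nil_piN, nil_piD, nil_piM).

Lemma nil_addA : associative nil_add.
Proof.
move=> a b c; rewrite -[a]nil_reprK -[b]nil_reprK -[c]nil_reprK !nil_piE.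
exact/nil_piP/nil_cong_addA.
Qed.

Lemma nil_addC : commutative nil_add.
Proof.
move=> a b; rewrite -[a]nil_reprK -[b]nil_reprK !nil_piE.
exact/nil_piP/nil_cong_addC.
Qed.

Lemma nil_add0 : left_id (nil_pi NZero) nil_add.
Proof.
by move=> a; rewrite -[a]nil_reprK nil_piE; exact/nil_piP/nil_cong_add0.
Qed.

Lemma nil_addN : left_inverse (nil_pi NZero) nil_opp nil_add.
Proof.
by move=> a; rewrite -[a]nil_reprK !nil_piE; exact/nil_piP/nil_cong_addN.
Qed.

HB.instance Definition _ :=
  GRing.isZmodule.Build nilCox nil_addA nil_addC nil_add0 nil_addN.

Lemma nil_mulA : associative nil_mul.
Proof.
move=> a b c; rewrite -[a]nil_reprK -[b]nil_reprK -[c]nil_reprK !nil_piE.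
exact/nil_piP/nil_cong_mulA.
Qed.

Lemma nil_mul1l : left_id (nil_pi NOne) nil_mul.
Proof.
by move=> a; rewrite -[a]nil_reprK nil_piE; exact/nil_piP/nil_cong_mul1l.
Qed.

Lemma nil_mul1r : right_id (nil_pi NOne) nil_mul.
Proof.
by move=> a; rewrite -[a]nil_reprK nil_piE; exact/nil_piP/nil_cong_mul1r.
Qed.

Lemma nil_mulDl : left_distributive nil_mul nil_add.
Proof.
move=> a b c; rewrite -[a]nil_reprK -[b]nil_reprK -[c]nil_reprK !nil_piE.
exact/nil_piP/nil_cong_mulDl.
Qed.

Lemma nil_mulDr : right_distributive nil_mul nil_add.
Proof.
move=> a b c; rewrite -[a]nil_reprK -[b]nil_reprK -[c]nil_reprK !nil_piE.
exact/nil_piP/nil_cong_mulDr.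
Qed.

(* 1 != 0: the terms evaluate in the integers with all generators sent to 0. *)
Fixpoint nil_eval0 x : int :=
  match x with
  | NGen _ => 0
  | NZero => 0
  | NOne => 1
  | NOpp y => - nil_eval0 y
  | NAdd y z => nil_eval0 y + nil_eval0 z
  | NMul y z => nil_eval0 y * nil_eval0 z
  end.

Lemma nil_eval0_cong x y : nil_cong x y -> nil_eval0 x = nil_eval0 y.
Proof.
elim=> {x y} //=.
- by move=> x y [i|i j _|i _] /=; rewrite ?mul0r.
- by move=> x y z _ -> _ ->.
- by move=> x x' _ ->.
- by move=> x x' y y' _ -> _ ->.
- by move=> x x' y y' _ -> _ ->.
- by move=> x y z; rewrite addrA.
- by move=> x y; rewrite addrC.
- by move=> x; rewrite add0r.
- by move=> x; rewrite addNr.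
- by move=> x y z; rewrite mulrA.
- by move=> x; rewrite mul1r.
- by move=> x; rewrite mulr1.
- by move=> x y z; rewrite mulrDl.
- by move=> x y z; rewrite mulrDr.
Qed.

Lemma nil_oner_neq0 : nil_pi NOne != nil_pi NZero.
Proof. by apply/eqP => /nil_piP /nil_eval0_cong. Qed.

HB.instance Definition _ :=
  GRing.Zmodule_isNzRing.Build nilCox nil_mulA nil_mul1l nil_mul1r
    nil_mulDl nil_mulDr nil_oner_neq0.

Definition nil_gen (i : 'I_k.+1) : nilCox := nil_pi (NGen i).

(* The element u(x); by Matsumoto's theorem it does not depend on the choice
   of the reduced word. *)
Definition nil_of (x : affSym k) : nilCox :=
  \prod_(i <- reduced_word x) nil_gen i.

Definition cyc_decreasing (D : {set 'I_k.+1}) (w : seq 'I_k.+1) : bool :=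
  [&& uniq w, [set i in w] == D &
      [forall j in D, (ordS j \in D) ==> (index (ordS j) w < index j w)%N]].

(* The element u_D, for D a proper subset of the residues; all cyclically
   decreasing arrangements of D give the same product. *)
Definition nil_cyc (D : {set 'I_k.+1}) : nilCox :=
  \prod_(i <- xget [::] [set w | cyc_decreasing D w]%classic) nil_gen i.

Definition nil_h (i : nat) : nilCox :=
  \sum_(D : {set 'I_k.+1} | (D \proper [set: 'I_k.+1]) && (#|D| == i))
    nil_cyc D.

(* The subalgebra generated by h_1, ..., h_k: over the integers, subalgebras
   are subrings. *)
Definition in_h_subalgebra (a : nilCox) : Prop :=
  forall S : {pred nilCox}, subring_closed S ->
    (forall i, (1 <= i <= k)%N -> nil_h i \in S) -> a \in S.

End NilCoxeter.

(* Partitions are nonincreasing sequences of positive integers. Rows and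
   columns are numbered from 0. *)

Definition is_partition (la : seq nat) : bool :=
  sorted geq la && (0%N \notin la).

Definition part (la : seq nat) (p : nat) : nat := nth 0%N la p.

Definition conj_part (la : seq nat) (q : nat) : nat := count (fun x => q < x)%N la.

Definition sub_diagram (mu la : seq nat) : Prop :=
  forall p, (part mu p <= part la p)%N.

Definition hook (la : seq nat) (p q : nat) : nat :=
  ((part la p - q.+1) + (conj_part la q - p.+1)).+1.

Definition is_core (n : nat) (la : seq nat) : Prop :=
  is_partition la /\ forall p q, (q < part la p)%N -> hook la p q != n.

Definition k_bounded (k : nat) (la : seq nat) : Prop :=
  is_partition la /\ (part la 0 <= k)%N.

(* The Lapointe-Morse bijection from (k+1)-cores to k-bounded partitions, whose
   inverse is core_of_bounded. *)
Definition bounded_of_core (k : nat) (nu : seq nat) : seq nat :=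
  [seq count (fun q => hook nu p q <= k)%N (iota 0 (part nu p))
  | p <- iota 0 (size nu)].

Definition core_of_bounded (k : nat) (la : seq nat) : seq nat :=
  xget [::] [set nu | is_core k.+1 nu /\ bounded_of_core k nu = la]%classic.

Definition content (k : nat) (p q : nat) : 'I_k.+1 := inZp q - inZp p.

Section CoreAction.
Variables (k : nat) (i : 'I_k.+1) (nu : seq nat).

Definition addable (p : nat) : bool :=
  (p <= size nu)%N && ((p == 0%N) || (part nu p < part nu p.-1)%N)
  && (content k p (part nu p) == i).

Definition removable (p : nat) : bool :=
  (part nu p.+1 < part nu p)%N && (content k p (part nu p).-1 == i).

Definition add_boxes : seq nat :=
  [seq x <- [seq part nu p + addable p | p <- iota 0 (size nu).+1] | 0 < x]%N.

Definition remove_boxes : seq nat :=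
  [seq x <- [seq part nu p - removable p | p <- iota 0 (size nu)] | 0 < x]%N.

Definition gen_act : seq nat :=
  if has addable (iota 0 (size nu).+1) then add_boxes
  else if has removable (iota 0 (size nu)) then remove_boxes
  else nu.

End CoreAction.

(* The action of the affine symmetric group on (k+1)-cores; on cores it does
   not depend on the word chosen to represent x. *)
Definition core_act (k : nat) (x : affSym k) (nu : seq nat) : seq nat :=
  foldr (@gen_act k) nu (reduced_word x).

Definition w_of (k : nat) (la : seq nat) : affSym k :=
  xget 1%g [set x : affSym k | min_coset_rep x /\
                    core_act x [::] = core_of_bounded k la]%classic.

Definition u_of (k : nat) (la : seq nat) : nilCox k := nil_of (w_of k la).

(* These properties determine s on k-bounded partitions; its other values are
   irrelevant. The set of the mu in the sum is finite. *)
Definition is_kSchur (k : nat) (s : seq nat -> nilCox k) : Prop :=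
  [/\ forall la, k_bounded k la -> in_h_subalgebra (s la),
      s [::] = 1
    & forall (i : nat) (la : seq nat), (1 <= i <= k)%N -> k_bounded k la ->
        nil_h k i * s la =
        \sum_(mu \in [set mu | k_bounded k mu /\
               exists D : {set 'I_k.+1},
                 [/\ D \proper [set: 'I_k.+1], #|D| = i
                   & u_of k mu = nil_cyc D * u_of k la]]%classic) s mu].

Definition skew_word (k : nat) (nu mu : seq nat) : seq 'I_k.+1 :=
  flatten [seq [seq content k p q
               | q <- rev (iota (part mu p) (part nu p - part mu p))]
          | p <- rev (iota 0 (size nu))].

Definition V_skew (k : nat) (nu mu : seq nat) : affSym k :=
  word_prod (skew_word k nu mu).

Definition rect (c r : nat) : seq nat := nseq r c.

(* Main.v *)
Require Import Defs.
From mathcomp Require Import all_boot all_order all_algebra.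
From mathcomp Require Import boolp classical_sets cardinality fsbigop.
From mathcomp Require Import zify ring.

(* Put n = k+1. A core is encoded by the function G : Z -> Z with
   G (p + n) = G p + 1 that is negative exactly at the beads of its Maya diagram,
   so that the algebra acts by exchanging the values at adjacent positions, and
   is nonzero as long as every exchange is made at an ascent.

   The Pieri rule, by induction on the length and the first part, gives
   s_lambda 0 = c(lambda), and the two-row case of the Pieri rule is symmetric, so
   the h_i commute. The operator T adding a rectangle R to a k-bounded partition
   is G |-> G (p + r) - [the class of p + r is among the r highest levels of G]; it
   commutes with every h_i, up to a rotation of the residues. With commutativity,
   s_R (s_mu 0) = s_mu (s_R 0) = s_mu (T 0) = T (s_mu 0), so s_R acts as T.

   The word of (R,nu)/nu acts as nonzero on G exactly when the classes of the r
   highest levels are those of the beads of nu above position -r, and then acts as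
   T. This happens for exactly one nu inside R, so X_R acts as T, and s_R = X_R
   because the action of the algebra on cores is faithful. *)

Set Implicit Arguments.
Unset Strict Implicit.
Unset Printing Implicit Defensive.

Import Order.TTheory GRing.Theory Num.Theory.
Local Open Scope ring_scope.

(** * Quasi-periodic functions *)

Section Residues.
Variable k : nat.
Local Notation n := (k.+1%:Z).
Implicit Types (p q m : int) (i j : 'I_k.+1).

(** [T] commutes with the h_i for a simple reason: a generator compares the values at two adjacent
    positions, and lowering the r highest classes by 1 never changes the result, because for
    positions less than n apart the levels decide it. The rotation comes from the shift by r, and
    each h_i is invariant under rotation. A level determines its class modulo n, so the n classes
    have distinct levels; this is why there are exactly r highest ones and only one nu for each G.

    A reduced word may kill the empty core, so agreement there says little about elements of the
    algebra. For faithfulness every reduced word gets its own core on which it acts as nonzero,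
    built from its inversions.

    Matsumoto's theorem is proved for any starting function without descents, equal neighbours
    allowed. It then serves twice: at the identity permutation, where it describes all reduced
    words, and at the empty core, whose stabilizer is W_0 and where it describes the minimal coset
    representatives. *)

Definition cl p : 'I_k.+1 := inZp `|(p %% n)%Z|%N.

Lemma val_cl p : (cl p)%:Z = (p %% n)%Z.
Proof.
rewrite /cl /= modn_small.
  by rewrite gez0_abs // modz_ge0.
have := ltz_pmod p (ltn0Sn k : 0 < n).
by have := modz_ge0 p (isT : n != 0); lia.
Qed.

Lemma cl_ord i : cl i%:Z = i.
Proof.
apply/val_inj; apply/eqP; rewrite -eqz_nat; apply/eqP.
by rewrite (val_cl i) modz_small //; have := ltn_ord i; lia.
Qed.

Lemma clP p q : cl p = cl q <-> exists m, q = p + m * n.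
Proof.
split=> [/(congr1 (fun i : 'I_k.+1 => i%:Z)) | [m ->]].
  rewrite !val_cl => E; exists ((q %/ n)%Z - (p %/ n)%Z).
  by rewrite {1}(divz_eq q n) {1}(divz_eq p n) E; ring.
apply/val_inj; apply/eqP; rewrite -eqz_nat; apply/eqP.
by rewrite (val_cl p) (val_cl (p + m * n)) addrC modzMDl.
Qed.

Lemma clDM p m : cl (p + m * n) = cl p.
Proof. by apply/esym/clP; exists m. Qed.

Lemma clDn p : cl (p + n) = cl p.
Proof. by rewrite -(clDM p 1) mul1r. Qed.

Lemma cl_inj p q : cl p = cl q -> q - n < p < q + n -> p = q.
Proof.
case/clP=> m -> H.
have -> : m = 0 by nia.
ring.
Qed.

Lemma cl_inZp (a : nat) : cl a%:Z = inZp a.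
Proof.
by apply/val_inj; rewrite /cl /= modz_nat absz_nat modn_mod.
Qed.

Lemma clD p q : cl (p + q) = cl p + cl q.
Proof.
apply/val_inj; apply/eqP; rewrite -eqz_nat; apply/eqP.
rewrite (val_cl (p + q)) -[val (_ + _ : 'I__)]/((cl p + cl q) %% k.+1)%N.
by rewrite -modz_nat PoszD (val_cl p) (val_cl q) modzDm.
Qed.

Lemma clN p : cl (- p) = - cl p.
Proof.
apply/eqP; rewrite -subr_eq0 opprK -clD addNr.
by apply/eqP/val_inj.
Qed.

Lemma clB p q : cl (p - q) = cl p - cl q.
Proof. by rewrite clD clN. Qed.

Lemma contentE (a b : nat) : content k a b = cl (b%:Z - a%:Z).
Proof. by rewrite /content clB !cl_inZp. Qed.

Lemma clS p : cl (p + 1) = ordS (cl p).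
Proof.
apply/val_inj; rewrite clD /=.
have -> : (`|(1 %% n)%Z| %% k.+1)%N = (1 %% k.+1)%N.
  by rewrite modz_nat absz_nat modn_mod.
by rewrite modnDmr addn1.
Qed.

Lemma clS_eq p q : (cl (p + 1) == cl (q + 1)) = (cl p == cl q).
Proof. by rewrite !clD (inj_eq (addIr _)). Qed.

(** The simple reflection s_i in the realization of the affine symmetric group by permutations of
    the integers: it exchanges p - 1 and p for every p of class i. *)
Definition tau i p : int :=
  if cl p == i then p - 1 else if cl (p + 1) == i then p + 1 else p.

Lemma tauDM i p m : tau i (p + m * n) = tau i p + m * n.
Proof.
rewrite /tau -[p + m * n + 1]addrAC !clDM.
by case: ifP => // _; [ring | case: ifP => // _; ring].
Qed.

Lemma tauDn i p : tau i (p + n) = tau i p + n.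
Proof. by have := tauDM i p 1; rewrite mul1r. Qed.

Lemma tau_at i p : cl p = i -> tau i p = p - 1.
Proof. by rewrite /tau => ->; rewrite eqxx. Qed.

Hypothesis k_gt0 : (0 < k)%N.

Lemma clS_neq p : cl (p + 1) != cl p.
Proof. by apply/eqP => /cl_inj H; have := H ltac:(lia); lia. Qed.

Lemma tau_pred i p : cl (p + 1) = i -> tau i p = p + 1.
Proof. by rewrite /tau => <-; rewrite eqxx eq_sym (negbTE (clS_neq p)). Qed.

Lemma tau_other i p : cl p != i -> cl (p + 1) != i -> tau i p = p.
Proof. by rewrite /tau => /negbTE-> /negbTE->. Qed.

Lemma tauK i : involutive (tau i).
Proof.
move=> p; case: (eqVneq (cl p) i) => [e|ne].
  by rewrite (tau_at e) tau_pred ?subrK.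
case: (eqVneq (cl (p + 1)) i) => [e1|ne1].
  by rewrite (tau_pred e1) tau_at // addrK.
by rewrite !(tau_other ne ne1).
Qed.

Lemma tauC i j p : ~~ adjacent i j -> tau i (tau j p) = tau j (tau i p).
Proof.
case: (eqVneq i j) => [->//|ij].
(* A position moved by one of the two reflections is fixed, together with its image, by the other
   one. *)
suff H a b q : a != b -> ~~ adjacent a b -> (cl q == a) || (cl (q + 1) == a) ->
    tau b q = q /\ tau b (tau a q) = tau a q.
  move=> nij; have nji : ~~ adjacent j i by rewrite /adjacent orbC.
  have ji : j != i by rewrite eq_sym.
  case: (boolP ((cl p == i) || (cl (p + 1) == i))) => [/(H _ _ _ ij nij)[-> ->//]|].
  case: (boolP ((cl p == j) || (cl (p + 1) == j))) => [/(H _ _ _ ji nji)[-> ->//]|].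
  rewrite !negb_or => /andP[? ?] /andP[? ?].
  by rewrite (tau_other (i := j)) // (tau_other (i := i)) // (tau_other (i := j)).
move=> ab; rewrite /adjacent negb_or => /andP[nba nab] /orP[] /eqP e.
  have e1 : cl (q + 1) != b by rewrite clS e eq_sym.
  have e0 : cl q != b by rewrite e.
  have e2 : cl (q - 1) != b.
    by apply: contra nab => /eqP <-; rewrite -clS subrK e.
  by rewrite (tau_at e) !tau_other // subrK.
have e0 : cl q != b.
  by apply: contra nab => /eqP <-; rewrite -clS e.
have e1 : cl (q + 1) != b by rewrite e.
have e2 : cl (q + 1 + 1) != b by rewrite clS e eq_sym.
by rewrite (tau_pred e) !tau_other.
Qed.

Lemma tau_braid i p : (1 < k)%N ->
  tau i (tau (ordS i) (tau i p)) = tau (ordS i) (tau i (tau (ordS i) p)).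
Proof.
move=> k1; pose a := i%:Z; have ea : cl a = i := cl_ord i.
have ea1 : cl (a + 1) = ordS i by rewrite clS ea.
have far x y : cl x = cl y -> x - y < n -> y - x < n -> x = y.
  by move=> /cl_inj H ? ?; apply: H; lia.
have neq x y : 0 < x - y < n -> cl x != cl y.
  by move=> xy; apply/eqP => /far; lia.
(* On the classes of a - 1, a and a + 1, which are distinct since n >= 3, both sides exchange a - 1
   and a + 1; all other positions stay fixed. *)
have key q : [\/ q = a - 1, q = a | q = a + 1] ->
  tau i (tau (ordS i) (tau i q)) = tau (ordS i) (tau i (tau (ordS i) q)).
  have t0 : tau i (a - 1) = a by rewrite tau_pred ?subrK.
  have t1 : tau i a = a - 1 by rewrite tau_at.
  have t2 : tau i (a + 1) = a + 1.
    by rewrite tau_other // -[X in _ != X]ea neq //; lia.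
  have u0 : tau (ordS i) a = a + 1 by rewrite tau_pred.
  have u1 : tau (ordS i) (a + 1) = a by rewrite tau_at ?addrK.
  have u2 : tau (ordS i) (a - 1) = a - 1.
    by rewrite tau_other // -ea1 eq_sym neq //; lia.
  by case=> ->; rewrite !(t0, t1, t2, u0, u1, u2).
case: (eqVneq (cl p) (cl (a - 1))) => [/esym/clP[m ->]|n0].
  by rewrite !tauDM key //; constructor 1.
case: (eqVneq (cl p) (cl a)) => [/esym/clP[m ->]|n1].
  by rewrite !tauDM key //; constructor 2.
case: (eqVneq (cl p) (cl (a + 1))) => [/esym/clP[m ->]|n2].
  by rewrite !tauDM key //; constructor 3.
have e1 : cl (p + 1) != ordS i by rewrite -ea1 clS_eq.
have e0 : cl (p + 1) != i by rewrite -ea -(subrK 1 a) clS_eq.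
have h0 : cl p != i by rewrite -ea.
have h1 : cl p != ordS i by rewrite -ea1.
by rewrite !(tau_other h0, tau_other h1).
Qed.

End Residues.

(* N = 1 is the case of cores; the identity is an element for N = n. *)
Record qper (k : nat) (N : int) := QPer {
  qfun :> int -> int;
  qfunDn : forall p, qfun (p + k.+1%:Z) = qfun p + N }.

Section Action.
Variables (k : nat) (N : int).
Local Notation n := (k.+1%:Z).
Local Notation X := (qper k N).
Implicit Types (p q m : int) (i j : 'I_k.+1) (G H : X) (w : seq 'I_k.+1).

Lemma qper_eq G H : G =1 H -> G = H.
Proof.
case: G H => [g hg] [h hh] /= /funext E; case: _ / E hh => hh.
by congr QPer; exact: Prop_irrelevance.
Qed.

Lemma qfunDM G p m : G (p + m * n) = G p + m * N.
Proof.
have nat_case (a : nat) q : G (q + a%:Z * n) = G q + a%:Z * N.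
  elim: a q => [|a IH] q; first by rewrite !mul0r !addr0.
  rewrite -addn1 PoszD !mulrDl !mul1r !addrA qfunDn IH; ring.
case: m => a; first exact: nat_case.
have := nat_case a.+1 (p + Negz a * n).
rewrite NegzE mulNr subrK => ->; ring.
Qed.

Definition sact i G : X.
Proof.
exists (G \o tau i) => p; rewrite /= tauDn; exact: qfunDn.
Defined.

Definition up i G : bool := G (i%:Z - 1) < G i%:Z.
Definition down i G : bool := G i%:Z < G (i%:Z - 1).

Lemma upE i G p : cl k p = i -> up i G = (G (p - 1) < G p).
Proof.
rewrite -{1}(cl_ord i) => /esym/clP[m ->].
by rewrite addrAC !qfunDM ltrD2r.
Qed.

Lemma downE i G p : cl k p = i -> down i G = (G p < G (p - 1)).
Proof.
rewrite -{1}(cl_ord i) => /esym/clP[m ->].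
by rewrite addrAC !qfunDM ltrD2r.
Qed.

Lemma levelE i G p : cl k p = i ->
  (G (i%:Z - 1) == G i%:Z) = (G (p - 1) == G p).
Proof.
rewrite -{1}(cl_ord i) => /esym/clP[m ->].
by rewrite addrAC !qfunDM (inj_eq (addIr _)).
Qed.

Hypothesis k_gt0 : (0 < k)%N.

Lemma sactK i : involutive (sact i).
Proof. by move=> G; apply: qper_eq => p /=; rewrite tauK. Qed.

Lemma sactC i j G : ~~ adjacent i j -> sact i (sact j G) = sact j (sact i G).
Proof.
by move=> ij; apply: qper_eq => p /=; rewrite tauC // /adjacent orbC.
Qed.

Lemma sact_braid i G : (1 < k)%N ->
  sact i (sact (ordS i) (sact i G)) = sact (ordS i) (sact i (sact (ordS i) G)).
Proof. by move=> k1; apply: qper_eq => p /=; rewrite tau_braid. Qed.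

Lemma sact_at i G p : cl k p = i -> sact i G p = G (p - 1).
Proof. by move=> e /=; rewrite tau_at. Qed.

Lemma sact_pred i G p : cl k p = i -> sact i G (p - 1) = G p.
Proof. by move=> e /=; rewrite tau_pred ?subrK. Qed.

Lemma sact_other i G p : cl k p != i -> cl k (p + 1) != i -> sact i G p = G p.
Proof. by move=> e e1 /=; rewrite tau_other. Qed.

Lemma up_sact i G : up i (sact i G) = down i G.
Proof.
by rewrite /up (sact_pred _ (cl_ord i)) (sact_at _ (cl_ord i)).
Qed.

Lemma down_sact i G : down i (sact i G) = up i G.
Proof. by rewrite -up_sact sactK. Qed.

Lemma sact_level i G : ~~ up i G -> ~~ down i G -> sact i G = G.
Proof.
rewrite /up /down -!leNgt => h1 h2.
have /eqP E : G (i%:Z - 1) == G i%:Z by rewrite eq_le h2 h1.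
apply: qper_eq => p; case: (eqVneq (cl k p) i) => [e|ne].
  by rewrite sact_at //; apply/eqP; rewrite -(levelE _ e) E.
case: (eqVneq (cl k (p + 1)) i) => [e|ne1]; last by rewrite sact_other.
have := sact_pred G e; rewrite addrK => ->; apply/esym/eqP.
by have := levelE G e; rewrite addrK E eqxx.
Qed.

Lemma adjacentP i j : adjacent i j -> j = ordS i \/ i = ordS j.
Proof. by move=> /orP[] /eqP; [left|right]. Qed.

Lemma far_sact i j G p : i != j -> ~~ adjacent i j -> cl k p = j ->
  sact i G p = G p /\ sact i G (p - 1) = G (p - 1).
Proof.
move=> ij; rewrite /adjacent negb_or => /andP[nji nij] e.
split; apply: sact_other.
- by rewrite e eq_sym.
- by rewrite clS e eq_sym.
- by apply: contra nji => /eqP <-; rewrite -clS subrK e.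
- by rewrite subrK e eq_sym.
Qed.

Lemma far_up i j G : i != j -> ~~ adjacent i j -> up j (sact i G) = up j G.
Proof.
by move=> ij nij; rewrite /up; have [-> ->] := far_sact G ij nij (cl_ord j).
Qed.

Lemma far_down i j G : i != j -> ~~ adjacent i j -> down j (sact i G) = down j G.
Proof.
by move=> ij nij; rewrite /down; have [-> ->] := far_sact G ij nij (cl_ord j).
Qed.

Lemma sact_window i G p : (1 < k)%N -> cl k p = i ->
  [/\ sact i G (p - 1) = G p, sact i G p = G (p - 1), sact i G (p + 1) = G (p + 1)
   & [/\ sact (ordS i) G (p - 1) = G (p - 1), sact (ordS i) G p = G (p + 1)
       & sact (ordS i) G (p + 1) = G p]].
Proof.
move=> k1 e; have e1 : cl k (p + 1) = ordS i by rewrite clS e.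
have neq x y : 0 < x - y < n -> cl k x != cl k y.
  by move=> xy; apply/eqP => /cl_inj H; have := H ltac:(lia); lia.
split; [exact: sact_pred | exact: sact_at | | split].
- by apply: sact_other; rewrite -e neq //; lia.
- by apply: sact_other; rewrite ?subrK -e1 eq_sym neq //; lia.
- by have := sact_pred G e1; rewrite addrK.
- by rewrite sact_at ?addrK.
Qed.

End Action.

(** * Exchange condition and Matsumoto's theorem *)

Section BraidWords.
Variable k : nat.
Implicit Types (i j s t : 'I_k.+1) (v w a b : seq 'I_k.+1).

(** Commutation and braid moves without cancellation. Unlike [cox_cong], this keeps the length and
    the set of letters, and it holds in the nilCoxeter algebra as well. *)
Inductive brd : seq 'I_k.+1 -> seq 'I_k.+1 -> Prop :=
| brd_comm i j : ~~ adjacent i j -> brd [:: i; j] [:: j; i]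
| brd_braid i : (1 < k)%N -> brd [:: i; ordS i; i] [:: ordS i; i; ordS i]
| brd_refl v : brd v v
| brd_sym v w : brd v w -> brd w v
| brd_trans v w x : brd v w -> brd w x -> brd v x
| brd_cat v v' w w' : brd v v' -> brd w w' -> brd (v ++ w) (v' ++ w').

Lemma brd_cons i v w : brd v w -> brd (i :: v) (i :: w).
Proof. by move=> vw; apply: (@brd_cat [:: i] [:: i]) => //; exact: brd_refl. Qed.

Lemma brd_comm_cons i j v : ~~ adjacent i j -> brd [:: i, j & v] [:: j, i & v].
Proof.
by move=> ij; apply: (brd_cat (brd_comm ij)); exact: brd_refl.
Qed.

Lemma brd_braid_cons i j v : (1 < k)%N -> adjacent i j ->
  brd [:: i, j, i & v] [:: j, i, j & v].
Proof.
move=> k1 ij.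
suff H s : brd [:: s, ordS s, s & v] [:: ordS s, s, ordS s & v].
  by move: ij => /orP[] /eqP ->; [exact: H | apply: brd_sym; exact: H].
by apply: (brd_cat (brd_braid s k1)); exact: brd_refl.
Qed.

Lemma brd_cox v w : brd v w -> cox_cong v w.
Proof.
elim=> {v w}.
- by move=> i j ij; exact/cox_cong_rel/cox_comm.
- by move=> i k1; exact/cox_cong_rel/cox_braid.
- by move=> v; exact: cox_cong_refl.
- by move=> v w _; exact: cox_cong_sym.
- by move=> v w x _ vw _; exact: cox_cong_trans.
- by move=> v v' w w' _ vv' _; exact: cox_cong_cat.
Qed.

Lemma brd_size v w : brd v w -> size v = size w.
Proof.
by elim=> {v w} // => [v w x _ -> _ ->//|v v' w w' _ vv' _ ww']; rewrite !size_cat vv' ww'.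
Qed.

Lemma brd_mem v w : brd v w -> v =i w.
Proof.
elim=> {v w} //.
- by move=> i j _ x; rewrite !inE orbC.
- by move=> i _ x; rewrite !inE; do 2!case: (x == _).
- by move=> v w _ vw y; rewrite vw.
- by move=> v w x _ vw _ wx y; rewrite vw wx.
- by move=> v v' w w' _ vv' _ ww' y; rewrite !mem_cat vv' ww'.
Qed.

Lemma cox_cons i v w : cox_cong v w -> cox_cong (i :: v) (i :: w).
Proof.
by move=> vw; apply: (@cox_cong_cat k [:: i] [:: i]) => //; exact: cox_cong_refl.
Qed.

Lemma cox_catl v v' w : cox_cong v v' -> cox_cong (v ++ w) (v' ++ w).
Proof. by move=> vv'; apply: cox_cong_cat => //; exact: cox_cong_refl. Qed.

Lemma cox_sq_cons i v : cox_cong [:: i, i & v] v.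
Proof.
by apply: (cox_cong_cat (cox_cong_rel (cox_sq i)) (cox_cong_refl v)).
Qed.

End BraidWords.

Section WordAction.
Variables (k : nat) (N : int).
Local Notation n := (k.+1%:Z).
Local Notation X := (qper k N).
Implicit Types (p q m : int) (i j s t : 'I_k.+1) (G H : X) (v w a b : seq 'I_k.+1).

Definition dot w G : X := foldr (@sact k N) G w.

(** Every letter is applied at an ascent. Over [id_qper] this characterizes the reduced words, over
    [base] the reduced words of minimal coset representatives. *)
Fixpoint red w G : bool := if w is i :: v then red v G && up i (dot v G) else true.

Lemma dot_cat v w G : dot (v ++ w) G = dot v (dot w G).
Proof. exact: foldr_cat. Qed.

Lemma red_cat v w G : red (v ++ w) G = red w G && red v (dot w G).
Proof.
by elim: v => [|i v IH] /=; rewrite ?andbT // IH dot_cat andbA.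
Qed.

Definition level i G : bool := G (i%:Z - 1) == G i%:Z.

Lemma levelP i G : level i G = ~~ up i G && ~~ down i G.
Proof. by rewrite /level /up /down -!leNgt eq_le andbC. Qed.

Hypothesis k_gt0 : (0 < k)%N.

Lemma dot_cox v w G : cox_cong v w -> dot v G = dot w G.
Proof.
move=> vw; elim: vw G => {v w}.
- move=> v w [i|i j ij|i k1] G /=.
  + by rewrite sactK.
  + by rewrite sactC.
  + by rewrite sact_braid.
- by [].
- by move=> v w _ IH G; rewrite IH.
- by move=> v w x _ IH _ IH' G; rewrite IH.
- by move=> v v' w w' _ IH _ IH' G; rewrite !dot_cat IH' IH.
Qed.

Lemma dot_brd v w G : brd v w -> dot v G = dot w G.
Proof. by move/brd_cox; exact: dot_cox. Qed.

Lemma dot_rev w G : dot (rev w) (dot w G) = G.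
Proof.
rewrite -dot_cat -[RHS]/(dot [::] G); apply: dot_cox; exact: cox_cong_revl.
Qed.

Hypothesis N_gt0 : 0 < N.
Variable G0 : X.
Hypothesis G0_dominant : forall i, ~~ down i G0.

(** After s the two positions of t carry G (p - 1) and G p + N with N > 0. So in the infinite
    dihedral case an ascent at s is followed by an ascent at t, and alternating words never stop
    being reduced. *)
Lemma up_rank1 s t G : k = 1%N -> s != t -> up s G -> up t (sact s G).
Proof.
move=> k1 st; pose p := s%:Z; have ep : cl k p = s := cl_ord s.
have ep1 : cl k (p + 1) = t.
  apply/val_inj; rewrite clS ep /=; move: st; rewrite -(inj_eq val_inj) /=.
  move: (ltn_ord s) (ltn_ord t); move: (nat_of_ord s) (nat_of_ord t).
  by rewrite k1; case=> [|[|?]] [|[|?]].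
rewrite (upE _ ep) (upE _ ep1) addrK sact_at //.
have -> : p + 1 = p - 1 + n by lia.
by rewrite qfunDn sact_pred // => H; lia.
Qed.

Local Notation pos i := (nat_of_ord i)%:Z.

(** Turns every question about the adjacent residues i and i + 1 into inequalities between the
    values at three consecutive positions, within reach of [lia]. *)
Lemma windowE i : (1 < k)%N ->
  ((forall H, up (ordS i) H = (H (pos i) < H (pos i + 1))%R) *
   (forall H, down (ordS i) H = (H (pos i + 1) < H (pos i))%R) *
   (forall H, level (ordS i) H = (H (pos i) == H (pos i + 1))%R) *
   (forall H, up i H = (H (pos i - 1) < H (pos i))%R) *
   (forall H, down i H = (H (pos i) < H (pos i - 1))%R) *
   (forall H, level i H = (H (pos i - 1) == H (pos i))%R) *
   ((forall H, sact i H (pos i - 1)%R = H (pos i)) *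
    (forall H, sact i H (pos i) = H (pos i - 1)%R) *
    (forall H, sact i H (pos i + 1)%R = H (pos i + 1)%R) *
    (forall H, sact (ordS i) H (pos i - 1)%R = H (pos i - 1)%R) *
    (forall H, sact (ordS i) H (pos i) = H (pos i + 1)%R) *
    (forall H, sact (ordS i) H (pos i + 1)%R = H (pos i))))%type.
Proof.
move=> k1; have ep : cl k (pos i) = i := cl_ord i.
have ep1 : cl k (pos i + 1) = ordS i by rewrite clS ep.
by repeat apply: pair; move=> H; have [? ? ? []] := sact_window k_gt0 H k1 ep;
  rewrite // /level ?(upE _ ep1) ?(downE _ ep1) ?(levelE _ ep1) addrK.
Qed.

(** Induction on the word s :: b. If s and t commute, t is a descent already before s. If they are
    adjacent, the ascent s followed by the descent t orders the three values of the window so that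
    t, and after it s, are descents of [dot b G0]. Two uses of the induction hypothesis bring b to
    the form t s b'', and the braid relation finishes. *)
Lemma exchange a t : red a G0 -> down t (dot a G0) ->
  exists a', brd a (t :: a') /\ red (t :: a') G0.
Proof.
have [m] := ubnP (size a); elim: m a t => // m IH [|s b] t /=.
  by move=> _ _ H; rewrite (negbTE (G0_dominant t)) in H.
rewrite ltnS => szb /andP[rb us] dt.
set G := dot b G0 in us dt.
case: (eqVneq s t) => [e|st].
  by exists b; rewrite -e rb us; split=> //; exact: brd_refl.
case: (boolP (adjacent s t)) => [adj|nadj]; last first.
  move: dt; rewrite far_down // => dt.
  have [b' [bb' /=/andP[rb' ut]]] := IH b t szb rb dt.
  have nadj' : ~~ adjacent t s by rewrite /adjacent orbC.
  have Hb : sact t (dot b' G0) = G by rewrite -[LHS]/(dot (t :: b') G0) -(dot_brd _ bb').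
  have us' : up s (dot b' G0) by rewrite -(far_up (i := t)) // ?Hb // eq_sym.
  exists (s :: b'); split=> /=.
    apply: (brd_trans (brd_cons s bb')); exact: brd_comm_cons.
  by rewrite rb' us' far_up.
have [k1|k1] : k = 1%N \/ (1 < k)%N by lia.
  by have := up_rank1 k1 st us; move: dt; rewrite /up /down; case: ltgtP.
have braid b' b'' : brd b (t :: b') -> red (t :: b') G0 ->
    brd b' (s :: b'') -> red (s :: b'') G0 ->
    up t (sact s (sact t G)) && up s (sact t (sact s (sact t G))) &&
      up t (sact s (sact t (sact s (sact t G)))) ->
    exists a' : seq 'I_k.+1, brd (s :: b) (t :: a') /\ red (t :: a') G0.
  move=> bb' rb' bb'' /=/andP[rb'' _] ups; exists [:: s, t & b'']; split.
    apply: brd_trans (brd_braid_cons b'' k1 adj); apply: brd_cons.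
    by apply: (brd_trans bb'); exact: brd_cons.
  have Hb : dot b'' G0 = sact s (sact t G).
    by rewrite /G (dot_brd _ bb') /= (dot_brd _ bb'') /= !sactK.
  by rewrite /= rb'' Hb.
have step b' : brd b (t :: b') -> red (t :: b') G0 -> down s (sact t G) ->
    exists2 b'', brd b' (s :: b'') & red (s :: b'') G0.
  move=> bb' /=/andP[rb' _]; rewrite /G (dot_brd _ bb') /= sactK // => ds.
  have szb' : (size b' < m)%N by have := brd_size bb'; move: szb => /= /[swap] -> /=; lia.
  by have [b'' []] := IH b' s szb' rb' ds; exists b''.
have main : down t G -> down s (sact t G) -> up t (sact s (sact t G)) &&
    up s (sact t (sact s (sact t G))) &&
    up t (sact s (sact t (sact s (sact t G)))) ->
    exists a' : seq 'I_k.+1, brd (s :: b) (t :: a') /\ red (t :: a') G0.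
  move=> dtG dsG ups; have [b' [bb' rb']] := IH b t szb rb dtG.
  have [b'' bb'' rb''] := step b' bb' rb' dsG.
  exact: braid bb' rb' bb'' rb'' ups.
move: us dt main; case: (adjacentP adj) => ->; rewrite !windowE // => us dt main.
  by apply: main; lia.
by apply: main; lia.
Qed.

Lemma matsumoto v w : red v G0 -> red w G0 -> dot v G0 = dot w G0 -> brd v w.
Proof.
elim: v w => [|i v IH] w rv rw E.
  case: w rw E => [|t w] /=; first by move=> _ _; exact: brd_refl.
  by move=> /andP[_ ut] /(congr1 (down t)); rewrite down_sact // ut (negbTE (G0_dominant t)).
move: rv => /=/andP[rv ui].
have di : down i (dot w G0) by rewrite -E /= down_sact.
have [w' [ww' /=/andP[rw' _]]] := exchange rw di.
apply: (brd_trans _ (brd_sym ww')); apply: brd_cons; apply: IH => //.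
by apply: (can_inj (sactK k_gt0 i)); rewrite -[RHS]/(dot (i :: w') G0) -(dot_brd _ ww').
Qed.

(** Deodhar's lemma: a generator fixing [dot w G0], carried through w, becomes a generator fixing
    G0. The cases are those of [exchange], with an equality in place of one inequality. *)
Lemma level_conj w i : red w G0 -> level i (dot w G0) ->
  exists2 j, level j G0 & cox_cong (i :: w) (w ++ [:: j]).
Proof.
have [m] := ubnP (size w); elim: m w i => // m IH [|t w] i /=.
  by move=> _ _ H; exists i => //; exact: cox_cong_refl.
rewrite ltnS => szw /andP[rw ut] li; set G := dot w G0 in ut li.
case: (eqVneq t i) => [e|ti].
  by move: li; rewrite levelP -e down_sact // ut andbF.
case: (boolP (adjacent t i)) => [adj|nadj]; last first.
  have liG : level i G by move: li; rewrite !levelP far_up // far_down.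
  have [j lj E] := IH w i szw rw liG.
  exists j => //; have nadj' : ~~ adjacent i t by rewrite /adjacent orbC.
  apply: (cox_cong_trans (brd_cox (brd_comm_cons w nadj'))).
  exact: cox_cons.
have [k1|k1] : k = 1%N \/ (1 < k)%N by lia.
  by have := up_rank1 k1 ti ut; move: li; rewrite levelP => /andP[/negbTE->].
have adj' : adjacent i t by rewrite /adjacent orbC.
have main : down i G -> level t (sact i G) ->
    exists2 j, level j G0 & cox_cong [:: i, t & w] (t :: w ++ [:: j]).
  move=> di lt; have [w' [ww' rw']] := exchange rw di.
  have [rw'' E] : red w' G0 /\ dot w' G0 = sact i G.
    by rewrite /G (dot_brd _ ww') /= sactK //; case/andP: rw'.
  rewrite -E in lt.
  have szw' : (size w' < m)%N by have := brd_size ww'; move: szw => /= /[swap] -> /=; lia.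
  have [j lj Ej] := IH w' t szw' rw'' lt; exists j => //.
  apply: (cox_cong_trans (cox_cons i (cox_cons t (brd_cox ww')))).
  apply: (cox_cong_trans (brd_cox (brd_braid_cons w' k1 adj'))).
  apply: (cox_cong_trans (cox_cons t (cox_cons i Ej))).
  apply: cox_cons; apply: (@cox_catl _ (i :: w')).
  exact/cox_cong_sym/brd_cox.
move: ut li main; case: (adjacentP adj) => ->; rewrite !windowE // => ut li main.
  by apply: main; lia.
by apply: main; lia.
Qed.

(** The word is processed from the right. A letter at an ascent is kept, one at a descent is
    cancelled by [exchange], one at a level is passed by [level_conj] to the stabilizer part y. The
    last two cases shorten w, whence the final alternative. *)
Lemma coset_decomposition v : exists w y, [/\ red w G0, all (fun j => level j G0) y,
  cox_cong v (w ++ y), (size w <= size v)%N & red v G0 \/ (size w < size v)%N].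
Proof.
elim: v => [|i v [w [y [rw ly E sz rv]]]].
  by exists [::], [::]; split=> //; [exact: cox_cong_refl | left].
case: (boolP (up i (dot w G0))) => [ui|nui].
  exists (i :: w), y; split=> //=; first by rewrite rw ui.
  - exact: cox_cons.
  - case: rv => [rv|]; last by right.
    rewrite rv /=.
    have : dot v G0 = dot w G0.
      rewrite (dot_cox _ E) dot_cat; congr dot.
      elim: y ly {E} => //= j y IHy /andP[lj /IHy ->].
      by move: lj; rewrite levelP => /andP[? ?]; rewrite sact_level.
    by move=> ->; left.
case: (boolP (down i (dot w G0))) => [di|ndi].
  have [w' [ww' /=/andP[rw' _]]] := exchange rw di.
  have szw := brd_size ww'; rewrite /= in szw.
  exists w', y; split=> //=; [|by lia|by right; lia].
  apply: (cox_cong_trans (cox_cons i E)).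
  apply: (cox_cong_trans (cox_cons i (cox_catl y (brd_cox ww')))).
  exact: cox_sq_cons.
have li : level i (dot w G0) by rewrite levelP nui.
have [j lj Ej] := level_conj rw li.
exists w, (j :: y); split=> //=; [by rewrite lj| |by lia|by right; lia].
apply: (cox_cong_trans (cox_cons i E)).
by apply: (cox_cong_trans (cox_catl y Ej)); rewrite -catA; exact: cox_cong_refl.
Qed.

End WordAction.

(** * Words in the nilCoxeter algebra *)

Section ReducedWords.
Variable k : nat.
Hypothesis k_gt0 : (0 < k)%N.
Local Notation n := (k.+1%:Z).
Implicit Types (p q m : int) (i j : 'I_k.+1) (v w : seq 'I_k.+1).

Definition id_qper : qper k n := @QPer k n id (fun p => erefl).

Lemma id_up i : up i id_qper.
Proof. by rewrite /up /=; lia. Qed.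

Lemma id_dominant i : ~~ down i id_qper.
Proof. by rewrite -up_sact //; rewrite up_sact // /down /=; lia. Qed.

Lemma id_level i : ~~ level i id_qper.
Proof. by rewrite levelP id_up. Qed.

Lemma n_gt0 : 0 < n. Proof. by []. Qed.

Lemma word_prodE w : word_prod w = affSym_of_word w.
Proof.
elim: w => [|i w IH]; first by rewrite /word_prod big_nil.
by rewrite /word_prod big_cons -/(word_prod w) IH -cat1s affSym_of_word_cat.
Qed.

Lemma word_prodP v w : word_prod v = word_prod w <-> cox_cong v w.
Proof. by rewrite !word_prodE; exact: affSym_of_wordP. Qed.

(** No generator fixes the identity, so the stabilizer part y of [coset_decomposition] is empty. A
    word that is not [red] then has a shorter equivalent, and two [red] words of the same element
    have equal length by [matsumoto]. *)
Lemma reducedP w : reduced w <-> red w id_qper.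
Proof.
have [v [y [rv ly E sz rw]]] :=
  coset_decomposition k_gt0 n_gt0 id_dominant w.
have y0 : y = [::] by case: (y) ly => //= j ?; rewrite (negbTE (id_level j)).
rewrite y0 cats0 in E.
split=> [rw'|rw' x /word_prodP xw].
  case: rw => // sz'; have /word_prodP/esym/rw' := E.
  by move=> ?; lia.
have [v' [y' [rv' ly' E' sz' _]]] :=
  coset_decomposition k_gt0 n_gt0 id_dominant x.
have y0' : y' = [::] by case: (y') ly' => //= j ?; rewrite (negbTE (id_level j)).
rewrite y0' cats0 in E'.
have /(dot_cox k_gt0 id_qper) Ew := cox_cong_trans (cox_cong_sym E') xw.
by rewrite -(brd_size (matsumoto k_gt0 n_gt0 id_dominant rv' rw' Ew)).
Qed.

Lemma reduced_wordP (x : affSym k) :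
  word_prod (reduced_word x) = x /\ reduced (reduced_word x).
Proof.
rewrite /reduced_word; apply: (@xgetPex _ [::]
  [set w | word_prod w = x /\ reduced w]%classic).
have [v [y [rv ly E sz rw]]] :=
  coset_decomposition k_gt0 n_gt0 id_dominant (repr x).
have y0 : y = [::] by case: (y) ly => //= j ?; rewrite (negbTE (id_level j)).
rewrite y0 cats0 in E; exists v; split; last exact/reducedP.
by rewrite word_prodE -[RHS]affSym_reprK; apply/affSym_of_wordP/cox_cong_sym.
Qed.

Definition nil_word w : nilCox k := \prod_(i <- w) nil_gen i.

Lemma nil_word_cat v w : nil_word (v ++ w) = nil_word v * nil_word w.
Proof. by rewrite /nil_word big_cat. Qed.

Lemma nil_word_cons i w : nil_word (i :: w) = nil_gen i * nil_word w.
Proof. by rewrite /nil_word big_cons. Qed.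

Lemma nil_word_nil : nil_word [::] = 1.
Proof. by rewrite /nil_word big_nil. Qed.

Lemma nil_genM i j : nil_gen i * nil_gen j = nil_pi (NMul (NGen i) (NGen j)).
Proof. exact: nil_piM. Qed.

Lemma nil_word_brd v w : brd v w -> nil_word v = nil_word w.
Proof.
elim=> {v w} //.
- move=> i j ij; rewrite !nil_word_cons nil_word_nil !mulr1 !nil_genM.
  exact/nil_piP/nil_cong_rel/nil_comm.
- move=> i k1; rewrite !nil_word_cons nil_word_nil !mulr1 !mulrA !nil_genM.
  rewrite -[LHS]/(nil_mul _ _) -[RHS]/(nil_mul _ _) !nil_piM.
  exact/nil_piP/nil_cong_rel/nil_braid.
- by move=> v w x _ -> _ ->.
- by move=> v v' w w' _ vv' _ ww'; rewrite !nil_word_cat vv' ww'.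
Qed.

Lemma nil_gen_sq i : nil_gen i * nil_gen i = 0.
Proof. rewrite nil_genM; exact/nil_piP/nil_cong_rel/nil_sq. Qed.

(** The first letter, from the right, not applied at an ascent is applied at a descent, as there are
    no levels over the identity. [exchange] brings an equal letter next to it, and u_i squared is
    0. *)
Lemma nil_word0 w : ~~ red w id_qper -> nil_word w = 0.
Proof.
elim: w => //= i w IH; rewrite nil_word_cons.
case: (boolP (red w _)) => [rw /= nu|/IH -> _]; last by rewrite mulr0.
have nl : ~~ level i (dot w id_qper).
  apply/negP => /(level_conj k_gt0 n_gt0 id_dominant rw)[j].
  by rewrite (negbTE (id_level j)).
have di : down i (dot w id_qper) by move: nl; rewrite levelP nu negbK.
have [w' [/nil_word_brd -> _]] := exchange k_gt0 n_gt0 id_dominant rw di.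
by rewrite nil_word_cons mulrA nil_gen_sq mul0r.
Qed.

Lemma nil_ofE w : red w id_qper -> nil_of (word_prod w) = nil_word w.
Proof.
move=> rw; have [E R] := reduced_wordP (word_prod w).
apply: nil_word_brd; apply: (matsumoto k_gt0 n_gt0 id_dominant) => //.
  exact/reducedP.
by apply: (dot_cox k_gt0); apply/word_prodP.
Qed.

End ReducedWords.

(* The module of cores in dual form: a in the algebra sends a functional phi to
   G |-> phi (a G), which is the right action of the algebra on functionals. *)
Section CoreModule.
Variable k : nat.
Hypothesis k_gt0 : (0 < k)%N.
Local Notation n := (k.+1%:Z).
Local Notation X := (qper k 1).
Implicit Types (i j : 'I_k.+1) (v w : seq 'I_k.+1) (G : X) (phi : X -> int).

Fixpoint eval (x : nil_term k) phi G : int :=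
  match x with
  | NGen i => if up i G then phi (sact i G) else 0
  | NZero => 0
  | NOne => phi G
  | NOpp y => - eval y phi G
  | NAdd y z => eval y phi G + eval z phi G
  | NMul y z => eval z (eval y phi) G
  end.

Lemma evalD x phi psi G :
  eval x (fun H => phi H + psi H) G = eval x phi G + eval x psi G.
Proof.
elim: x phi psi G => //=.
- by move=> i phi psi G; case: ifP; rewrite ?addr0.
- by move=> y IH phi psi G; rewrite IH opprD.
- by move=> y IHy z IHz phi psi G; rewrite IHy IHz addrACA.
- move=> y IHy z IHz phi psi G; rewrite -IHz; congr (eval z _ G).
  by apply/funext => H; exact: IHy.
Qed.

Lemma eval_cong x y : nil_cong x y -> eval x = eval y.
Proof.
move=> xy; apply/funext => phi; apply/funext => G; elim: xy phi G => {x y} //=.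
- move=> x y [i|i j ij|i k1] phi G /=.
  + by case: ifP => // ui; rewrite up_sact //; move: ui; rewrite /up /down; case: ltgtP.
  + case: (eqVneq i j) => [->//|nij].
    have nji : j != i by rewrite eq_sym.
    have ij' : ~~ adjacent j i by rewrite /adjacent orbC.
    rewrite !far_up // sactC //.
    by case: (up i G); case: (up j G).
  (* Both sides of the braid relation are nonzero exactly when a < b < c. *)
  + rewrite !windowE //; set a := G _; set b := G _; set c := G _.
    rewrite sact_braid //.
    by case: (ltP a b) => ?; case: (ltP b c) => ?; case: (ltP a c) => ? //; lia.
- by move=> x y z _ IH _ IH' phi G; rewrite IH.
- by move=> x x' _ IH phi G; rewrite IH.
- by move=> x x' y y' _ IH _ IH' phi G; rewrite IH IH'.
- move=> x x' y y' _ IH _ IH' phi G; rewrite IH'; congr (eval y' _ G).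
  by apply/funext => H; rewrite IH.
- by move=> x y z phi G; rewrite addrA.
- by move=> x y phi G; rewrite addrC.
- by move=> x phi G; rewrite add0r.
- by move=> x phi G; rewrite addNr.
- by move=> x y z phi G; exact: evalD.
Qed.

Definition act (a : nilCox k) := eval (repr a).

Lemma act_pi x : act (nil_pi x) = eval x.
Proof. exact/eval_cong/nil_cong_repr. Qed.

Lemma actD a b phi G : act (a + b) phi G = act a phi G + act b phi G.
Proof. by rewrite -[a + b]/(nil_add a b) /nil_add act_pi. Qed.

Lemma actN a phi G : act (- a) phi G = - act a phi G.
Proof. by rewrite -[- a]/(nil_opp a) /nil_opp act_pi. Qed.

Lemma actM a b phi : act (a * b) phi = act b (act a phi).
Proof. by rewrite -[a * b]/(nil_mul a b) /nil_mul act_pi. Qed.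

Lemma act1 phi : act 1 phi = phi.
Proof. by rewrite act_pi. Qed.

Lemma act0 phi G : act 0 phi G = 0.
Proof. by rewrite act_pi. Qed.

Lemma actB a b phi G : act (a - b) phi G = act a phi G - act b phi G.
Proof. by rewrite actD actN. Qed.

Lemma act_sum (I : Type) (r : seq I) (P : pred I) (F : I -> nilCox k) phi G :
  act (\sum_(x <- r | P x) F x) phi G = \sum_(x <- r | P x) act (F x) phi G.
Proof. by elim/big_rec2: _ => [|x y z _ <-]; [exact: act0 | exact: actD]. Qed.

Lemma actMn a m phi G : act (a *~ m) phi G = act a phi G * m.
Proof.
have nat_case (u : nat) : act (a *+ u) phi G = act a phi G * u%:Z.
  elim: u => [|u IH]; first by rewrite mulr0n act0 mulr0.
  by rewrite mulrS actD IH intS mulrDr mulr1.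
case: m => u; first exact: nat_case.
by rewrite NegzE mulrNz actN nat_case mulrN.
Qed.

Lemma act_word w phi G :
  act (nil_word w) phi G = if red w G then phi (dot w G) else 0.
Proof.
elim: w phi G => [|i w IH] phi G; first by rewrite nil_word_nil act1.
rewrite nil_word_cons actM IH act_pi /=.
by case: (red w G).
Qed.

End CoreModule.

(** * Cores and bounded partitions *)

Section BaseCore.
Variable k : nat.
Hypothesis k_gt0 : (0 < k)%N.
Local Notation n := (k.+1%:Z).
Local Notation X := (qper k 1).
Implicit Types (p q m : int) (i j : 'I_k.+1) (v w : seq 'I_k.+1) (G H : X).

Definition base : X.
Proof. by exists (fun p => (p %/ n)%Z) => p; rewrite divzDr // divzz. Defined.

Lemma baseE p m : 0 <= p - m * n < n -> base p = m.
Proof.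
move=> H; rewrite /base /= -(subrK (m * n) p) addrC divzMDl //.
by rewrite divz_small ?addr0.
Qed.

Lemma base_homo p q : p <= q -> base p <= base q.
Proof. by move=> pq; rewrite /base /=; exact: lez_pdiv2r. Qed.

Lemma base_dominant i : ~~ down i base.
Proof. by rewrite /down -leNgt; apply: base_homo; lia. Qed.

(** Identifies the stabilizer part in [coset_decomposition] with W_0. *)
Lemma base_level i : level i base = (i != ord0).
Proof.
have il := ltn_ord i; have e : base i%:Z = 0 by apply: baseE; lia.
rewrite /level e; case: (eqVneq i ord0) => [->|i0].
  by rewrite (_ : _ - _ = -1) // (@baseE _ (-1)) //; lia.
have : (0 < i)%N by rewrite lt0n.
by move=> i1; rewrite (@baseE _ 0) //; lia.
Qed.

Lemma dot_id N (w : seq 'I_k.+1) (G : qper k N) p : dot w G p = G (dot w (id_qper k) p).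
Proof. by elim: w p => //= i w IH p. Qed.

Lemma red_base_size v w : red v base -> red w base -> dot v base = dot w base ->
  size v = size w.
Proof.
by move=> rv rw E; apply: brd_size; exact: (matsumoto k_gt0 _ base_dominant).
Qed.

Lemma red_base_nil_word v w : red v base -> red w base ->
  dot v base = dot w base -> nil_word v = nil_word w.
Proof.
by move=> rv rw E; apply: nil_word_brd; exact: (matsumoto k_gt0 _ base_dominant).
Qed.

Lemma base_decomposition v : exists w y, [/\ red w base, all (fun j => j != ord0) y,
  cox_cong v (w ++ y), (size w <= size v)%N & red v base \/ (size w < size v)%N].
Proof.
have [w [y [rw ly E sz rv]]] := coset_decomposition k_gt0 (isT : 0 < 1 :> int) base_dominant v.
exists w, y; split=> //; apply/allP => j /(allP ly).
by rewrite base_level.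
Qed.

Lemma dot_W0 y : all (fun j => j != ord0) y -> dot y base = base.
Proof.
elim: y => //= j y IH /andP[j0 /IH ->].
by move: j0; rewrite -base_level levelP => /andP[? ?]; rewrite sact_level.
Qed.

Lemma cox_length_word w : (cox_length (word_prod w) <= size w)%N.
Proof.
have [E R] := reduced_wordP k_gt0 (word_prod w).
by apply: R; rewrite E.
Qed.

Lemma word_prod_cat v w : word_prod (v ++ w) = (word_prod v * word_prod w)%g.
Proof. by rewrite !word_prodE affSym_of_word_cat. Qed.

(** Otherwise the decomposition writes x as a shorter word w times y in W_0, and multiplying x by
    the inverse of y gives a shorter element of the coset. *)
Lemma min_coset_rep_red (x : affSym k) : min_coset_rep x -> red (reduced_word x) base.
Proof.
move=> mx; have [Ex _] := reduced_wordP k_gt0 x.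
have [w [y [rw ly E sz [//|lt]]]] := base_decomposition (reduced_word x).
have /mx : in_W0 (word_prod (rev y)) by exists (rev y); rewrite ?all_rev.
rewrite -[in leqRHS]Ex -word_prod_cat.
have -> : word_prod (reduced_word x ++ rev y) = word_prod w.
  apply/word_prodP; apply: (cox_cong_trans (cox_catl (rev y) E)).
  rewrite -catA -[X in cox_cong _ X]cats0.
  apply: cox_cong_cat; first exact: cox_cong_refl.
  by have := cox_cong_revl (rev y); rewrite revK.
by move=> /leq_trans/(_ (cox_length_word w)); rewrite /cox_length leqNgt lt.
Qed.

Lemma red_min_coset_rep w : red w base -> min_coset_rep (word_prod w).
Proof.
move=> rw _ [y ly <-]; rewrite -word_prod_cat.
have [/word_prodP E _] := reduced_wordP k_gt0 (word_prod (w ++ y)).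
have [w' [y' [rw' ly' E' sz _]]] := base_decomposition (reduced_word (word_prod (w ++ y))).
have Ed : dot w' base = dot w base.
  rewrite -{1}(dot_W0 ly') -dot_cat -(dot_cox k_gt0 _ E') (dot_cox k_gt0 _ E).
  by rewrite dot_cat dot_W0.
rewrite -(red_base_size rw rw' (esym Ed)) in sz.
exact: leq_trans (cox_length_word w) sz.
Qed.

Definition reachable G := exists2 w, red w base & G = dot w base.

Lemma reachable_dot w : reachable (dot w base).
Proof.
have [v [y [rv ly E _ _]]] := base_decomposition w.
by exists v => //; rewrite (dot_cox k_gt0 _ E) dot_cat dot_W0.
Qed.

Lemma reachable_word w G : reachable G -> reachable (dot w G).
Proof. by case=> v _ ->; rewrite -dot_cat; exact: reachable_dot. Qed.

End BaseCore.

(** * Beads, gaps and hook lengths *)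

Section Partitions.
Implicit Types (nu la : seq nat) (p q : nat).

Lemma part_anti nu p q : sorted geq nu -> (p <= q)%N -> (part nu q <= part nu p)%N.
Proof.
move=> snu pq; rewrite /part; case: (ltnP q (size nu)) => [qs|sq]; last by rewrite nth_default.
have tr : transitive geq by move=> x y z; rewrite /geq => yx xz; exact: leq_trans xz yx.
by apply: (sorted_leq_nth tr _ _ snu); rewrite ?inE //; [exact: leqnn | exact: leq_ltn_trans qs].
Qed.

Lemma conj_partP nu p q : sorted geq nu -> (p < conj_part nu q)%N = (q < part nu p)%N.
Proof.
rewrite /conj_part /part; elim: nu p => [|x nu IH] p; first by rewrite nth_nil.
move=> /[dup] sxnu /= /path_sorted snu.
case: (ltnP q x) => [qx|xq]; first by case: p => [|p] //=; rewrite ltnS IH.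
have -> : count (fun y => q < y)%N nu = 0%N.
  apply/eqP; rewrite -leqn0 leqNgt -has_count; apply/hasPn => y /(nthP 0%N)[j _ <-].
  by rewrite -leqNgt; apply: leq_trans xq; apply: (@part_anti (x :: nu) 0%N j.+1).
rewrite ltn0; apply/esym/negbTE; rewrite -leqNgt; apply: leq_trans xq.
exact: (@part_anti (x :: nu) 0%N p).
Qed.

Lemma part_filter nu p : sorted geq nu -> part [seq x <- nu | 0 < x]%N p = part nu p.
Proof.
rewrite /part; elim: nu p => // x nu IH p /[dup] sxnu /= /path_sorted snu.
case: (posnP x) => [x0|x1]; last by case: p => //= p; exact: IH.
have z j : nth 0%N (x :: nu) j = 0%N.
  by have := @part_anti (x :: nu) 0%N j sxnu (leq0n j); rewrite /part x0 leqn0 => /eqP.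
rewrite [RHS]z; case: (ltnP p (size [seq x <- nu | 0 < x]%N)) => [ps|]; last exact: nth_default.
by rewrite IH //; exact: (z p.+1).
Qed.

Lemma filter_partition nu : sorted geq nu -> is_partition [seq x <- nu | 0 < x]%N.
Proof.
move=> snu; apply/andP; split; last by rewrite mem_filter.
by apply: sorted_filter => // x y z; rewrite /geq => yx xz; exact: leq_trans xz yx.
Qed.

Lemma part_gt0 nu p : is_partition nu -> (0 < part nu p)%N = (p < size nu)%N.
Proof.
move=> /andP[_ n0]; case: (ltnP p (size nu)) => [ps|]; last by move=> ?; rewrite /part nth_default.
by rewrite lt0n; apply: contraNneq n0 => <-; exact: mem_nth.
Qed.

Lemma part_inj nu la : is_partition nu -> is_partition la -> part nu =1 part la -> nu = la.
Proof.
move=> pn pl E.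
have s_le a b : is_partition a -> is_partition b -> part a =1 part b -> (size a <= size b)%N.
  move=> pa pb Eab; rewrite leqNgt -(part_gt0 _ pa) Eab part_gt0 // ltnn //.
apply: (@eq_from_nth _ 0%N) => [|p _]; last exact: E.
by apply/eqP; rewrite eqn_leq !s_le.
Qed.

(** The Maya diagram of nu; for a nonempty row this is the content of its last box. The
    complementary positions, the gaps, are q - [conj_part nu q], one for each column q, and a hook
    length is the distance from a bead down to a gap. *)
Definition bead nu p : int := (part nu p)%:Z - p%:Z - 1.

Lemma bead_lt nu p q : sorted geq nu -> (p < q)%N -> bead nu q < bead nu p.
Proof. by move=> /part_anti a /[dup] /ltnW/a; rewrite /bead; lia. Qed.

Lemma bead_inj nu : sorted geq nu -> injective (bead nu).
Proof.
move=> snu p q E; case: (ltngtP p q) => // /(bead_lt snu); lia.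
Qed.

Lemma hook_bead nu p q : sorted geq nu -> (q < part nu p)%N ->
  (hook nu p q)%:Z = bead nu p - (q%:Z - (conj_part nu q)%:Z).
Proof. by move=> snu qp; have := conj_partP p q snu; rewrite qp /hook /bead; lia. Qed.

Lemma bead_neq_empty nu p q : sorted geq nu -> bead nu p != q%:Z - (conj_part nu q)%:Z.
Proof. by move=> /(conj_partP p q); rewrite /bead; case: ltnP; lia. Qed.

(** If r beads lie above e, the column is q = e + r, and its length is r. *)
Lemma empty_column nu (e : int) : sorted geq nu -> (forall p, bead nu p != e) ->
  exists q : nat, e = q%:Z - (conj_part nu q)%:Z.
Proof.
move=> snu ne.
have ex : exists p, bead nu p < e.
  exists (size nu + `|e|.+1)%N; rewrite /bead /part nth_default; first by lia.
  by rewrite leq_addr.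
case: (ex_minnP ex) => r er minr.
have e_r : 0 <= e + r%:Z by move: er; rewrite /bead; lia.
exists (absz (e + r%:Z)%R); rewrite gez0_abs //.
suff -> : conj_part nu (absz (e + r%:Z)%R) = r by lia.
have := conj_partP r (absz (e + r%:Z)%R) snu.
have er' : ((absz (e + r%:Z)%R) < part nu r)%N = false by move: er; rewrite /bead; lia.
rewrite er' => c1.
case: r => [|r] in er minr e_r er' c1 *; first by lia.
have := conj_partP r (absz (e + r.+1%:Z)%R) snu.
have : e < bead nu r.
  by rewrite lt_neqAle eq_sym ne leNgt /=; apply/negP => /minr; lia.
rewrite /bead => H.
have -> : ((absz (e + r.+1%:Z)%R) < part nu r)%N by lia.
by move=> c2; lia.
Qed.

(* From the bottom row upwards, the number of small hooks of a row
   determines its length. *)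
Lemma core_row k nu la p : is_core k.+1 nu -> is_core k.+1 la ->
  (forall q, (p < q)%N -> part nu q = part la q) ->
  count (fun q => hook nu p q <= k)%N (iota 0 (part nu p)) =
  count (fun q => hook la p q <= k)%N (iota 0 (part la p)) ->
  (part nu p <= part la p)%N -> part nu p = part la p.
Proof.
move=> [/andP[sn _] cn] [/andP[sl _] cl] below E le.
apply/eqP; rewrite eqn_leq le leqNgt; apply/negP => lt.
set x := part nu p in E le lt; set y := part la p in E le lt.
pose d := (y - x)%N; have yE : y = (x + d)%N by rewrite /d subnKC.
have d0 : (0 < d)%N by rewrite /d subn_gt0.
have conjE q : (q < x)%N -> conj_part nu q = conj_part la q.
  move=> qx; apply/eqP; rewrite eqn_leq; apply/andP; split; rewrite leqNgt; apply/negP.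
    set r := conj_part la q => rc.
    have := conj_partP r q sl; rewrite ltnn; rewrite conj_partP // in rc.
    case: (ltnP p r) => [/below <-|rp]; first by rewrite rc.
    by rewrite (leq_trans (leq_trans qx le) (part_anti sl rp)).
  set r := conj_part nu q => rc.
  have := conj_partP r q sn; rewrite ltnn; rewrite conj_partP // in rc.
  case: (ltnP p r) => [/below ->|rp]; first by rewrite rc.
  by rewrite (leq_trans qx (part_anti sn rp)).
have hook1 q : (q < x)%N -> hook la p q = (hook nu p q + d)%N.
  by move=> qx; rewrite /hook conjE // -/x -/y yE; (clear E; lia).
have hook2 q : (x <= q < y)%N -> hook la p q = (y - q)%N.
  move=> /andP[xq qy]; have c1 : (p < conj_part la q)%N by rewrite conj_partP.
  have c2 : (p.+1 < conj_part la q)%N = false.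
    rewrite conj_partP // -below //; apply/negbTE; rewrite -leqNgt.
    by apply: leq_trans xq; exact: part_anti.
  by rewrite /hook -/y; (clear E; lia).
(* Otherwise the cell of la in column y - n lies in the new part of the row and has hook length y -
   (y - n) = n. *)
have dk : (d <= k)%N.
  rewrite leqNgt; apply/negP => kd.
  have := cl p (y - k.+1)%N; rewrite -/y hook2; last by (clear E; lia).
  by move=> /(_ ltac:((clear E; lia))); (clear E; lia).
rewrite yE iotaD count_cat add0n in E.
have E2 : count (fun q => hook la p q <= k)%N (iota x d) = d.
  rewrite -[RHS](size_iota x d); apply/eqP; rewrite -all_count.
  by apply/allP => q; rewrite mem_iota => qx; rewrite hook2; lia.
have E1 : count (fun q => hook la p q <= k)%N (iota 0 x) =
    count (fun q => hook nu p q + d <= k)%N (iota 0 x).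
  by apply: eq_in_count => q; rewrite mem_iota => qx; rewrite hook1; lia.
rewrite E1 E2 in E.
(* The d further cells of la all have small hooks, so exactly d small hooks of nu must exceed k when
   d is added to them. These are distinct and lie between k - d + 1 and k, but k - d + 1 would
   become n in la, which is a core: d values for d - 1 places. *)
pose s := [seq hook nu p q | q <- iota 0 x & (k - d < hook nu p q <= k)%N].
have szs : size s = d.
  rewrite size_map size_filter.
  apply/eqP; rewrite -(eqn_add2l (count (fun q => hook nu p q + d <= k)%N (iota 0 x))).
  rewrite -E -(count_predUI (fun q => hook nu p q + d <= k)%N).
  rewrite [X in (_ + X)%N](eq_count (a2 := pred0)); last first.
    by move=> q /=; apply/negbTE/negP => /and3P[]; move: dk; clear; move: d (hook _ _ _) => e h; lia.
  rewrite count_pred0 addn0; apply/eqP/eq_count => q /=.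
  by move: dk; clear; move: d (hook _ _ _) => e h; lia.
have us : uniq s.
  rewrite map_inj_in_uniq ?filter_uniq ?iota_uniq // => q q'.
  rewrite !mem_filter !mem_iota !add0n => /andP[_ /andP[_ qx]] /andP[_ /andP[_ q'x]].
  move/(congr1 Posz); rewrite !hook_bead //; clear E E1 E2 szs.
  have anti a b : (a <= b)%N -> (conj_part nu b <= conj_part nu a)%N.
    by move=> ab; apply: sub_count => z /=; apply: leq_ltn_trans.
  case: (leqP q q') => [/[dup]/anti|/[dup]/ltnW/anti]; lia.
have := @uniq_leq_size _ s (iota (k - d).+2 d.-1) us; rewrite size_iota szs.
move=> /(_ _)/wrap[z|]; last by lia.
case/mapP => q; rewrite mem_filter mem_iota => /andP[hq qx] ->; rewrite mem_iota.
have := cl p q; rewrite hook1; last by lia.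
by rewrite -/y => /(_ ltac:(lia)); lia.
Qed.

Lemma bounded_of_core_inj k nu la : is_core k.+1 nu -> is_core k.+1 la ->
  bounded_of_core k nu = bounded_of_core k la -> nu = la.
Proof.
move=> cn cl E; have [[pn _] [pl _]] := (cn, cl).
have szE : size nu = size la by have := congr1 size E; rewrite !size_map !size_iota.
apply: part_inj => // p.
have [m] := ubnP (size nu - p); elim: m p => // m IH p mp.
case: (ltnP p (size nu)) => [ps|]; last by move=> ?; rewrite /part !nth_default -?szE.
have below q : (p < q)%N -> part nu q = part la q by move=> pq; apply: IH; lia.
have Ep := congr1 (nth 0%N ^~ p) E.
rewrite /= !(nth_map 0%N) ?size_iota -?szE // !nth_iota -?szE // in Ep.
case: (leqP (part nu p) (part la p)) => [|/ltnW] le; first exact: core_row cn cl below Ep le.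
apply/esym; apply: core_row cl cn _ (esym Ep) le => q pq; exact/esym/below.
Qed.

End Partitions.

(** * Cores as quasi-periodic functions and the Lapointe-Morse bijection *)

Section CoresAndPartitions.
Variable k : nat.
Hypothesis k_gt0 : (0 < k)%N.
Local Notation n := (k.+1%:Z).
Local Notation X := (qper k 1).
Implicit Types (nu la : seq nat) (p q : nat) (b e m : int) (i : 'I_k.+1) (G H : X).

Definition diagram_of nu G :=
  is_partition nu /\ forall b, (G b < 0) <-> exists p, b = bead nu p.

(** The signs determine the values: as N = 1, a shift by m periods changes a value by m. *)
Lemma diagram_inj nu G H : diagram_of nu G -> diagram_of nu H -> G = H.
Proof.
have le (A B : X) : (forall b, B b < 0 -> A b < 0) -> forall b, A b <= B b.
  move=> AB b; rewrite leNgt; apply/negP => lt.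
  by have := AB (b + (- A b) * n); rewrite !qfunDM; lia.
move=> [_ dG] [_ dH]; apply: qper_eq => b; apply/eqP; rewrite eq_le.
by rewrite !le // => e; [move/dG/dH | move/dH/dG].
Qed.

Lemma diagram_fun nu la G : diagram_of nu G -> diagram_of la G -> nu = la.
Proof.
move=> [pn dn] [pl dl]; apply: part_inj => // p.
have [sn sl] : sorted geq nu /\ sorted geq la by case/andP: pn; case/andP: pl.
suff : bead nu p = bead la p by rewrite /bead; lia.
have step (a c : seq nat) r : sorted geq a -> sorted geq c ->
    (forall z, (exists x, z = bead a x) -> exists x, z = bead c x) ->
    (forall x, (x < r)%N -> bead a x = bead c x) -> bead a r <= bead c r.
  move=> sa sc ac E; have [x Ex] := ac _ (ex_intro _ r erefl).
  case: (ltnP x r) => [xr|]; last first.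
    by rewrite leq_eqVlt Ex => /orP[/eqP->//|/(bead_lt sc)/ltW].
  by have := bead_lt sa xr; rewrite Ex E // ltxx.
have [m] := ubnP p; elim: m p => // m IH p pm.
have E x : (x < p)%N -> bead nu x = bead la x by move=> xp; apply: IH; lia.
apply/eqP; rewrite eq_le !step // => [z|x /E ->//|z]; [move/dl/dn|move/dn/dl]; done.
Qed.

Lemma diagram_base : diagram_of [::] (base k).
Proof.
split=> // b; rewrite /bead /part; split=> [lt|[p ->]].
  exists (absz (b + 1)); rewrite nth_nil.
  suff : b < 0 by lia.
  by rewrite ltNge; apply/negP => /(base_homo k); rewrite [base k 0](baseE (m := 0)); lia.
rewrite nth_nil; apply: (@le_lt_trans _ _ (base k (-1))); first by apply: base_homo; lia.
by rewrite (baseE (m := -1)); lia.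
Qed.

Lemma diagram_neg nu G b : diagram_of nu G -> (G b < 0) <-> exists p, b = bead nu p.
Proof. by case. Qed.

Section Boxes.
Variables (i : 'I_k.+1) (nu : seq nat) (G : X).
Hypothesis dG : diagram_of nu G.

Let snu : sorted geq nu. Proof. by case: dG => /andP[]. Qed.
Let bead_neg p : G (bead nu p) < 0. Proof. by apply/(diagram_neg _ dG); exists p. Qed.

Lemma bead_succ p : (G (bead nu p + 1) < 0) = (p != 0)%N && (part nu p == part nu p.-1).
Proof.
apply/idP/andP => [/(diagram_neg _ dG)[x Ex]|[p0 /eqP E]]; last first.
  by apply/(diagram_neg _ dG); exists p.-1; rewrite /bead E; lia.
have xp : (x < p)%N.
  rewrite ltnNge leq_eqVlt; apply/negP => /orP[/eqP E|/(bead_lt snu)]; last by lia.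
  by rewrite E in Ex; lia.
have := part_anti snu (ltnW xp); move: Ex; rewrite /bead => Ex h.
have xE : x = p.-1 by lia.
by rewrite -xE; split; lia.
Qed.

Lemma bead_pred p : (G (bead nu p - 1) < 0) = (part nu p.+1 == part nu p).
Proof.
apply/idP/eqP => [/(diagram_neg _ dG)[x Ex]|Ep]; last by apply/(diagram_neg _ dG); exists p.+1; rewrite /bead Ep; lia.
have xp : (p < x)%N.
  rewrite ltnNge leq_eqVlt; apply/negP => /orP[/eqP E'|/(bead_lt snu)]; last by lia.
  by rewrite E' in Ex; lia.
have := part_anti snu xp; have := part_anti snu (leqnSn p); move: Ex; rewrite /bead; lia.
Qed.

Lemma addableE p :
  addable i nu p = (0 <= G (bead nu p + 1)) && (cl k (bead nu p + 1) == i).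
Proof.
rewrite /addable contentE (_ : _ - _ = bead nu p + 1); last by rewrite /bead; lia.
congr (_ && _); rewrite leNgt bead_succ negb_and negbK.
case: p => [//|p]; rewrite -[p.+1.-1]/p [(part nu _ < _)%N]ltn_neqAle (part_anti snu (leqnSn p)) andbT.
case: (ltnP p (size nu)) => // sp.
by rewrite /part !nth_default ?eqxx // (leq_trans sp).
Qed.

Lemma removableE p :
  removable i nu p = (0 <= G (bead nu p - 1)) && (cl k (bead nu p) == i).
Proof.
rewrite /removable leNgt bead_pred ltn_neqAle (part_anti snu (leqnSn p)) andbT.
case: eqP => // ne; rewrite contentE; congr (_ && (cl k _ == i)).
have := part_anti snu (leqnSn p); rewrite /bead; lia.
Qed.

Lemma addable_gt q : (size nu < q)%N -> addable i nu q = false.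
Proof. by move=> sq; rewrite /addable leqNgt sq. Qed.

Lemma add_boxes_sorted :
  sorted geq [seq (part nu p + addable i nu p)%N | p <- iota 0 (size nu).+1].
Proof.
apply/(sortedP 0%N) => q; rewrite size_map size_iota => qs.
rewrite !(nth_map 0%N) ?size_iota // 1?ltnW // !nth_iota // 1?ltnW // !add0n.
have := part_anti snu (leqnSn q); rewrite /geq [addable i nu q.+1]addableE leNgt bead_succ /=.
by case: eqP => /= h1 h2; lia.
Qed.

Lemma add_boxes_part p : part (add_boxes i nu) p = (part nu p + addable i nu p)%N.
Proof.
rewrite part_filter; last exact: add_boxes_sorted.
rewrite {1}/part; case: (ltnP p (size nu).+1) => ps.
  by rewrite (nth_map 0%N) ?size_iota // nth_iota.
by rewrite nth_default ?size_map ?size_iota // addable_gt // /part nth_default // ltnW.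
Qed.

Lemma remove_boxes_sorted :
  sorted geq [seq (part nu p - removable i nu p)%N | p <- iota 0 (size nu)].
Proof.
apply/(sortedP 0%N) => q; rewrite size_map size_iota => qs.
rewrite !(nth_map 0%N) ?size_iota // 1?ltnW // !nth_iota // 1?ltnW // !add0n.
have := part_anti snu (leqnSn q); rewrite /geq [removable i nu q]removableE leNgt bead_pred /=.
by case: eqP => /= h1 h2; lia.
Qed.

Lemma remove_boxes_part p : part (remove_boxes i nu) p = (part nu p - removable i nu p)%N.
Proof.
rewrite part_filter; last exact: remove_boxes_sorted.
rewrite {1}/part; case: (ltnP p (size nu)) => ps.
  by rewrite (nth_map 0%N) ?size_iota // nth_iota.
by rewrite nth_default ?size_map ?size_iota // /part nth_default.
Qed.

Lemma addable_size p : addable i nu p -> (p < (size nu).+1)%N.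
Proof. by rewrite ltnNge; apply: contraL => /addable_gt ->. Qed.

Lemma removable_size p : removable i nu p -> (p < size nu)%N.
Proof.
move=> /andP[lt _]; apply: contraLR lt; rewrite -leqNgt => sp.
by rewrite [part nu p]nth_default.
Qed.

End Boxes.

(** An addable box of content i is a position p of class i with G (p - 1) < 0 <= G p. By periodicity
    it forces an ascent at every position of class i, so no box of content i is removable, and the
    exchange of values moves exactly the beads of the addable rows. Removable boxes are dual, with
    descents. *)
Lemma diagram_gen_act i nu G : diagram_of nu G ->
  diagram_of (gen_act i nu) (sact i G).
Proof.
move=> dG; have snu : sorted geq nu by case: dG => /andP[].
have bead_neg p : G (bead nu p) < 0 by apply/(diagram_neg _ dG); exists p.
have neg_bead b : G b < 0 -> exists p, b = bead nu p by move/(diagram_neg _ dG).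
have cl_not b : cl k b = i -> (cl k (b + 1) == i) = false.
  by move=> <-; exact/negbTE/clS_neq.
rewrite /gen_act; case: ifP => [/hasP[p _]|/hasPn noadd].
  rewrite (addableE _ dG) => /andP[Gp /eqP clp].
  have ui : up i G by rewrite (upE _ clp) addrK; exact: lt_le_trans Gp.
  have upb b : cl k b = i -> G (b - 1) < G b by move=> e; rewrite -(upE _ e).
  split; first exact/filter_partition/(add_boxes_sorted i dG).
  have beadE q : bead (add_boxes i nu) q = bead nu q + (addable i nu q)%:Z.
    by rewrite /bead (add_boxes_part i dG); lia.
  move=> b; split=> [Gb|[q ->]].
    case: (eqVneq (cl k b) i) => [e|ne].
      rewrite sact_at // in Gb; case: (ltP (G b) 0) => [/neg_bead[q E]|Gb0].
        by exists q; rewrite beadE (addableE _ dG) -E (cl_not _ e) andbF addr0.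
      have [q E] := neg_bead _ Gb; exists q.
      by rewrite beadE (addableE _ dG) -E subrK Gb0 e eqxx subrK.
    case: (eqVneq (cl k (b + 1)) i) => [e1|ne1].
      have := sact_pred k_gt0 G e1; rewrite addrK => Eb; rewrite Eb in Gb.
      have := upb _ e1; rewrite addrK => /lt_trans/(_ Gb)/neg_bead[q E]; exists q.
      by rewrite beadE (addableE _ dG) -E leNgt Gb addr0.
    rewrite sact_other // in Gb; have [q E] := neg_bead _ Gb; exists q.
    by rewrite beadE (addableE _ dG) -E (negbTE ne1) andbF addr0.
  rewrite beadE (addableE _ dG); clear b; set b := bead nu q.
  case: (ltP (G (b + 1)) 0) => [Gb|Gb]; rewrite ?andTb ?andFb.
    rewrite addr0; case: (eqVneq (cl k b) i) => [e|ne].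
      by rewrite sact_at //; exact: lt_trans (upb _ e) (bead_neg q).
    case: (eqVneq (cl k (b + 1)) i) => [e1|ne1].
      by have := sact_pred k_gt0 G e1; rewrite addrK => ->.
    by rewrite sact_other // bead_neg.
  case: (eqVneq (cl k (b + 1)) i) => [e1|ne1]; first by rewrite sact_at // addrK bead_neg.
  rewrite addr0; case: (eqVneq (cl k b) i) => [e|ne]; last by rewrite sact_other // bead_neg.
  by rewrite sact_at //; exact: lt_trans (upb _ e) (bead_neg q).
case: ifP => [/hasP[p _]|/hasPn norem].
  rewrite (removableE _ dG) => /andP[Gp /eqP clp].
  have di : down i G by rewrite (downE _ clp); exact: lt_le_trans Gp.
  have downb b : cl k b = i -> G b < G (b - 1) by move=> e; rewrite -(downE _ e).
  split; first exact/filter_partition/(remove_boxes_sorted i dG).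
  have beadE q : bead (remove_boxes i nu) q = bead nu q - (removable i nu q)%:Z.
    rewrite /bead (remove_boxes_part i dG).
    by case: (boolP (removable i nu q)) => [/andP[]|]; lia.
  move=> b; split=> [Gb|[q ->]].
    case: (eqVneq (cl k b) i) => [e|ne].
      rewrite sact_at // in Gb.
      have [q E] := neg_bead _ (lt_trans (downb _ e) Gb); exists q.
      by rewrite beadE (removableE _ dG) -E leNgt Gb subr0.
    case: (eqVneq (cl k (b + 1)) i) => [e1|ne1].
      have := sact_pred k_gt0 G e1; rewrite addrK => Eb; rewrite Eb in Gb.
      case: (ltP (G b) 0) => [/neg_bead[q E]|Gb0].
        by exists q; rewrite beadE (removableE _ dG) -E (negbTE ne) andbF subr0.
      have [q E] := neg_bead _ Gb; exists q.
      by rewrite beadE (removableE _ dG) -E addrK Gb0 e1 eqxx addrK.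
    rewrite sact_other // in Gb; have [q E] := neg_bead _ Gb; exists q.
    by rewrite beadE (removableE _ dG) -E (negbTE ne) andbF subr0.
  rewrite beadE (removableE _ dG); clear b; set b := bead nu q.
  case: (eqVneq (cl k b) i) => [e|ne].
    case: (ltP (G (b - 1)) 0) => Gb; rewrite ?andTb ?andFb; first by rewrite subr0 sact_at.
    by rewrite sact_pred // bead_neg.
  rewrite andbF subr0; case: (eqVneq (cl k (b + 1)) i) => [e1|ne1].
    have := sact_pred k_gt0 G e1; rewrite addrK => ->.
    by have := downb _ e1; rewrite addrK => /lt_trans; apply; exact: bead_neg.
  by rewrite sact_other // bead_neg.
(* An ascent or descent at i, shifted by the right number of periods, crosses 0 and yields an
   addable or a removable box. *)
suff -> : sact i G = G by [].
have shift b : cl k (b + (- G b) * n) = cl k b by rewrite clDM.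
apply: sact_level => //; apply/negP.
  pose b := i%:Z; have e : cl k b = i := cl_ord i.
  rewrite (upE _ e) => lt; pose c := b + (- G b) * n.
  have Gc : G c = 0 by rewrite /c qfunDM; lia.
  have ec : cl k c = i by rewrite shift.
  have Gc1 : G (c - 1) < 0 by rewrite /c addrAC qfunDM mulr1 subr_lt0.
  have [q E] := neg_bead _ Gc1.
  have aq : addable i nu q by rewrite (addableE _ dG) -E subrK Gc ec eqxx.
  by have /negP[] := noadd q ltac:(by rewrite mem_iota add0n (addable_size aq)).
pose b := i%:Z; have e : cl k b = i := cl_ord i.
rewrite (downE _ e) => lt; pose c := b + (- G (b - 1)) * n.
have Gc : G (c - 1) = 0 by rewrite /c addrAC qfunDM mulr1 subrr.
have ec : cl k c = i by rewrite clDM.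
have Gc1 : G c < 0 by rewrite /c qfunDM mulr1 subr_lt0.
have [q E] := neg_bead _ Gc1.
have aq : removable i nu q by rewrite (removableE _ dG) -E Gc ec eqxx.
by have /negP[] := norem q ltac:(by rewrite mem_iota add0n (removable_size aq)).
Qed.

Lemma diagram_dot w nu G : diagram_of nu G ->
  diagram_of (foldr (@gen_act k) nu w) (dot w G).
Proof. by move=> dG; elim: w => //= i w; exact: diagram_gen_act. Qed.

Lemma diagram_core nu G : diagram_of nu G -> is_core k.+1 nu.
Proof.
move=> dG; have snu : sorted geq nu by case: dG => /andP[].
split; first by case: dG.
move=> p q qp; apply/eqP => /(congr1 Posz); rewrite hook_bead // => E.
have : G (bead nu p) < 0 by apply/(diagram_neg _ dG); exists p.
have -> : bead nu p = q%:Z - (conj_part nu q)%:Z + n by lia.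
rewrite qfunDn => lt.
have [r /esym/eqP] : exists r, q%:Z - (conj_part nu q)%:Z = bead nu r by apply/(diagram_neg _ dG); lia.
by rewrite (negbTE (bead_neq_empty r q snu)).
Qed.

Definition gaps_below G b := count (fun t : nat => 0 <= G (b - 1 - t%:Z)) (iota 0 k).

(** A hook of length t + 1 in row p is a gap t + 1 positions below the bead of that row. *)
Lemma bounded_row nu G p : diagram_of nu G ->
  count (fun q => hook nu p q <= k)%N (iota 0 (part nu p)) = gaps_below G (bead nu p).
Proof.
move=> dG; have snu : sorted geq nu by case: dG => /andP[].
have anti (a b : nat) : (a <= b)%N -> (conj_part nu b <= conj_part nu a)%N.
  by move=> ab; apply: sub_count => z /=; apply: leq_ltn_trans.
rewrite /gaps_below -!size_filter -(size_map (fun q => (hook nu p q).-1)).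
apply/perm_size/uniq_perm; last 1 first.
- move=> t; rewrite mem_filter mem_iota add0n; apply/mapP/andP.
    case=> q; rewrite mem_filter mem_iota add0n => /andP[hq /andP[_ qp]] ->.
    have hE := hook_bead snu qp.
    have c1 := conj_partP p q snu; rewrite qp in c1.
    split; last by rewrite /hook /= in hq *; lia.
    rewrite leNgt; apply/negP => neg.
    have [r /esym/eqP] : exists r, bead nu p - 1 - (hook nu p q).-1%:Z = bead nu r.
      exact/(diagram_neg _ dG).
    have -> : bead nu p - 1 - (hook nu p q).-1%:Z = q%:Z - (conj_part nu q)%:Z.
      by rewrite /hook /= in hE *; lia.
    by rewrite (negbTE (bead_neq_empty r q snu)).
  case=> Gt /andP[_ tk].
  have [q Eq] : exists q : nat, bead nu p - 1 - t%:Z = q%:Z - (conj_part nu q)%:Z.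
    apply: empty_column => // r; apply/eqP => E.
    by move: Gt; rewrite leNgt -E => /negP[]; apply/(diagram_neg _ dG); exists r.
  have qp : (q < part nu p)%N.
    rewrite -conj_partP // ltnNge; apply/negP => cp.
    have := conj_partP p q snu; rewrite ltnNge cp /= => /esym/negbT; rewrite -leqNgt.
    by move: Eq; rewrite /bead; lia.
  have hE := hook_bead snu qp; exists q; last by lia.
  by rewrite mem_filter mem_iota; lia.
- rewrite map_inj_in_uniq ?filter_uniq ?iota_uniq // => q q'.
  rewrite !mem_filter !mem_iota !add0n => /andP[_ /andP[_ qx]] /andP[_ /andP[_ q'x]] E.
  have hE := hook_bead snu qx; have hE' := hook_bead snu q'x.
  have h0 : (0 < hook nu p q)%N by [].
  have h0' : (0 < hook nu p q')%N by [].
  by case: (leqP q q') => [/[dup]/anti|/[dup]/ltnW/anti]; lia.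
- by rewrite filter_uniq ?iota_uniq.
Qed.

(** Counted over n positions, moving the window up by one replaces c - n by c, whose value is larger
    by 1, so the number of gaps cannot drop. Below a bead the n-th position is itself negative and
    contributes nothing. *)
Lemma gaps_below_homo G b e : G b < 0 -> G e < 0 -> b <= e ->
  (gaps_below G b <= gaps_below G e)%N.
Proof.
pose N c := count (fun t : nat => 0 <= G (c - 1 - t%:Z)) (iota 0 k.+1).
have NE c : G c < 0 -> N c = gaps_below G c.
  move=> Gc; rewrite /N -addn1 iotaD count_cat /= add0n.
  have -> : c - 1 - k%:Z = c + (-1) * n by lia.
  rewrite qfunDM leNgt; have -> : G c + -1 * 1 < 0 by lia.
  by rewrite !addn0.
move=> /NE <- /NE <- be; have -> : e = b + (absz (e - b))%:Z by lia.
elim: (absz (e - b)) => [|d IH]; first by rewrite addr0.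
apply: leq_trans IH _; set c := b + d%:Z.
have -> : b + d.+1%:Z = c + 1 by rewrite /c; lia.
rewrite {2}/N -[k.+1]add1n iotaD count_cat [iota 0 1]/= /N -[in leqLHS]addn1 iotaD.
rewrite count_cat addnC leq_add //=.
  rewrite addn0 addn0 add0n; have -> : c - 1 - k%:Z = c + (-1) * n by lia.
  rewrite qfunDM (_ : c + 1 - 1 - 0%:Z = c); last by lia.
  by case: leP => // h; case: leP => //; lia.
rewrite add0n -[iota 1 k]/(iota (1 + 0) k) iotaDl count_map; apply: sub_count => t /=.
by rewrite (_ : c + 1 - 1 - (1 + t)%:Z = c - 1 - t%:Z) //; lia.
Qed.

(** The gap of column 0 lies below the bead; moved up by periods into the n positions under the bead
    it remains a gap, and it misses the lowest of them, where the value is negative. *)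
Lemma gaps_below_gt0 nu G p : diagram_of nu G -> (p < size nu)%N ->
  (0 < gaps_below G (bead nu p))%N.
Proof.
move=> dG ps; rewrite -has_count; set b := bead nu p.
have snu : sorted geq nu by case: dG => /andP[].
have p0 : (0 < part nu p)%N by rewrite part_gt0 //; case: dG.
have hE := hook_bead snu p0; set e := 0%:Z - (conj_part nu 0)%:Z in hE.
have eb : e < b by have := conj_partP p 0 snu; rewrite p0 /b /bead /e; lia.
have Ge : 0 <= G e.
  rewrite leNgt; apply/negP => neg; have [r /esym/eqP] : exists r, e = bead nu r by exact/(diagram_neg _ dG).
  by rewrite (negbTE (bead_neq_empty r 0 snu)).
have Gb : G b < 0 by apply/(diagram_neg _ dG); exists p.
pose t := ((b - 1 - e) %% n)%Z.
have t0 : 0 <= t by rewrite modz_ge0.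
have tn : t < n by rewrite ltz_pmod.
have Et : b - 1 - t = e + ((b - 1 - e) %/ n)%Z * n.
  by rewrite /t; have := divz_eq (b - 1 - e) n; lia.
have d0 : 0 <= ((b - 1 - e) %/ n)%Z by rewrite divz_ge0 //; lia.
have Gt : 0 <= G (b - 1 - t) by rewrite Et qfunDM; lia.
apply/hasP; exists `|t|%N; last by rewrite /= gez0_abs.
rewrite mem_iota add0n /=.
have tk : t != k%:Z.
  apply/eqP => E; move: Gt; have -> : b - 1 - t = b + (-1) * n by lia.
  by rewrite qfunDM; lia.
lia.
Qed.

Lemma bounded_of_coreE nu G : diagram_of nu G ->
  bounded_of_core k nu = [seq gaps_below G (bead nu p) | p <- iota 0 (size nu)].
Proof. by move=> dG; apply: eq_map => p; exact: bounded_row. Qed.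

Lemma bounded_of_core_bounded nu G : diagram_of nu G -> k_bounded k (bounded_of_core k nu).
Proof.
move=> dG; have snu : sorted geq nu by case: dG => /andP[].
have Gb p : G (bead nu p) < 0 by apply/(diagram_neg _ dG); exists p.
rewrite (bounded_of_coreE dG); split; last first.
  rewrite /part; case: (posnP (size nu)) => [->//|s0].
  rewrite (nth_map 0%N) ?size_iota // nth_iota // /gaps_below.
  by rewrite -[leqRHS](size_iota 0) count_size.
apply/andP; split.
  apply/(sortedP 0%N) => q; rewrite size_map size_iota => qs.
  rewrite !(nth_map 0%N) ?size_iota // 1?ltnW // !nth_iota // 1?ltnW // !add0n.
  by apply: gaps_below_homo => //; apply/ltW/bead_lt.
apply/mapP => -[p]; rewrite mem_iota add0n => /andP[_ ps].
by have := gaps_below_gt0 dG ps; case: (gaps_below _ _).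
Qed.

Lemma reachable_diagram G : reachable G -> exists nu, diagram_of nu G.
Proof.
by case=> w _ ->; exists (foldr (@gen_act k) [::] w); apply/diagram_dot/diagram_base.
Qed.

Definition shape_of G : seq nat :=
  bounded_of_core k (xget [::] [set nu | diagram_of nu G]%classic).

Lemma shape_ofE nu G : diagram_of nu G -> shape_of G = bounded_of_core k nu.
Proof.
move=> dG; congr bounded_of_core; apply: xget_unique => // la dl.
exact: diagram_fun dl dG.
Qed.

Lemma shape_of_bounded G : reachable G -> k_bounded k (shape_of G).
Proof.
by case/reachable_diagram => nu dG; rewrite (shape_ofE dG); exact: bounded_of_core_bounded dG.
Qed.

Lemma shape_of_inj G H : reachable G -> reachable H -> shape_of G = shape_of H -> G = H.
Proof.
move=> /reachable_diagram[nu dG] /reachable_diagram[la dH].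
rewrite (shape_ofE dG) (shape_ofE dH) => E.
have E' : nu = la by apply: bounded_of_core_inj E; [exact: diagram_core dG|exact: diagram_core dH].
by apply: diagram_inj dG _; rewrite E'.
Qed.

Lemma core_of_shape nu G : diagram_of nu G -> core_of_bounded k (shape_of G) = nu.
Proof.
move=> dG; rewrite (shape_ofE dG); apply: xget_unique.
  by split=> //; exact: diagram_core dG.
move=> la [cl E]; apply: bounded_of_core_inj E => //; exact: diagram_core dG.
Qed.

End CoresAndPartitions.

(** * The Pieri rule *)

Section CyclicallyDecreasing.
Variable k : nat.
Hypothesis k_gt0 : (0 < k)%N.
Local Notation n := (k.+1%:Z).
Implicit Types (p q z A : int) (i j : 'I_k.+1) (w : seq 'I_k.+1) (D : {set 'I_k.+1}).

Definition start D p q :=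
  [/\ q <= p, cl k q \notin D & forall z, q < z <= p -> cl k z \in D].

Lemma cl_surj p i : exists2 g : nat, (g < k.+1)%N & cl k (p - g%:Z) = i.
Proof.
pose g := ((p - i%:Z) %% n)%Z; have g0 : 0 <= g by rewrite modz_ge0.
have gn : g < n by rewrite ltz_pmod.
exists (absz g); first by lia.
rewrite gez0_abs // -[RHS]cl_ord; apply/clP; exists (- ((p - i%:Z) %/ n)%Z).
by have := divz_eq (p - i%:Z) n; rewrite -/g; lia.
Qed.

Lemma start_ex D p : D \proper [set: 'I_k.+1] -> exists2 q, start D p q & p - n < q.
Proof.
move=> /properP[_ [i _ iD]].
have [g gn eg] := cl_surj p i.
have ex : exists g : nat, cl k (p - g%:Z) \notin D by exists g; rewrite eg.
case: (ex_minnP ex) => m mD mmin; exists (p - m%:Z).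
  split=> // [|z zp]; first by lia.
  apply/negPn/negP => zD; have : cl k (p - (absz (p - z))%:Z) \notin D.
    by rewrite (_ : p - _ = z) //; lia.
  by move/mmin; lia.
by have : (m <= g)%N; [apply: mmin; rewrite eg | lia].
Qed.

Lemma start_self D p : cl k p \notin D -> start D p p.
Proof. by move=> pD; split=> // z; lia. Qed.

Lemma start_step D p q : cl k p \in D -> start D p q <-> start D (p - 1) q.
Proof.
move=> pD; split=> -[qp qD chain]; split=> //.
- have : q != p by apply: contraNneq qD => ->.
  lia.
- by move=> z zp; apply: chain; lia.
- lia.
- by move=> z zp; case: (eqVneq z p) => [->//|zp']; apply: chain; lia.
Qed.

(** Since i + 1 is outside D, a position of class i can only be the right end of an interval of i |:
    D, so only the starts seen from class i change. *)
Lemma start_setU1 D i p q : i \notin D -> ordS i \notin D -> cl k p != i ->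
  start (i |: D) p q <-> start D p q.
Proof.
move=> iD siD pi; have sii : ordS i != i by rewrite -(cl_ord i) -clS clS_neq.
split=> -[qp qD chain]; split=> //.
- by apply: contra qD => qD; rewrite inE qD orbT.
- move=> z /andP[qz zp]; have := chain z; rewrite qz zp => /(_ isT).
  rewrite inE => /orP[/set1P zi|//]; have : z != p by apply: contraNneq pi => <-; rewrite zi.
  move=> zp'; have := chain (z + 1) ltac:(lia).
  by rewrite clS zi !inE (negbTE sii) (negbTE siD).
- rewrite !inE negb_or qD andbT; apply/eqP => qi.
  have : q != p by apply: contraNneq pi => <-; rewrite qi.
  by move=> qp'; have := chain (q + 1) ltac:(lia); rewrite clS qi (negbTE siD).
- by move=> z /chain zD; rewrite inE zD orbT.
Qed.

Lemma cyc_decreasing_cons D i w : cyc_decreasing D (i :: w) ->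
  [/\ i \notin [set j in w], ordS i \notin [set j in w], D = i |: [set j in w]
    & cyc_decreasing [set j in w] w].
Proof.
move=> /and3P[/= /andP[iw uw] /eqP DE /forallP dec].
have DE' : D = i |: [set j in w] by rewrite -DE; apply/setP => j; rewrite !inE.
split=> //; first by rewrite inE.
  rewrite inE; apply/negP => siw; have := dec i.
  by rewrite DE' !inE eqxx siw orbT /= ltn0.
rewrite /cyc_decreasing uw eqxx; apply/forall_inP => j; rewrite inE => jw; apply/implyP.
rewrite inE => sjw; have := dec j; rewrite DE' !inE jw sjw !orbT /=.
have -> : (i == j) = false by apply: contraNF iw => /eqP ->.
by have -> : (i == ordS j) = false by apply: contraNF iw => /eqP ->.
Qed.

Section Moves.
Variable N : int.
Local Notation X := (qper k N).
Implicit Types (G H : X).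

(* u_D acts on G as nonzero exactly when each start q of an interval of D ending
   at p satisfies G q < G p; it then carries the value at q over the interval. *)
Definition movable D G := forall p q, cl k p \in D -> start D p q -> G q < G p.

Definition moved D G H := forall p,
  (cl k (p + 1) \in D -> H p = G (p + 1)) /\
  (cl k (p + 1) \notin D -> forall q, start D p q -> H p = G q).

Lemma moved_uniq D G H H' : D \proper [set: 'I_k.+1] ->
  moved D G H -> moved D G H' -> H = H'.
Proof.
move=> pD mH mH'; apply: qper_eq => p; have [h1 h2] := mH p; have [h1' h2'] := mH' p.
case: (boolP (cl k (p + 1) \in D)) => pD'; first by rewrite h1 // h1'.
by have [q sq _] := start_ex p pD; rewrite (h2 pD' q sq) (h2' pD' q sq).
Qed.

Lemma cyc_word_moved D w G : D \proper [set: 'I_k.+1] -> cyc_decreasing D w ->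
  (red w G <-> movable D G) /\ moved D G (dot w G).
Proof.
elim: w D => [|i w IH] D pD.
  move=> /and3P[_ /eqP <- _]; split; first by split=> // _ p q; rewrite !inE.
  by move=> p; split=> [|_ q [qp _ ch]]; rewrite ?inE //; congr (G _);
    case: (eqVneq q p) => // qp'; have := ch p ltac:(lia); rewrite !inE.
move=> /cyc_decreasing_cons[]; set D' := [set j in w] => iD siD DE cw.
have pD' : D' \proper [set: 'I_k.+1].
  by apply: (sub_proper_trans _ pD); rewrite DE; exact: finset.subsetUr.
have [IHr IHm] := IH _ pD' cw.
have sii : ordS i != i by rewrite -(cl_ord i) -clS clS_neq.
have wat p : cl k p = i -> dot w G p = G p.
  move=> e; apply: (proj2 (IHm p)); first by rewrite clS e.
  by apply: start_self; rewrite e.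
have wpred p q : cl k p = i -> start D p q -> dot w G (p - 1) = G q.
  move=> e sq; apply: (proj2 (IHm (p - 1))); first by rewrite subrK e.
  apply/(start_setU1 _ iD siD); first by rewrite -e -[X in _ != cl k X](subrK 1) eq_sym clS_neq.
  have pD0 : cl k p \in D by rewrite e DE !inE eqxx.
  by rewrite -DE; apply/(start_step _ pD0).
split=> [|p].
  rewrite /=; split=> [/andP[/IHr mv ui] p q pD'' sq|mv].
    move: (pD''); rewrite DE inE => /orP[/set1P e|pD3].
      by move: ui; rewrite (upE _ e) (wat _ e) (wpred _ _ e sq).
    apply: mv => //; apply/(start_setU1 _ iD siD); last by rewrite -DE.
    by apply: contraNneq iD => <-.
  apply/andP; split.
    apply/IHr => p q pD3 sq; apply: mv; first by rewrite DE inE pD3 orbT.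
    rewrite DE; apply/start_setU1 => //.
    by apply: contraNneq iD => <-.
  have [q sq _] := start_ex i%:Z pD; rewrite (upE _ (cl_ord i)).
  rewrite (wat _ (cl_ord i)) (wpred _ _ (cl_ord i) sq); apply: mv => //.
  by rewrite cl_ord DE !inE eqxx.
case: (eqVneq (cl k p) i) => [e|ne].
  rewrite [dot _ _]/= sact_at //; split.
    by rewrite clS e DE !inE (negbTE sii); move: siD; rewrite inE => /negbTE->.
  by move=> _ q sq; exact: wpred.
case: (eqVneq (cl k (p + 1)) i) => [e1|ne1].
  have := sact_pred k_gt0 (dot w G) e1; rewrite addrK => E.
  split; first by move=> _; rewrite E wat.
  by rewrite e1 DE !inE eqxx.
rewrite [dot _ _]/= sact_other //; have [h1 h2] := IHm p.
split; first by rewrite DE inE => /orP[/set1P/eqP|//]; rewrite (negbTE ne1).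
rewrite DE inE negb_or => /andP[_ pD3] q sq; apply: h2 => //.
exact/(start_setU1 _ iD siD).
Qed.

Lemma cyc_word_dot D w w' G : D \proper [set: 'I_k.+1] ->
  cyc_decreasing D w -> cyc_decreasing D w' ->
  red w G = red w' G /\ dot w G = dot w' G.
Proof.
move=> pD cw cw'; have [r m] := cyc_word_moved G pD cw.
have [r' m'] := cyc_word_moved G pD cw'.
by split; [apply/idP/idP => [/r/r'|/r'/r] | exact: moved_uniq m m'].
Qed.

End Moves.

Lemma cl_inj_window A (s : seq int) : (forall x, x \in s -> A < x < A + n) ->
  {in s &, injective (cl k)}.
Proof. by move=> sA x y /sA xA /sA yA /cl_inj; apply; lia. Qed.

Lemma cyc_decreasing_seq A (s : seq int) : sorted >%R s ->
  (forall x, x \in s -> A < x < A + n) ->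
  cyc_decreasing [set i in map (cl k) s] (map (cl k) s).
Proof.
move=> ss sA; have inj := cl_inj_window sA.
have tr : transitive (>%R : rel int) by move=> a b c /= ab bc; exact: lt_trans bc ab.
have us : uniq s by apply: sorted_uniq ss => [|x]; [exact: tr | exact: ltxx].
have idx x : x \in s -> index (cl k x) (map (cl k) s) = index x s.
  move=> xs; rewrite -[in RHS](nth_index_map 0 inj xs) index_uniq //.
  by rewrite -(size_map (cl k)) index_mem map_f.
apply/and3P; split; [by rewrite map_inj_in_uniq | by [] |].
apply/forall_inP => i; rewrite inE => /mapP[x xs ->]; apply/implyP; rewrite inE.
rewrite -clS => /mapP[y ys e].
have yE : y = x + 1.
  have := sA x xs; have := sA y ys => hy hx.
  by apply/esym; apply: cl_inj e _; lia.
rewrite e !idx // yE ltnNge leq_eqVlt; apply/negP => /orP[/eqP|] H.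
  have : x = y by rewrite -(nth_index 0 xs) H -yE nth_index.
  by rewrite yE; lia.
by have := sorted_ltn_index tr ss x y xs ys; rewrite yE H => /(_ isT); rewrite /=; lia.
Qed.

(** The circle of residues is cut at a class j outside D, and the classes of D are read downwards
    from there. *)
Lemma cyc_word_ex D : D \proper [set: 'I_k.+1] -> exists w, cyc_decreasing D w.
Proof.
move=> /properP[_ [j _ jD]]; pose s := [seq j%:Z + t%:Z | t <- rev (iota 1 k) & cl k (j%:Z + t%:Z) \in D].
have sA x : x \in s -> j%:Z < x < j%:Z + n.
  by move=> /mapP[t]; rewrite mem_filter mem_rev mem_iota => /andP[_ ?] ->; lia.
have ss : sorted >%R s.
  rewrite sorted_map; apply: sorted_filter => [a b c /= ? ?|]; first by lia.
  rewrite rev_sorted; apply: sub_sorted (iota_ltn_sorted 1 k) => a b /= ?; lia.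
exists (map (cl k) s); suff -> : D = [set i in map (cl k) s] by exact: cyc_decreasing_seq sA.
apply/setP => i; rewrite inE; apply/idP/mapP => [iD|[x /mapP[t + ->] ->]]; last first.
  by rewrite mem_filter => /andP[].
have [g gn eg] := cl_surj (j%:Z + k%:Z + 1) i.
have t0 : g != 0%N.
  apply: contraNneq jD => g0; rewrite -(cl_ord j) -clDn.
  by have -> : j%:Z + n = j%:Z + k%:Z + 1 - g%:Z; [lia | rewrite eg].
exists (j%:Z + (k.+1 - g)%N%:Z).
  apply: map_f; rewrite mem_filter mem_rev mem_iota; apply/andP; split; last by lia.
  by rewrite (_ : _ + _ = j%:Z + k%:Z + 1 - g%:Z) ?eg //; lia.
by rewrite -eg; congr cl; lia.
Qed.

Definition cyc_word D := xget [::] [set w | cyc_decreasing D w]%classic.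

Lemma cyc_wordP D : D \proper [set: 'I_k.+1] -> cyc_decreasing D (cyc_word D).
Proof. by move=> /cyc_word_ex; exact: (@xgetPex _ [::] [set w | cyc_decreasing D w]%classic). Qed.

Lemma nil_cycE D : nil_cyc D = nil_word (cyc_word D).
Proof. by []. Qed.

Lemma cyc_word_size D w : cyc_decreasing D w -> size w = #|D|.
Proof.
move=> /and3P[uw /eqP <- _]; rewrite -(card_uniqP uw).
by apply: eq_card => i; rewrite inE.
Qed.

Lemma cyc_word_mem D w : cyc_decreasing D w -> w =i D.
Proof. by move=> /and3P[_ /eqP <- _] i; rewrite inE. Qed.

End CyclicallyDecreasing.

(** Turns the sums over sets of partitions into sums over a finite type: the sets D in the Pieri
    rule, and functions coding the partitions inside R in the theorem. *)
Lemma fsbig_finType_image (R : Type) (idx : R) (op : Monoid.com_law idx)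
    (I : finType) (J : choiceType) (P : pred I) (h : I -> J) (A : set J) (F : J -> R) :
  (forall j, A j <-> exists2 i, P i & h i = j) -> {in P &, injective h} ->
  \big[op/idx]_(j \in A) F j = \big[op/idx]_(i | P i) F (h i).
Proof.
move=> Ah inj; have -> : A = (h @` [set` P])%classic.
  by apply/predeqP => j; split=> [/Ah[i Pi <-]|[i Pi <-]]; [exists i | apply/Ah; exists i].
rewrite fsbig_image; last by move=> x y /set_mem xP /set_mem yP; exact: inj.
rewrite -(@bigfs _ _ _ _ (index_enum I)) ?index_enum_uniq // => i _.
by rewrite mem_index_enum.
Qed.

(** Inside the classical comprehension of [is_kSchur] the full set of residues is read as a
    classical set. *)
Lemma proper_setTE (T : finType) (D : {set T}) :
  (D \proper [set: T]%classic) = (D \proper [set: T]).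
Proof.
apply: (@fintype.eq_proper_r _ (mem [set: T]%classic) (mem [set: T])) => x.
by rewrite finset.inE; apply: mem_set.
Qed.

Section IdWords.
Variable k : nat.
Hypothesis k_gt0 : (0 < k)%N.

Lemma dot_rev_id (w : seq 'I_k.+1) : cancel (dot w (id_qper k)) (dot (rev w) (id_qper k)).
Proof. by move=> p; rewrite -(dot_id w (dot (rev w) (id_qper k))) -{1}(revK w) dot_rev. Qed.

Lemma dot_id_inj (w : seq 'I_k.+1) : injective (dot w (id_qper k)).
Proof. exact: can_inj (dot_rev_id w). Qed.

Lemma cyc_word_red_id (D : {set 'I_k.+1}) : D \proper [set: 'I_k.+1] ->
  red (cyc_word D) (id_qper k).
Proof.
move=> pD; apply/(proj1 (cyc_word_moved k_gt0 (id_qper k) pD (cyc_wordP k_gt0 pD))).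
move=> p q pD' [qp qD _] /=; rewrite lt_neqAle qp andbT.
by apply: contraNneq qD => ->.
Qed.

End IdWords.

(** * The Pieri rule in terms of the action on cores *)

Section Pieri.
Variable k : nat.
Hypothesis k_gt0 : (0 < k)%N.
Local Notation X := (qper k 1).
Local Notation base := (base k).
Implicit Types (w : seq 'I_k.+1) (D : {set 'I_k.+1}) (G H : X).

(** Both elements are applied to the functional that is 1 at [dot v base] and 0 elsewhere. *)
Lemma red_word_inj v w : red v base -> nil_word v = nil_word w ->
  red w base /\ dot v base = dot w base.
Proof.
move=> rv E; pose phi (H : X) : int := if `[< H = dot v base >] then 1 else 0.
have := congr1 (fun a => act a phi base) E; rewrite /= !(act_word k_gt0) rv /phi.
rewrite asboolT //; case: (red w base) => //.
by case: asboolP => [->//|].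
Qed.

Lemma diagram_core_act (x : affSym k) :
  diagram_of (core_act x [::]) (dot (reduced_word x) base).
Proof. exact/diagram_dot/(diagram_base k_gt0). Qed.

Lemma min_coset_rep1 : min_coset_rep (1%g : affSym k).
Proof.
have E : word_prod [::] = 1%g :> affSym k by rewrite /word_prod big_nil.
by rewrite -E; apply: red_min_coset_rep.
Qed.

Lemma w_of_min la : min_coset_rep (w_of k la).
Proof.
by rewrite /w_of; case: xgetP => [x _ []//|_]; exact: min_coset_rep1.
Qed.

Lemma u_of_shape w : red w base -> u_of k (shape_of (dot w base)) = nil_word w.
Proof.
move=> rw; set la := shape_of _.
have dw : diagram_of (core_act (word_prod w) [::]) (dot w base).
  have := diagram_core_act (word_prod w).
  by rewrite (dot_cox k_gt0 (w := w)) //; apply/word_prodP; case: (reduced_wordP k_gt0 (word_prod w)).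
have [mx cx] : min_coset_rep (w_of k la) /\ core_act (w_of k la) [::] = core_of_bounded k la.
  apply: (@xgetPex _ 1%g [set x : affSym k | min_coset_rep x /\
    core_act x [::] = core_of_bounded k la]%classic).
  exists (word_prod w); split; first exact: red_min_coset_rep.
  by rewrite /la (core_of_shape k_gt0 dw).
have rx := min_coset_rep_red k_gt0 mx.
apply: (red_base_nil_word k_gt0 rx rw); rewrite (core_of_shape k_gt0 dw) in cx.
by apply: (diagram_inj k_gt0 (diagram_core_act (w_of k la))); rewrite cx.
Qed.

(** The choices in [w_of] and [core_of_bounded] must not fall back on their default values. Either
    default, the element 1 or the empty sequence, would give back [base], which a nonempty reduced
    word leaves. *)
Lemma shape_of_u mu w : red w base -> (0 < size w)%N -> k_bounded k mu ->
  u_of k mu = nil_word w -> mu = shape_of (dot w base).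
Proof.
move=> rw sw bmu E; have mx := w_of_min mu.
have rx := min_coset_rep_red k_gt0 mx.
have [_ Ed] := red_word_inj rx E.
have nbase : dot w base <> base.
  by move=> Eb; rewrite (red_base_size k_gt0 rw (isT : red [::] base) Eb) in sw.
have dx := diagram_core_act (w_of k mu); rewrite Ed in dx.
have : core_act (w_of k mu) [::] = core_of_bounded k mu \/ w_of k mu = 1%g.
  by rewrite /w_of; case: xgetP => [x _ [_ cx]|_]; [left | right].
case=> [Ec|E1]; last first.
  case: nbase; rewrite -Ed E1; have E0 : word_prod [::] = 1%g :> affSym k.
    by rewrite /word_prod big_nil.
  have [Er _] := reduced_wordP k_gt0 (1%g : affSym k).
  by rewrite (dot_cox k_gt0 (w := [::])) //; apply/word_prodP; rewrite Er.
rewrite (shape_ofE k_gt0 dx) Ec /core_of_bounded; case: xgetP => [nu _ [_ ->]//|none].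
case: nbase; apply: (diagram_inj k_gt0 _ (diagram_base k_gt0)).
by move: dx; rewrite Ec /core_of_bounded xgetPN.
Qed.

Variable s : seq nat -> nilCox k.
Hypothesis hs : is_kSchur s.

Definition sk G := s (shape_of G).

(** By [matsumoto] at [base], the two words followed by w are braid equivalent, so they agree on the
    identity, where w cancels. [matsumoto] at the identity then shows that they have the same
    letters. *)
Lemma cyc_red_inj D D' G : reachable G -> D \proper [set: 'I_k.+1] ->
  D' \proper [set: 'I_k.+1] -> red (cyc_word D) G -> red (cyc_word D') G ->
  dot (cyc_word D) G = dot (cyc_word D') G -> D = D'.
Proof.
move=> [w rw ->] pD pD' rD rD' E.
have r : red (cyc_word D ++ w) base by rewrite red_cat rw.
have r' : red (cyc_word D' ++ w) base by rewrite red_cat rw.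
have b := matsumoto k_gt0 (isT : 0 < 1 :> int) (base_dominant k_gt0) r r'.
have {b}/b : dot (cyc_word D ++ w) base = dot (cyc_word D' ++ w) base by rewrite !dot_cat.
move=> /(dot_brd k_gt0 (id_qper k)); rewrite !dot_cat => Eid.
have Ed : dot (cyc_word D) (id_qper k) = dot (cyc_word D') (id_qper k).
  apply: qper_eq => p; apply: (@dot_id_inj k k_gt0 w).
  by rewrite -!(dot_id _ (dot w (id_qper k))) Eid.
have b := matsumoto k_gt0 (n_gt0 k) (id_dominant k_gt0)
  (cyc_word_red_id k_gt0 pD) (cyc_word_red_id k_gt0 pD') Ed.
apply/setP => i; rewrite -(cyc_word_mem (cyc_wordP k_gt0 pD)).
by rewrite -(cyc_word_mem (cyc_wordP k_gt0 pD')); exact: brd_mem b _.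
Qed.

(** The partitions mu of the defining sum correspond to the sets D for which u_D acts on G as
    nonzero, bijectively by [cyc_red_inj]. *)
Lemma pieri G i : (1 <= i <= k)%N -> reachable G ->
  nil_h k i * sk G = \sum_(D : {set 'I_k.+1} |
    [&& D \proper [set: 'I_k.+1], #|D| == i & red (cyc_word D) G]) sk (dot (cyc_word D) G).
Proof.
move=> ik rG; case: hs => _ _ /(_ i (shape_of G) ik (shape_of_bounded k_gt0 rG)) ->.
have [w rw Ew] := rG; have Eu := u_of_shape rw; rewrite -Ew in Eu.
apply: fsbig_finType_image => [mu|D D' /and3P[pD _ rD] /and3P[pD' _ rD'] E]; last first.
  apply: (cyc_red_inj rG pD pD' rD rD'); apply: shape_of_inj E => //; exact: reachable_word.
have rDw D : red (cyc_word D) G -> red (cyc_word D ++ w) base.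
  by move=> rD; rewrite red_cat rw -Ew.
split=> [[bmu [D []]]|[D /and3P[pD /eqP cD rD] <-]].
  rewrite proper_setTE => pD cD; rewrite Eu nil_cycE -nil_word_cat => E.
  have rmu := min_coset_rep_red k_gt0 (w_of_min mu).
  have [rw' _] := red_word_inj rmu E; exists D.
    by rewrite pD cD eqxx; move: rw'; rewrite red_cat -Ew => /andP[].
  rewrite Ew -dot_cat; apply/esym; apply: shape_of_u => //.
  by rewrite size_cat (cyc_word_size (cyc_wordP k_gt0 pD)) cD; lia.
split; first by apply: shape_of_bounded => //; exact: reachable_word.
exists D; split; rewrite ?proper_setTE //.
by rewrite Eu nil_cycE -nil_word_cat -(u_of_shape (rDw _ rD)) dot_cat -Ew.
Qed.

End Pieri.

(** * The first row of the bounded partition *)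

Section TopPosition.
Variable k : nat.
Hypothesis k_gt0 : (0 < k)%N.
Local Notation n := (k.+1%:Z).
Local Notation X := (qper k 1).
Local Notation base := (base k).
Implicit Types (p q e m M : int) (w : seq 'I_k.+1) (D : {set 'I_k.+1}) (G H : X).

(* M - n is the largest bead. *)
Definition top G M := G M = 0 /\ forall p, M < p -> 0 < G p.

Lemma top_ex G : exists M, top G M.
Proof.
pose c : int := \sum_(j < k.+1) `|G j%:Z|.
have cP (j : 'I_k.+1) : - c <= G j%:Z.
  rewrite /c (bigD1 j) //=.
  have : 0 <= \sum_(i < k.+1 | i != j) `|G i%:Z| by apply: sumr_ge0.
  by move: (\sum_(_ < _ | _) _) => x; lia.
have c0 : 0 <= c by apply: sumr_ge0.
have pos p : (c + 1) * n <= p -> 0 < G p.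
  move=> pc; rewrite (divz_eq p n) addrC qfunDM mulr1.
  have m0 : 0 <= (p %% n)%Z by rewrite modz_ge0.
  have mn : (p %% n)%Z < n by rewrite ltz_pmod.
  have jn : (absz (p %% n)%Z < k.+1)%N by lia.
  have := cP (Ordinal jn); rewrite /= gez0_abs // => h.
  have : c + 1 <= (p %/ n)%Z by rewrite lez_divRL.
  by lia.
pose p0 : int := 0 + (- `|G 0|) * n.
have neg0 : G p0 <= 0 by rewrite /p0 qfunDM mulr1; move: (G 0) => g; lia.
have ex : exists t : nat, G (p0 + t%:Z) <= 0 by exists 0%N; rewrite addr0.
have bnd (t : nat) : G (p0 + t%:Z) <= 0 -> (t <= absz ((c + 1) * n - p0)%R)%N.
  move=> Gt; rewrite leqNgt; apply/negP => lt.
  by have := pos (p0 + t%:Z); lia.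
case: (ex_maxnP ex bnd) => t Gt tmax; exists (p0 + t%:Z).
have gt p : p0 + t%:Z < p -> 0 < G p.
  move=> lt; rewrite ltNge; apply/negP => Gp.
  have := tmax (absz (p - p0)%R); rewrite gez0_abs; last by lia.
  have -> : p0 + (p - p0) = p by ring.
  by move=> /(_ Gp); lia.
split=> //; have := gt (p0 + t%:Z + n); rewrite qfunDn; lia.
Qed.

Lemma top_ge0 G M p : top G M -> M - n < p -> 0 <= G p.
Proof. by move=> [_ gt] lt; have := gt (p + n); rewrite qfunDn; lia. Qed.

(* The first part of the k-bounded partition of G. *)
Definition rank G M := count (fun t : nat => 0 < G (M - t%:Z)) (iota 0 k.+1).

Lemma rank_le G M : top G M -> (rank G M <= k)%N.
Proof.
move=> [G0 _]; rewrite /rank /= subr0 G0 ltxx add0n.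
by apply: leq_trans (count_size _ _) _; rewrite size_iota.
Qed.

Lemma end_ex D q M : q <= M -> cl k (M + 1) \notin D ->
  exists e, [/\ q <= e <= M, cl k (e + 1) \notin D & forall z, q < z <= e -> cl k z \in D].
Proof.
move=> qM MD.
have ex : exists t : nat, cl k (q + t%:Z + 1) \notin D.
  by exists (absz (M - q)%R); rewrite gez0_abs ?subr_ge0 // [q + _]addrC subrK.
case: (ex_minnP ex) => t tD tmin; exists (q + t%:Z); split=> //.
  by have := tmin (absz (M - q)%R); rewrite gez0_abs ?subr_ge0 // [q + _]addrC subrK MD; lia.
move=> z zq; apply/negPn/negP => zD; have := tmin (absz (z - q - 1)%R).
rewrite gez0_abs; last by lia.
have -> : q + (z - q - 1) + 1 = z by ring.
by move=> /(_ zD); lia.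
Qed.

Lemma end_exT D q : D \proper [set: 'I_k.+1] -> exists e,
  [/\ q <= e, cl k (e + 1) \notin D & forall z, q < z <= e -> cl k z \in D].
Proof.
move=> /properP[_ [i _ iD]]; have [g gn eg] := cl_surj k_gt0 (q + n) i.
have [|e [/andP[qe _] eD ch]] := @end_ex D q (q + n - g%:Z - 1) ltac:(lia).
  by rewrite subrK eg.
by exists e.
Qed.

Lemma start_end D q e p : cl k q \notin D -> q <= p <= e ->
  (forall z, q < z <= e -> cl k z \in D) -> start D p q.
Proof. by move=> qD qpe ch; split=> //; [lia | move=> z zp; apply: ch; lia]. Qed.

(* G is obtained from the window of H ending at M when D consists of the
   positive positions of H shifted by one. *)
Definition profile D M G := cl k (M + 1) \notin D /\ forall q, M - n < q <= M ->
  0 <= G q /\ (0 < G q) = (cl k q \in D).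

Lemma moved_profile D G H M : moved D G H -> top H M ->
  (forall p, M - n < p <= M -> (0 < H p) = (cl k (p + 1) \in D)) -> profile D M G.
Proof.
move=> mv tH HD; have M0 : cl k (M + 1) \notin D.
  by rewrite -HD ?(proj1 tH) ?ltxx //; lia.
split=> // q qM; case: (boolP (cl k q \in D)) => qD.
  have qM' : q != M - n + 1.
    by apply: contraTneq qD => ->; rewrite addrAC -[n in X in X \notin _]mul1r -mulNr clDM.
  have [h _] := mv (q - 1); rewrite subrK in h.
  by have := HD (q - 1) ltac:(lia); rewrite subrK qD h // => /[dup] /ltW.
have [e [/andP[qe eM] eD ch]] := @end_ex D q M ltac:(lia) M0.
have -> : G q = H e.
  by apply/esym; apply: (proj2 (mv e)) => //; apply: (start_end (e := e)) => //; lia.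
have := HD e ltac:(lia); rewrite (negbTE eD) => He.
by have := top_ge0 tH (p := e) ltac:(lia); rewrite He.
Qed.

Lemma window_rep M (i : 'I_k.+1) : exists2 q, M - n < q <= M & cl k q = i.
Proof. by have [g gn eg] := cl_surj k_gt0 M i; exists (M - g%:Z) => //; lia. Qed.

(** If M < M', the positions of D lifted into the window ending at M' become or stay positive, and
    so does the class of M + 1: D' contains D and one more class. If M = M', both sets are read off
    from the same signs. *)
Lemma profile_uniq D D' M M' G : profile D M G -> profile D' M' G -> #|D| = #|D'| -> D = D'.
Proof.
have lt_card A B P Q : profile A P G -> profile B Q G -> P < Q -> (#|A| < #|B|)%N.
  move=> [PA pA] [QB pB] PQ.
  have AB q : P - n < q <= P -> 0 < G q \/ q = P - n + 1 -> cl k q \in B.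
    move=> qP Gq; have [q' q'Q e] := window_rep Q (cl k q).
    rewrite -e; have /clP[m E] := e; have E' : q' = q - m * n by rewrite E; ring.
    have [G0 <-] := pB q' q'Q.
    have [Gq0 _] := pA q qP.
    rewrite E' -mulNr qfunDM.
    by case: Gq => [Gq|Gq]; nia.
  have PE : cl k (P - n + 1) = cl k (P + 1).
    by rewrite addrAC -[n]mul1r -mulNr clDM.
  apply: (@leq_trans #|cl k (P + 1) |: A|).
    by rewrite cardsU1 PA add1n.
  apply/subset_leq_card/fintype.subsetP => i; rewrite !inE => /orP[/eqP->|iA].
    by rewrite -PE; apply: AB; [lia | right].
  have [q qP qi] := window_rep P i; rewrite -qi; apply: AB => //; left.
  by have [_ ->] := pA q qP; rewrite qi.
move=> pD pD' E; case: (ltgtP M M') => [lt|lt|MM'].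
- by have := lt_card _ _ _ _ pD pD' lt; rewrite E ltnn.
- by have := lt_card _ _ _ _ pD' pD lt; rewrite E ltnn.
apply/setP => i; have [q qM <-] := window_rep M i.
by have [_ <-] := proj2 pD q qM; rewrite MM' in qM; have [_ <-] := proj2 pD' q qM.
Qed.

Lemma count_sub_eq (T : eqType) (a b : pred T) (r : seq T) :
  {in r, forall x, a x -> b x} -> count b r = count a r -> {in r, forall x, b x -> a x}.
Proof.
move=> ab E x xr bx; apply/negPn/negP => nax.
suff : (count a r < count b r)%N by rewrite E ltnn.
have -> : count b r = (count a r + count (predI b (predC a)) r)%N.
  rewrite -count_predUI [X in (_ + X)%N](eq_count (a2 := pred0)) ?count_pred0 ?addn0.
    by apply: eq_in_count => y yr /=; have := ab y yr; case: (a y) => /= [->|_]; rewrite ?andbT.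
  by move=> y /=; case: (a y); rewrite ?andbF.
by rewrite -[X in (X < _)%N]addn0 ltn_add2l -has_count; apply/hasP; exists x; rewrite //= bx.
Qed.

Lemma sub_in_count (T : eqType) (a b : pred T) (r : seq T) :
  {in r, forall x, a x -> b x} -> (count a r <= count b r)%N.
Proof.
move=> ab; rewrite (eq_in_count (a2 := predI a (mem r))); last by move=> x /= ->; rewrite andbT.
rewrite [leqRHS](eq_in_count (a2 := predI b (mem r))); last by move=> x /= ->; rewrite andbT.
by apply: sub_count => x /andP[ax xr] /=; rewrite (ab x xr ax).
Qed.

Lemma card_window D M : #|D| = count (fun t : nat => cl k (M + 1 - t%:Z) \in D) (iota 0 k.+1).
Proof.
have inj : {in iota 0 k.+1 &, injective (fun t : nat => cl k (M + 1 - t%:Z))}.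
  by move=> a b; rewrite !mem_iota => ha hb /cl_inj H; have := H ltac:(lia); lia.
rewrite -size_filter -(size_map (fun t : nat => cl k (M + 1 - t%:Z))).
rewrite -(card_uniqP _); last first.
  rewrite map_inj_in_uniq ?filter_uniq ?iota_uniq // => a b.
  by rewrite !mem_filter => /andP[_ ha] /andP[_ hb]; exact: inj.
apply: eq_card => i; apply/idP/mapP => [iD|[t + ->]]; last by rewrite mem_filter => /andP[].
have [g gn eg] := cl_surj k_gt0 (M + 1) i.
by exists g => //; rewrite mem_filter eg iD mem_iota.
Qed.

(** Let p + 1 lie in the interval of D with start q and end e. Then H p = G (p + 1) > G q = H e, and
    H e >= 0 in or above the window. So each class of D accounts for a positive position of the
    window of H. *)
Lemma moved_rank D G H M : D \proper [set: 'I_k.+1] -> movable D G -> moved D G H ->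
  top H M -> (#|D| <= rank H M)%N /\ (rank H M = #|D| -> profile D M G).
Proof.
move=> pD mvD mv tH.
have pos p : M - n < p -> cl k (p + 1) \in D -> 0 < H p.
  move=> pM pD'; have [h _] := mv p; rewrite h //.
  have [q sq _] := start_ex k_gt0 (p + 1) pD; have := mvD _ _ pD' sq.
  have [e [pe eD ch]] := end_exT (p + 1) pD.
  have [qp qD chq] := sq.
  have se : start D e q.
    split=> //; first by lia.
    by move=> z ze; case: (leP z (p + 1)) => zp; [apply: chq | apply: ch]; lia.
  have He := proj2 (mv e) eD q se.
  have := top_ge0 tH (p := e) ltac:(lia); rewrite He; lia.
have DE := card_window D M.
have sub : {in iota 0 k.+1, forall t : nat, cl k (M + 1 - t%:Z) \in D -> 0 < H (M - t%:Z)}.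
  by move=> t; rewrite mem_iota => tk tD; apply: pos; [lia | rewrite addrAC].
split; first by rewrite DE /rank; exact: sub_in_count.
rewrite DE => rE; apply: (moved_profile mv tH) => p pM.
apply/idP/idP => [Hp|]; last by apply: pos; lia.
have tE : (absz (M - p)%R)%:Z = M - p by rewrite gez0_abs // subr_ge0; lia.
have := count_sub_eq sub rE (x := absz (M - p)%R).
rewrite mem_iota tE (_ : M - (M - p) = p); last by ring.
by rewrite (_ : M + 1 - (M - p) = p + 1); [apply; lia | ring].
Qed.

End TopPosition.

Section Triangularity.
Variable k : nat.
Hypothesis k_gt0 : (0 < k)%N.
Local Notation n := (k.+1%:Z).
Local Notation X := (qper k 1).
Local Notation base := (base k).
Implicit Types (p q e m M : int) (w : seq 'I_k.+1) (D : {set 'I_k.+1}) (G H : X).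

Lemma act_h i phi G : act (nil_h k i) phi G = \sum_(D : {set 'I_k.+1} |
  [&& D \proper [set: 'I_k.+1], #|D| == i & red (cyc_word D) G]) phi (dot (cyc_word D) G).
Proof.
rewrite /nil_h (act_sum k_gt0).
under eq_bigr do rewrite nil_cycE (act_word k_gt0).
by rewrite -big_mkcondr; apply: eq_bigl => D; rewrite andbA.
Qed.

Lemma flat_no_descent G M j : (forall p, M - n < p <= M -> G p = 0) -> ~~ down j G.
Proof.
move=> flat; have [q qM qj] := window_rep k_gt0 M j.
rewrite (downE _ qj) -leNgt (flat q) //.
case: (eqVneq q (M - n + 1)) => [->|qn]; last by rewrite flat //; lia.
by rewrite addrK -[n]mul1r -mulNr qfunDM flat //; lia.
Qed.

Lemma movable_window D G A : (forall p q, A < p <= A + n -> cl k p \in D -> start D p q -> G q < G p) ->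
  movable D G.
Proof.
move=> win p q pD [qp qD ch]; have [p' p'A /clP[m E]] := window_rep k_gt0 (A + n) (cl k p).
have E' : p = p' + m * n := E.
have Eq : q = (q - m * n) + m * n by rewrite subrK.
rewrite E' Eq !qfunDM ltrD2r; apply: win; first by lia.
  by rewrite -(clDM k p' m) -E'.
split; first by lia.
  by rewrite -(clDM k _ m) subrK.
by move=> z zp; rewrite -(clDM k z m); apply: ch; lia.
Qed.

Lemma dot_revK w (G : X) : dot w (dot (rev w) G) = G.
Proof. by rewrite -{1}(revK w) dot_rev. Qed.

(* Removing the first row of the k-bounded partition of G. *)
Lemma first_row G M : reachable G -> G <> base -> top G M -> exists D,
  [/\ D \proper [set: 'I_k.+1], #|D| = rank G M, (0 < #|D|)%N,
      red (cyc_word D) (dot (rev (cyc_word D)) G)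
    & profile D M (dot (rev (cyc_word D)) G)].
Proof.
move=> [w rw Gw] Gb tG.
have iN p : cl k (p - n) = cl k p by rewrite -[n]mul1r -mulNr clDM.
pose D := [set j | [exists t : 'I_k.+1, (cl k (M - t%:Z + 1) == j) && (0 < G (M - t%:Z))]].
have DP p : M - n < p <= M -> (0 < G p) = (cl k (p + 1) \in D).
  move=> pM; rewrite inE; apply/idP/existsP => [Gp|[t /andP[]]].
    have tk : (absz (M - p)%R < k.+1)%N by lia.
    exists (Ordinal tk); rewrite /= gez0_abs ?subr_ge0; last by lia.
    by rewrite (_ : M - (M - p) = p) ?eqxx //; ring.
  rewrite clS_eq => /eqP/cl_inj E Gt; have tk := ltn_ord t.
  by rewrite -E //; lia.
have M1D : cl k (M + 1) \notin D by rewrite -DP ?(proj1 tG) ?ltxx //; lia.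
have pD : D \proper [set: 'I_k.+1].
  by apply/properP; split; [exact: finset.subsetT | exists (cl k (M + 1)); first exact: finset.in_setT].
have cD := cyc_wordP k_gt0 pD.
have DE := card_window k_gt0 D M.
have rankE : #|D| = rank G M.
  rewrite DE /rank; apply: eq_in_count => t; rewrite mem_iota => tk.
  by rewrite DP ?(addrAC M 1) //; lia.
pose K := dot (rev (cyc_word D)) G.
have [rD mv] := cyc_word_moved k_gt0 K pD cD; rewrite /K dot_revK -/K in mv.
have prof : profile D M K by exact: moved_profile mv tG DP.
exists D; split=> //.
(* If D were empty, G would vanish on a whole period and have no descent, but the last letter
   applied in a nonempty reduced word leaves one. *)
- rewrite lt0n; apply/eqP => D0; case: Gb; rewrite Gw.
  case: w rw Gw => [//|j w] /= /andP[_ uj] Gw.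
  have := @flat_no_descent G M j; rewrite Gw down_sact // uj -Gw => /(_ _)/wrap[|//] p pM.
  have := top_ge0 k_gt0 tG (p := p) ltac:(lia).
  by rewrite le_eqVlt DP // (cards0_eq D0) inE orbF => /eqP.
- apply/rD; apply: (@movable_window _ _ (M - n)) => p q pM pD' sq.
  have [[qp qD ch] [_ pr]] := (sq, prof).
  have [_] := pr p ltac:(lia); rewrite pD' => Kp.
  have qM : M - n < q.
    have Dn : cl k (M - n + 1) \notin D by rewrite addrAC iN.
    have pn : p != M - n + 1 by apply: contraTneq pD' => ->.
    rewrite ltNge; apply/negP => qM.
    by have := ch (M - n + 1) ltac:(lia); rewrite (negbTE Dn).
  by have [Kq] := pr q ltac:(lia); rewrite (negbTE qD) => Kq'; lia.
Qed.

Variable s : seq nat -> nilCox k.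
Hypothesis hs : is_kSchur s.

Lemma sk_base : sk s base = 1.
Proof.
by case: hs => _ <- _; rewrite /sk (shape_ofE k_gt0 (diagram_base k_gt0)).
Qed.

(* By induction on the length, then downwards on the first row: removing the first
   row of G gives K with u_D K = G, and all other terms of h_i K have a longer
   first row. *)
Lemma sk_act_base G phi : reachable G -> act (sk s G) phi base = phi G.
Proof.
case=> w rw -> {G}; have [M tM] := top_ex k_gt0 (dot w base).
(* A lexicographic measure: the length, then k minus the first part, which is at most k. *)
have [m] := ubnP (size w * k.+1 + (k - rank (dot w base) M)).
elim: m => // m IH in w M rw tM phi *.
rewrite ltnS => szm; set G := dot w base in tM szm *.
have rG : reachable G by exists w.
have [Eb|Gb] := EM (G = base); first by rewrite Eb sk_base (act1 k_gt0).
have [D [pD cD D0 rD prof]] := first_row rG Gb tM.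
set K := dot _ G in rD prof.
have GK : dot (cyc_word D) K = G by exact: dot_revK.
have rK : reachable K by exact: reachable_word.
have [v rv Kv] := rK.
have szD := cyc_word_size (cyc_wordP k_gt0 pD).
have szv : size w = (#|D| + size v)%N.
  rewrite -szD -size_cat; apply: (red_base_size k_gt0 rw).
    by rewrite red_cat rv -Kv.
  by rewrite dot_cat -Kv GK.
have IHK psi : act (sk s K) psi base = psi K.
  have [M' tM'] := top_ex k_gt0 K; rewrite Kv; apply: (IH v M') => //; rewrite -?Kv //.
  have := rank_le tM; have := rank_le tM'; nia.
have ik : (1 <= #|D| <= k)%N by rewrite D0 cD (rank_le tM).
(* Both sides of the Pieri rule, applied to the empty core, are sums over the same sets. By
   induction all terms except that of D agree, hence those of D agree too. *)
have := congr1 (fun a => act a phi base) (pieri k_gt0 hs ik rK).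
rewrite /= (actM k_gt0) IHK act_h (act_sum k_gt0).
rewrite (bigD1 D) /=; last by rewrite pD eqxx rD.
rewrite [RHS](bigD1 D) /=; last by rewrite pD eqxx rD.
rewrite GK => E; apply/esym; move: E.
rewrite [X in _ + X = _ -> _](eq_bigr (fun D' => act (sk s (dot (cyc_word D') K)) phi base)).
  by move/addIr.
move=> D' /andP[/and3P[pD' /eqP cD' rD'] nD]; apply/esym.
set H := dot (cyc_word D') K.
have HE : H = dot (cyc_word D' ++ v) base by rewrite dot_cat -Kv.
have [M' tM'] := top_ex k_gt0 H.
have cw' := cyc_wordP k_gt0 pD'.
have [mvb mv] := cyc_word_moved k_gt0 K pD' cw'.
have [le eqr] := moved_rank k_gt0 pD' (proj1 mvb rD') mv tM'.
have lt : (rank G M < rank H M')%N.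
  rewrite -cD ltn_neqAle -{2}cD' le andbT; apply: contraNneq nD => rE.
  by apply/eqP/(profile_uniq k_gt0 (eqr _) prof) => //; rewrite -rE.
rewrite HE; apply: (IH _ M'); first by rewrite red_cat rv -Kv.
  by rewrite -HE.
rewrite -HE size_cat (cyc_word_size cw') cD' -szv.
have := rank_le tM'; lia.
Qed.

End Triangularity.

(** * Commutativity of the h_i *)

Section Commutation.
Variable k : nat.
Hypothesis k_gt0 : (0 < k)%N.
Local Notation n := (k.+1%:Z).
Local Notation X := (qper k 1).
Local Notation base := (base k).
Implicit Types (p q : int) (w : seq 'I_k.+1) (D : {set 'I_k.+1}) (G H : X) (a b i j l : nat).

Definition row_word (z : int) l : seq 'I_k.+1 := [seq cl k (z + t%:Z) | t <- rev (iota 0 l)].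

Lemma row_word_add z j l :
  row_word (z + j%:Z) l ++ row_word z j = row_word z (j + l).
Proof.
rewrite /row_word iotaD rev_cat map_cat add0n; congr (_ ++ _).
rewrite (_ : iota j l = map (addn j) (iota 0 l)); last by rewrite -iotaDl addn0.
rewrite -map_rev -map_comp; apply: eq_map => t /=.
by rewrite PoszD addrA.
Qed.

Lemma row_wordS z l : row_word z l.+1 = cl k (z + l%:Z) :: row_word z l.
Proof. by have := row_word_add z l 1; rewrite addn1 => <-; rewrite /row_word /= addr0. Qed.

Lemma window_neq p q : p != q -> p - q < n -> q - p < n -> cl k p != cl k q.
Proof. by move=> pq ? ?; apply: contra pq => /eqP/cl_inj ->; lia. Qed.

(** The core with the single row j, described by its values over one period. *)
Lemma row_core j : (j <= k)%N -> red (row_word 0 j) base /\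
  forall p, -1 <= p < k%:Z -> dot (row_word 0 j) base p = if p == j%:Z - 1 then -1 else 0.
Proof.
elim: j => [|j IH] jk.
  by split=> // p pk /=; case: eqP => e; apply: baseE; lia.
have [rj vj] := IH (ltnW jk); rewrite row_wordS add0r.
set G := dot (row_word 0 j) base in vj *.
have e : cl k j%:Z = cl k j%:Z by [].
split.
  rewrite /= rj (upE _ e) -/G !vj ?eqxx; try lia.
  by case: eqP; lia.
move=> p pk; rewrite [dot _ _]/= -/G.
case: (eqVneq p j%:Z) => [->|pj].
  by rewrite sact_at // vj ?eqxx; [case: eqP => //; lia | lia].
case: (eqVneq p (j%:Z - 1)) => [->|pj'].
  by rewrite sact_pred // vj; [case: eqP; [lia|]; case: eqP => //; lia | lia].
have n0 : cl k p != cl k j%:Z by apply: window_neq => //; lia.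
have n1 : cl k (p + 1) != cl k j%:Z by apply: window_neq; lia.
rewrite sact_other // vj //; case: eqP; first by lia.
by case: eqP => //; lia.
Qed.

Definition two_rows b j l := row_word (-1) b ++ row_word j%:Z l.

Lemma mem_row_word z l (x : 'I_k.+1) :
  (x \in row_word z l) = [exists t : 'I_l, cl k (z + t%:Z) == x].
Proof.
apply/mapP/existsP => [[t + ->]|[t /eqP <-]].
  by rewrite mem_rev mem_iota => tl; exists (Ordinal (tl : (t < l)%N)).
by exists (t : nat) => //; rewrite mem_rev mem_iota ltn_ord.
Qed.

Lemma mem_two_rows b j l p : (b <= j)%N -> (j + l <= k)%N -> -1 <= p < k%:Z ->
  (cl k p \in two_rows b j l) = (p < b%:Z - 1) || (j%:Z <= p < (j + l)%N%:Z).
Proof.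
move=> bj jl pk; rewrite mem_cat !mem_row_word; congr (_ || _).
  apply/existsP/idP => [[t /eqP/cl_inj E]|lt].
    by have := ltn_ord t; have := E ltac:(have := ltn_ord t; lia); lia.
  have tb : (absz (p + 1)%R < b)%N by lia.
  by exists (Ordinal tb); rewrite /= gez0_abs; [rewrite addrC addrK | lia].
apply/existsP/idP => [[t /eqP/cl_inj E]|lt].
  by have := ltn_ord t; have := E ltac:(have := ltn_ord t; lia); lia.
have tb : (absz (p - j%:Z)%R < l)%N by lia.
by exists (Ordinal tb); rewrite /= gez0_abs; [rewrite addrC subrK | lia].
Qed.

Lemma two_rows_cyc b j l : (b <= j)%N -> (j + l <= k)%N ->
  cyc_decreasing [set x in two_rows b j l] (two_rows b j l).
Proof.
move=> bj jl.
pose s : seq int := [seq k%:Z + t%:Z | t <- rev (iota 0 b)] ++ [seq j%:Z + t%:Z | t <- rev (iota 0 l)].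
have -> : two_rows b j l = map (cl k) s.
  rewrite map_cat -!map_comp; congr (_ ++ _); apply: eq_map => t /=.
  by rewrite -[in LHS](clDn k); congr cl; lia.
have sr (z : int) m : sorted >%R [seq z + t%:Z | t <- rev (iota 0 m)].
  rewrite sorted_map rev_sorted; apply: sub_sorted (iota_ltn_sorted 0 m) => x y /= ?; lia.
apply: (@cyc_decreasing_seq k k_gt0 (j%:Z - 1)).
  have tr : transitive (>%R : rel int) by move=> x y z /= xy yz; exact: lt_trans yz xy.
  rewrite (sorted_pairwise tr) pairwise_cat -!(sorted_pairwise tr) !sr !andbT.
  apply/allrelP => x y /mapP[t _ ->] /mapP[t' + ->].
  by rewrite mem_rev mem_iota /=; lia.
by move=> x; rewrite mem_cat => /orP[] /mapP[t + ->]; rewrite mem_rev mem_iota; lia.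
Qed.

Lemma card_proper D : (#|D| <= k)%N -> D \proper [set: 'I_k.+1].
Proof. by move=> Dk; rewrite properEcard finset.subsetT cardsT card_ord ltnS. Qed.

Section TwoRows.
Variable j : nat.
Hypothesis jk : (j <= k)%N.
Let G := dot (row_word 0 j) base.

(** On the core (j) an interval of D can begin in two ways only: just after the bead j - 1, which
    adds l boxes to the first row, or below position -1, which adds b boxes to a second row. The
    bead j - 1 admits no ascent, which stops the second run at b <= j. *)
Lemma movable_row D : D \proper [set: 'I_k.+1] -> movable D G ->
  exists b l, [/\ (b <= j)%N, (j + l <= k)%N & D = [set x in two_rows b j l]].
Proof.
move=> pD mv; have [_ vj] := row_core jk; rewrite -/G in vj.
have jD : cl k (j%:Z - 1) \notin D.
  apply/negP => jD; have [q sq qj] := start_ex k_gt0 (j%:Z - 1) pD.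
  have := mv _ _ jD sq; have [qj' qD _] := sq.
  have qne : q != j%:Z - 1 by apply: contraNneq qD => ->.
  rewrite (vj (j%:Z - 1)) ?eqxx; last by lia.
  case: (leP (-1) q) => q1.
    by rewrite vj ?(negbTE qne); lia.
  have := qfunDn G q; rewrite vj; last by lia.
  by case: eqP; lia.
have exb : exists b, cl k (b%:Z - 1) \notin D by exists j.
have exa : exists l, (j + l == k)%N || (cl k (j + l)%N%:Z \notin D).
  by exists (k - j)%N; rewrite subnKC ?eqxx.
case: (ex_minnP exb) => b bD bmin; case: (ex_minnP exa) => l lD lmin.
have bj : (b <= j)%N by apply: bmin.
have jl : (j + l <= k)%N by have := lmin (k - j)%N; rewrite subnKC // eqxx => /(_ isT); lia.
exists b, l; split=> //; apply/setP => i; rewrite inE.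
have [p pk <-] := window_rep k_gt0 (k%:Z - 1) i.
rewrite mem_two_rows //; last by lia.
apply/idP/orP => [pD'|[pb|/andP[jp pl]]].
- have [q sq qp] := start_ex k_gt0 p pD; have [qp' qD ch] := sq.
  have qne : q != p by apply: contraNneq qD => ->.
  case: (ltP q (-1)) => q1.
    left; rewrite ltNge; apply/negP => pb.
    have b1 := ch (b%:Z - 1); move: bD; rewrite b1 //.
    by case: (b) pb => [|b'] pb; lia.
  right; have q1D : cl k (q + 1) \in D by apply: ch; lia.
  have sq1 : start D (q + 1) q.
    split=> //; first by lia.
    by move=> z zq; have -> : z = q + 1 by lia.
  have := mv (q + 1) q q1D sq1; rewrite !vj; [|by clear -q1 qp' qne pk; lia..].
  case: eqP => [qE _|_]; last by case: eqP; lia.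
  apply/andP; split; first by lia.
  rewrite ltNge; apply/negP => lp.
  move: lD => /orP[/eqP jlk|]; first by lia.
  by rewrite ch //; lia.
- apply/negPn/negP => pD'; have := bmin (absz (p + 1)%R).
  by rewrite gez0_abs ?addrK //; [move=> /(_ pD'); lia | lia].
apply/negPn/negP => pD'; have := lmin (absz (p - j%:Z)%R).
rewrite PoszD gez0_abs; last by lia.
have -> : j%:Z + (p - j%:Z) = p by ring.
by rewrite pD' orbT => /(_ isT); lia.
Qed.

(** Symmetry comes from [joinE]: the boxes added to the first row continue the word of (j), so the
    whole word depends on i and j only through i + j, and the conditions on b are symmetric. *)
Lemma sum_two_rows (V : zmodType) (F : X -> V) i :
  \sum_(D : {set 'I_k.+1} | [&& D \proper [set: 'I_k.+1], #|D| == i & red (cyc_word D) G])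
     F (dot (cyc_word D) G) =
  \sum_(b : 'I_k.+1 | [&& (b <= i)%N, (b <= j)%N, (i + j - b <= k)%N &
       red (row_word (-1) b ++ row_word 0 (i + j - b)) base])
     F (dot (row_word (-1) b ++ row_word 0 (i + j - b)) base).
Proof.
have [rj _] := row_core jk.
pose Q := [set b : 'I_k.+1 | [&& (b <= i)%N, (b <= j)%N, (i + j - b <= k)%N &
       red (row_word (-1) b ++ row_word 0 (i + j - b)) base]].
pose h (b : 'I_k.+1) : {set 'I_k.+1} := [set x in two_rows b j (i - b)].
have joinE b : (b <= i)%N -> two_rows b j (i - b) ++ row_word 0 j = row_word (-1) b ++ row_word 0 (i + j - b).
  move=> bi; rewrite -catA -[j%:Z](add0r) row_word_add.
  by have -> : (j + (i - b) = i + j - b)%N by lia.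
have cycP b : (b <= i)%N -> (b <= j)%N -> (i + j - b <= k)%N ->
    [/\ [set x in two_rows b j (i - b)] \proper [set: 'I_k.+1], #|[set x in two_rows b j (i - b)]| = i
      & cyc_decreasing [set x in two_rows b j (i - b)] (two_rows b j (i - b))].
  move=> bi bj bk; have c := @two_rows_cyc b j (i - b) bj ltac:(lia).
  have sz := cyc_word_size c.
  have szi : size (two_rows b j (i - b)) = i.
    by rewrite size_cat !size_map !size_rev !size_iota; lia.
  by split=> //; [apply: card_proper; lia | rewrite -sz].
have cycE b : (b <= i)%N -> (b <= j)%N -> (i + j - b <= k)%N ->
    red (cyc_word [set x in two_rows b j (i - b)]) G = red (row_word (-1) b ++ row_word 0 (i + j - b)) base /\
    dot (cyc_word [set x in two_rows b j (i - b)]) G = dot (row_word (-1) b ++ row_word 0 (i + j - b)) base.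
  move=> bi bj bk; have [p c cy] := cycP b bi bj bk.
  have [-> ->] := cyc_word_dot k_gt0 G p (cyc_wordP k_gt0 p) cy.
  by rewrite -joinE // red_cat dot_cat rj.
rewrite (eq_bigl (mem (h @: Q))); last first.
  move=> D; apply/and3P/imsetP => [[pD /eqP cD rD]|[b]].
    have mv : movable D G by apply/(proj1 (cyc_word_moved k_gt0 G pD (cyc_wordP k_gt0 pD))).
    have [b [l [bj jl DE]]] := movable_row pD mv.
    have bl : (b + l)%N = i.
      have := cyc_word_size (two_rows_cyc bj jl); rewrite -DE cD.
      by rewrite size_cat !size_map !size_rev !size_iota.
    have lE : l = (i - b)%N by lia.
    have bk : (b < k.+1)%N by lia.
    exists (Ordinal bk); rewrite ?inE /h /= -?lE //.
    have [E _] := cycE b ltac:(lia) bj ltac:(lia).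
    by rewrite -E -lE -DE rD; apply/and4P; split=> //; lia.
  rewrite inE => /and4P[bi bj bk rb] ->; have [p c cy] := cycP b bi bj bk.
  by rewrite /h p c eqxx; have [-> _] := cycE b bi bj bk.
rewrite big_imset /=; last first.
  suff inj (b b' : 'I_k.+1) : b \in Q -> b' \in Q -> (b < b')%N -> h b != h b'.
    move=> b b' bQ b'Q E; apply: val_inj; case: (ltngtP b b') => // lt.
      by have := inj _ _ bQ b'Q lt; rewrite E eqxx.
    by have := inj _ _ b'Q bQ lt; rewrite E eqxx.
  rewrite !inE => /and4P[bi bj bk _] /and4P[b'i b'j b'k _] lt.
  apply/eqP => /setP/(_ (cl k (b%:Z - 1))); rewrite !inE !mem_two_rows; lia.
apply: eq_big => [b|b]; first by rewrite finset.inE.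
rewrite finset.inE => /and4P[bi bj bk _].
by have [_ <-] := cycE b bi bj bk.
Qed.

End TwoRows.

Variable s : seq nat -> nilCox k.
Hypothesis hs : is_kSchur s.

Lemma reachable_base : reachable base.
Proof. by exists [::]. Qed.

Lemma h_row i : (1 <= i <= k)%N -> nil_h k i = sk s (dot (row_word 0 i) base).
Proof.
move=> /[dup] ik /andP[i1 ik'].
rewrite -[LHS]mulr1 -(sk_base k_gt0 hs) (pieri k_gt0 hs ik reachable_base).
have [ri _] := row_core ik'.
apply: (etrans (@sum_two_rows 0 (leq0n k) _ (sk s) i)); rewrite (big_pred1 ord0) /=.
  by rewrite addn0 subn0.
move=> b; rewrite addn0 leqn0; apply/and4P/eqP => [[_ /eqP b0 _ _]|->].
  exact: val_inj.
by rewrite /= subn0 ri.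
Qed.

Lemma h_comm i j : (1 <= i <= k)%N -> (1 <= j <= k)%N ->
  nil_h k i * nil_h k j = nil_h k j * nil_h k i.
Proof.
suff E a b : (1 <= a <= k)%N -> (1 <= b <= k)%N ->
  nil_h k a * nil_h k b = \sum_(c : 'I_k.+1 | [&& (c <= a)%N, (c <= b)%N, (a + b - c <= k)%N &
       red (row_word (-1) c ++ row_word 0 (a + b - c)) base])
     sk s (dot (row_word (-1) c ++ row_word 0 (a + b - c)) base).
  move=> ik jk; rewrite !E // addnC; apply: eq_bigl => c.
  by rewrite andbCA.
move=> ak bk; rewrite (h_row bk) (pieri k_gt0 hs ak); last exact: reachable_dot.
by rewrite sum_two_rows //; case/andP: bk.
Qed.

End Commutation.

(** * Adding a rectangle *)

Section RectangleOperator.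
Variable k : nat.
Hypothesis k_gt0 : (0 < k)%N.
Local Notation n := (k.+1%:Z).
Local Notation X := (qper k 1).
Local Notation base := (base k).
Implicit Types (p q : int) (i j : 'I_k.+1) (w : seq 'I_k.+1) (D : {set 'I_k.+1}) (G H : X).

(* The first position without a bead in the residue class of p. *)
Definition lev G p : int := p - n * G p.

Lemma lev_cl G p q : cl k p = cl k q -> lev G p = lev G q.
Proof. by move/clP => [m ->]; rewrite /lev qfunDM; ring. Qed.

Lemma cl_lev G p : cl k (lev G p) = cl k p.
Proof. by rewrite /lev mulrC -mulNr clDM. Qed.

Lemma tau_delta i p : p - tau i p = (cl k (tau i p + 1) == i)%:Z - (cl k (tau i p) == i)%:Z.
Proof.
have nS b : cl k b = i -> (cl k (b + 1) == i) = false.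
  by move=> <-; exact/negbTE/clS_neq.
rewrite /tau; case: (eqVneq (cl k p) i) => [e|ne].
  rewrite subrK e eqxx (_ : (cl k (p - 1) == i) = false); first by clear; lia.
  by apply/negbTE/eqP => /nS; rewrite subrK e eqxx.
case: (eqVneq (cl k (p + 1)) i) => [e|ne1]; first by rewrite (nS _ e) e eqxx; clear; lia.
by rewrite (negbTE ne) (negbTE ne1); clear; lia.
Qed.

Variable r : nat.

Definition high G p : bool := (#|[pred j : 'I_k.+1 | (lev G p < lev G j%:Z)%R]| < r)%N.

Lemma high_cl G p q : cl k p = cl k q -> high G p = high G q.
Proof. by move=> /(lev_cl G) e; rewrite /high e. Qed.

Lemma high_mono G p q : lev G p <= lev G q -> high G p -> high G q.
Proof.
move=> pq; apply: leq_ltn_trans; apply: subset_leq_card.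
by apply/fintype.subsetP => j; rewrite !inE; exact: le_lt_trans.
Qed.

(* On k-bounded partitions, lambda |-> (c^r) U lambda, where c = n - r. *)
Definition rect_op G : X.
Proof.
exists (fun p => G (p + r%:Z) - (high G (p + r%:Z))%:Z) => p.
have -> : p + n + r%:Z = p + r%:Z + n by ring.
by rewrite qfunDn (@high_cl G _ (p + r%:Z)) ?clDn //; ring.
Defined.

(** The two corrections differ only if exactly one of the positions is high. If it is q, then lev G
    p < lev G q, which gives G q < G p already; if it is p, then G p <= G q. In both cases the
    comparison is not affected. *)
Lemma high_lt G p q : q < p -> p - q < n ->
  (G q - (high G q)%:Z < G p - (high G p)%:Z) = (G q < G p).
Proof.
move=> qp pq.
have strict a b : high G a -> ~~ high G b -> lev G b < lev G a.
  by move=> ha hb; rewrite ltNge; apply: contra hb => /high_mono; apply.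
have := strict q p; have := strict p q; rewrite /lev.
case: (high G q); case: (high G p) => h1 h2 /=; rewrite ?subr0 ?ltrD2r //.
- have {h1 h2} := h2 isT isT; move: (G q) (G p) => x y h.
  have xy : x < y by nia.
  by rewrite xy; apply/idP; lia.
- have {h1 h2} := h1 isT isT; move: (G q) (G p) => x y h.
  have xy : y <= x by nia.
  by apply/idP/idP; lia.
Qed.

Local Notation sh := (fun i : 'I_k.+1 => i - cl k r%:Z).

Lemma sh_cl p : sh (cl k p) = cl k (p - r%:Z).
Proof. by rewrite clB. Qed.

Lemma up_rect_op i G : up (sh i) (rect_op G) = up i G.
Proof.
have e : cl k (i%:Z - r%:Z) = sh i by rewrite -sh_cl cl_ord.
rewrite (upE _ e) (upE _ (cl_ord i)) /=.
have -> : i%:Z - r%:Z - 1 + r%:Z = i%:Z - 1 by ring.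
by rewrite subrK high_lt //; lia.
Qed.

Lemma tau_sh i p : tau (sh i) p + r%:Z = tau i (p + r%:Z).
Proof.
have E q : (cl k q == sh i) = (cl k (q + r%:Z) == i).
  by rewrite clD eq_sym subr_eq eq_sym.
rewrite /tau !E; have -> : p + 1 + r%:Z = p + r%:Z + 1 by ring.
by case: ifP => _; [ring | case: ifP => _ //; ring].
Qed.

Lemma lev_sact i G p : lev (sact i G) p = lev G (tau i p) + (p - tau i p).
Proof. by rewrite /lev /=; ring. Qed.

(** At an ascent the level of class i - 1 is above that of class i, and s_i raises the former by 1
    and lowers the latter by 1, so these two move apart. Any other pair could be disturbed only at
    levels differing by 1, that is for adjacent classes, and this again leads to the pair i - 1,
    i. *)
Lemma lev_sact_lt i G p q : up i G ->
  (lev (sact i G) q < lev (sact i G) p) = (lev G (tau i q) < lev G (tau i p)).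
Proof.
move=> ui; rewrite !lev_sact.
have key a b : cl k (a + 1) = i -> cl k b = i -> lev G b < lev G a.
  move=> ea eb; rewrite (lev_cl G (etrans eb (esym ea))).
  by move: ui; rewrite (upE _ ea) addrK /lev; nia.
rewrite !tau_delta; move: (tau i q) (tau i p) => x y.
have cx := cl_lev G x; have cy := cl_lev G y.
have adj1 : lev G y = lev G x + 1 -> (cl k (x + 1) == i) = (cl k y == i).
  by move=> E; rewrite -cy E !clS cx.
have adj2 : lev G x = lev G y + 1 -> (cl k (y + 1) == i) = (cl k x == i).
  by move=> E; rewrite -cx E !clS cy.
have same : lev G x = lev G y -> (cl k x == i) = (cl k y == i) /\
    (cl k (x + 1) == i) = (cl k (y + 1) == i).
  move=> E; have xy : cl k x = cl k y by rewrite -cx -cy E.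
  by rewrite !clS xy.
have key1 : cl k (x + 1) == i -> cl k y == i -> lev G y < lev G x.
  by move=> /eqP + /eqP; exact: key.
have key2 : cl k (y + 1) == i -> cl k x == i -> lev G x < lev G y.
  by move=> /eqP + /eqP; exact: key.
move: adj1 adj2 same key1 key2; clear; move: (lev G x) (lev G y) => u v.
by case: (_ == i); case: (_ == i); case: (_ == i); case: (_ == i) => /=; lia.
Qed.

Lemma high_sact i G p : up i G -> high (sact i G) p = high G (tau i p).
Proof.
move=> ui; rewrite /high; congr (_ < r)%N.
pose f j := cl k (tau i j%:Z).
have tau_f q : cl k (tau i q) = f (cl k q).
  have [m ->] : exists m, q = (cl k q)%:Z + m * n by apply/clP; rewrite cl_ord.
  by rewrite tauDM !clDM cl_ord.
have fK : involutive f by move=> j; rewrite /f -/(f _) -tau_f tauK ?cl_ord.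
rewrite -!sum1_card (reindex_inj (inv_inj fK)) /=.
apply: eq_bigl => j; rewrite !inE lev_sact_lt //; congr (_ < _).
rewrite (@lev_cl G _ j%:Z) //.
by rewrite tau_f cl_ord fK cl_ord.
Qed.

Lemma rect_op_sact i G : up i G -> rect_op (sact i G) = sact (sh i) (rect_op G).
Proof.
move=> ui; apply: qper_eq => p; rewrite [LHS]/= [RHS]/= !tau_sh.
by rewrite high_sact.
Qed.

Lemma red_rect_op w G : red (map sh w) (rect_op G) = red w G /\
  (red w G -> dot (map sh w) (rect_op G) = rect_op (dot w G)).
Proof.
elim: w => //= i w [-> IH]; case: (boolP (red w G)) => //= rw.
rewrite IH // up_rect_op; split=> // ui.
by rewrite rect_op_sact.
Qed.

Lemma sh_inj : injective sh.
Proof. exact: addIr. Qed.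

Lemma sh_ordS i : sh (ordS i) = ordS (sh i).
Proof. by rewrite -(cl_ord i) -clS !sh_cl -clS; congr cl; ring. Qed.

Lemma cyc_decreasing_sh D w : cyc_decreasing D w ->
  cyc_decreasing (sh @: D) (map sh w).
Proof.
move=> /and3P[uw /eqP <- /forallP dec]; apply/and3P; split.
- by rewrite (map_inj_uniq sh_inj).
- apply/eqP/setP => j; rewrite finset.inE; apply/mapP/imsetP => -[x xw ->]; exists x => //.
    by rewrite finset.inE.
  by rewrite finset.inE in xw.
apply/forall_inP => _ /imsetP[x xw ->]; apply/implyP => /imsetP[y yw E].
rewrite -sh_ordS !(index_map sh_inj); have := dec x; rewrite xw /= => /implyP; apply.
by rewrite (sh_inj (etrans (sh_ordS x) E)).
Qed.

(** All sets D of size i occur in h_i, so the rotation [sh] only permutes its terms. *)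
Lemma act_h_rect_op (i : nat) phi G :
  act (nil_h k i) (phi \o rect_op) G = act (nil_h k i) phi (rect_op G).
Proof.
rewrite !(act_h k_gt0) [RHS](reindex_inj (imset_inj sh_inj)) /=.
have prop D : (sh @: D \proper [set: 'I_k.+1]) = (D \proper [set: 'I_k.+1]).
  by rewrite !properEcard !finset.subsetT (card_imset _ sh_inj).
have E D : D \proper [set: 'I_k.+1] -> red (cyc_word (sh @: D)) (rect_op G) = red (cyc_word D) G /\
   (red (cyc_word D) G -> dot (cyc_word (sh @: D)) (rect_op G) = rect_op (dot (cyc_word D) G)).
  move=> pD; have cD := cyc_decreasing_sh (cyc_wordP k_gt0 pD).
  have pD' : sh @: D \proper [set: 'I_k.+1] by rewrite prop.
  have [-> ->] := cyc_word_dot k_gt0 (rect_op G) pD' (cyc_wordP k_gt0 pD') cD.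
  exact: red_rect_op.
apply: eq_big => D.
  rewrite prop (card_imset _ sh_inj); case: (boolP (D \proper _)) => //= pD.
  by have [-> _] := E D pD.
by move=> /and3P[pD _ rD]; have [_ ->] := E D pD.
Qed.

Variable s : seq nat -> nilCox k.
Hypothesis hs : is_kSchur s.

(** [in_h_subalgebra] quantifies over all subrings; instantiated at the subring cut out by P it
    becomes an induction principle. *)
Lemma h_subalgebra_ind (P : nilCox k -> Prop) : P 1 -> (forall a b, P a -> P b -> P (a - b)) ->
  (forall a b, P a -> P b -> P (a * b)) -> (forall i : nat, (1 <= i <= k)%N -> P (nil_h k i)) ->
  forall a, in_h_subalgebra a -> P a.
Proof.
move=> P1 PB PM Ph a Ha; apply/asboolP; apply: (Ha (fun x => `[< P x >])).
  split; rewrite ?unfold_in; first exact/asboolP.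
    by move=> x y /asboolP Px /asboolP Py; apply/asboolP/PB.
  by move=> x y /asboolP Px /asboolP Py; apply/asboolP/PM.
by move=> i ik; rewrite unfold_in; apply/asboolP; exact: Ph.
Qed.

Lemma h_subalgebra_comm (a b : nilCox k) : in_h_subalgebra a -> in_h_subalgebra b -> a * b = b * a.
Proof.
move=> Ha Hb; move: b Hb; apply: h_subalgebra_ind => [|x y ex ey|x y ex ey|i ik].
- by rewrite mulr1 mul1r.
- by rewrite mulrBr mulrBl ex ey.
- by rewrite mulrA ex -mulrA ey mulrA.
move: a Ha; apply: h_subalgebra_ind => [|x y ex ey|x y ex ey|j jk].
- by rewrite mulr1 mul1r.
- by rewrite mulrBr mulrBl ex ey.
- by rewrite mulrA -ex -mulrA ey mulrA.
exact: (h_comm k_gt0 hs).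
Qed.

Lemma act_rect_op (a : nilCox k) phi G : in_h_subalgebra a ->
  act a (phi \o rect_op) G = act a phi (rect_op G).
Proof.
move=> Ha; move: a Ha phi G; apply: h_subalgebra_ind.
- by move=> phi G; rewrite !(act1 k_gt0).
- by move=> a b Ha Hb phi G; rewrite !(actB k_gt0) Ha Hb.
- move=> a b Ha Hb phi G; rewrite !(actM k_gt0) -Hb; congr (act b _ G).
  by apply/funext => H; exact: Ha.
- by move=> i _ phi G; exact: act_h_rect_op.
Qed.

Lemma sk_subalgebra G : reachable G -> in_h_subalgebra (sk s G).
Proof. by move=> rG; case: hs => Hs _ _; apply: Hs; exact: shape_of_bounded. Qed.

(* s_R G = s_R s_G base = s_G s_R base = s_G T base = T s_G base = T G, where T is
   rect_op. *)
Lemma act_sk_rect G phi : reachable (rect_op base) -> reachable G ->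
  act (sk s (rect_op base)) phi G = phi (rect_op G).
Proof.
move=> rR rG.
rewrite -(sk_act_base k_gt0 hs (act (sk s (rect_op base)) phi) rG) -(actM k_gt0).
rewrite h_subalgebra_comm; [|exact: sk_subalgebra..].
rewrite (actM k_gt0) (sk_act_base k_gt0 hs _ rR) -act_rect_op; last exact: sk_subalgebra.
exact: sk_act_base.
Qed.

End RectangleOperator.

(** * Faithfulness of the action on cores *)

Section Charge.
Variable k : nat.
Hypothesis k_gt0 : (0 < k)%N.
Local Notation n := (k.+1%:Z).
Implicit Types (p q : int) (i j : 'I_k.+1) (w : seq 'I_k.+1).

Definition periodic (g : int -> int) := forall p q, cl k p = cl k q -> g p = g q.

Lemma sum_tau i g : periodic g -> \sum_(j : 'I_k.+1) g (tau i j%:Z) = \sum_(j : 'I_k.+1) g j%:Z.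
Proof.
move=> pg; pose f j := cl k (tau i j%:Z).
have tau_f q : cl k (tau i q) = f (cl k q).
  have [m ->] : exists m, q = (cl k q)%:Z + m * n by apply/clP; rewrite cl_ord.
  by rewrite tauDM !clDM cl_ord.
have fK : involutive f by move=> j; rewrite /f -/(f _) -tau_f tauK ?cl_ord.
rewrite [RHS](reindex_inj (inv_inj fK)); apply: eq_bigr => j _; apply: pg.
by rewrite [RHS]cl_ord.
Qed.

Lemma sum_residue i g : \sum_(j : 'I_k.+1) g j%:Z * (cl k j%:Z == i)%:Z = g i%:Z.
Proof.
rewrite (bigD1 i) //= cl_ord eqxx mulr1 big1 ?addr0 // => j ji.
by rewrite cl_ord (negbTE ji) mulr0.
Qed.

Lemma sum_residue_pred i g : periodic g ->
  \sum_(j : 'I_k.+1) g j%:Z * (cl k (j%:Z + 1) == i)%:Z = g (i%:Z - 1).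
Proof.
move=> pg; rewrite (bigD1 (cl k (i%:Z - 1))) //=.
have e : cl k (i%:Z - 1) = cl k (cl k (i%:Z - 1))%:Z by rewrite cl_ord.
rewrite clS -e -clS subrK cl_ord eqxx mulr1 -(pg _ _ e) big1 ?addr0 // => j ji.
rewrite (_ : _ == i = false) ?mulr0 //; apply: contraNF ji => /eqP <-.
by rewrite -[X in X == _]cl_ord -clS_eq subrK cl_ord.
Qed.

Lemma sum_delta i : \sum_(j : 'I_k.+1) (j%:Z - tau i j%:Z) = 0.
Proof.
pose g q := (cl k (q + 1) == i)%:Z - (cl k q == i)%:Z.
transitivity (\sum_(j : 'I_k.+1) g (tau i j%:Z)).
  by apply: eq_bigr => j _; exact: tau_delta.
rewrite sum_tau; last by move=> p q e; rewrite /g !clS e.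
rewrite sumrB.
have one : periodic (fun=> 1) by [].
have := sum_residue i (fun=> 1); have := sum_residue_pred i one.
by under eq_bigr do rewrite mul1r; move=> ->; under eq_bigr do rewrite mul1r; move=> ->.
Qed.

Definition charge N (G : qper k N) := \sum_(j : 'I_k.+1) G j%:Z.

(** The deviation L from the slope N / n is periodic, so its sum over a period is unchanged when
    [tau i] permutes the classes, and the displacements of [tau i] add up to 0. *)
Lemma charge_sact N i (G : qper k N) : charge (sact i G) = charge G.
Proof.
pose L p := n * G p - N * p.
have pL : periodic L by move=> p q /clP[m ->]; rewrite /L qfunDM; ring.
have E (H : qper k N) : n * charge H = \sum_(j : 'I_k.+1) (n * H j%:Z) by rewrite mulr_sumr.
apply: (@mulfI _ n) => //; rewrite !E.
have -> : \sum_(j : 'I_k.+1) n * sact i G j%:Z =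
    \sum_(j : 'I_k.+1) (L (tau i j%:Z) + (N * j%:Z - N * (j%:Z - tau i j%:Z))).
  by apply: eq_bigr => j _; rewrite /L /=; ring.
rewrite big_split /= sum_tau // -big_split /=.
under eq_bigr do rewrite addrA.
rewrite sumrB -[X in _ - X]mulr_sumr sum_delta mulr0 subr0.
by apply: eq_bigr => j _; rewrite /L; ring.
Qed.

Lemma charge_dot N w (G : qper k N) : charge (dot w G) = charge G.
Proof. by elim: w => //= i w IH; rewrite charge_sact. Qed.

Lemma charge_base : charge (base k) = 0.
Proof. by apply: big1 => j _; apply: baseE; have := ltn_ord j; lia. Qed.

Lemma qper_window (G H : qper k 1) : (forall j : 'I_k.+1, G j%:Z = H j%:Z) -> G = H.
Proof.
move=> E; apply: qper_eq => p.
have [m ->] : exists m, p = (cl k p)%:Z + m * n by apply/clP; rewrite cl_ord.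
by rewrite !qfunDM E.
Qed.

(** Without descents G takes only the values G 0 and G 0 + 1 over the period starting at 0, the
    former at least once; the sum of these n values is 0 only if all of them are. *)
Lemma charge0_dominant (G : qper k 1) : charge G = 0 -> (forall i, ~~ down i G) -> G = base k.
Proof.
move=> c0 nd; have step p : G (p - 1) <= G p.
  by rewrite leNgt -(downE _ (erefl (cl k p))).
have mono p q : p <= q -> G p <= G q.
  move=> pq; have -> : q = p + (absz (q - p)%R)%:Z by lia.
  elim: (absz _) => [|m IH]; first by rewrite addr0.
  by apply: le_trans IH _; have := step (p + m.+1%:Z); rewrite (_ : _ - 1 = p + m%:Z) //; lia.
have Gk : G k%:Z <= G 0 + 1 by rewrite -(qfunDn G 0); apply: mono; lia.
have lo (j : 'I_k.+1) : G 0 <= G j%:Z by apply: mono; lia.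
have hi (j : 'I_k.+1) : G j%:Z <= G k%:Z by apply: mono; have := ltn_ord j; lia.
have G0le : G 0 <= 0.
  rewrite leNgt; apply/negP => G0; have : 0 < charge G.
    apply: (@lt_le_trans _ _ (\sum_(j < k.+1) (1 : int))); last first.
      by apply: ler_sum => j _; have := lo j; lia.
    by rewrite sumr_const card_ord; lia.
  by rewrite c0 ltxx.
have Gkge : 0 <= G k%:Z.
  rewrite leNgt; apply/negP => Gk0; have : charge G < 0.
    apply: (@le_lt_trans _ _ (\sum_(j < k.+1) (-1 : int))).
      by apply: ler_sum => j _; have := hi j; lia.
    by rewrite sumr_const card_ord; lia.
  by rewrite c0 ltxx.
have Gbase (j : 'I_k.+1) : base k j%:Z = 0 by apply: baseE; have := ltn_ord j; lia.
have [z0|z0] : G 0 = 0 \/ G 0 = -1 by lia.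
  apply: qper_window => j; rewrite Gbase; apply/eqP; apply: contraTT isT => jn.
  suff : 0 < charge G by rewrite c0.
  rewrite /charge (bigD1 j) //= ltr_wpDr //; first by apply: sumr_ge0 => i _; rewrite -z0.
  by rewrite lt_neqAle eq_sym jn /= -z0.
suff : charge G < 0 by rewrite c0.
rewrite /charge (bigD1 ord0) //= z0.
suff : \sum_(j < k.+1 | j != ord0) G j%:Z <= 0 by move: (\sum_(_ < _ | _) _) => x; lia.
by apply: sumr_le0 => j _; have := hi j; lia.
Qed.

(* Sorting by descents decreases the sum of the squares of the levels. *)
Lemma charge0_reachable (G : qper k 1) : charge G = 0 -> reachable G.
Proof.
pose sq (H : qper k 1) := \sum_(j : 'I_k.+1) lev H j%:Z ^+ 2.
have sq_ge0 H : 0 <= sq H by apply: sumr_ge0 => j _; exact: sqr_ge0.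
have [m] := ubnP (absz (sq G)); elim: m G => // m IH G; rewrite ltnS => sqm c0.
have [nd|/existsNP[i /negP/negPn di]] := EM (forall i, ~~ down i G).
  by rewrite (charge0_dominant c0 nd); exists [::].
have -> : G = dot [:: i] (sact i G) by rewrite /= sactK.
apply: reachable_word => //; apply: IH; last by rewrite charge_sact.
suff : sq (sact i G) < sq G by have := sq_ge0 (sact i G); lia.
pose u q := (cl k (q + 1) == i)%:Z; pose v q := (cl k q == i)%:Z.
have pl : periodic (lev G) by move=> p q; exact: lev_cl.
have pu : periodic u by move=> p q e; rewrite /u !clS e.
have pv : periodic v by move=> p q e; rewrite /v e.
have -> : sq (sact i G) = \sum_(j : 'I_k.+1) (lev G j%:Z + (u j%:Z - v j%:Z)) ^+ 2.
  rewrite -(@sum_tau i (fun q => (lev G q + (u q - v q)) ^+ 2)); last first.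
    by move=> p q e; rewrite (pl _ _ e) (pu _ _ e) (pv _ _ e).
  by apply: eq_bigr => j _; rewrite lev_sact tau_delta.
have sqE q : (lev G q + (u q - v q)) ^+ 2 =
    lev G q ^+ 2 + ((lev G q * 2 + 1) * u q + (1 - lev G q * 2) * v q).
  rewrite /u /v; case: (eqVneq (cl k q) i) => [e|_].
    have /negbTE -> : cl k (q + 1) != i by rewrite -e clS_neq.
    by rewrite /=; ring.
  by case: (_ == i); rewrite /=; ring.
under eq_bigr do rewrite sqE.
rewrite big_split /= big_split /=.
rewrite (@sum_residue_pred i (fun q => lev G q * 2 + 1)); last by move=> p q /pl ->.
rewrite (@sum_residue i (fun q => 1 - lev G q * 2)) gtrDl -/(sq G).
(* The sum of squares changes by 2 n (G i - G (i - 1)), which is negative at a descent. *)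
by move: di; rewrite /down /lev; nia.
Qed.

End Charge.

Section Faithful.
Variable k : nat.
Hypothesis k_gt0 : (0 < k)%N.
Local Notation n := (k.+1%:Z).
Local Notation X := (qper k 1).
Local Notation base := (base k).
Local Notation idq := (id_qper k).
Implicit Types (p q : int) (i j : 'I_k.+1) (v w : seq 'I_k.+1) (G : X).

Lemma nil_span (a : nilCox k) : exists l : seq (int * seq 'I_k.+1),
  a = \sum_(x <- l) nil_word x.2 *~ x.1.
Proof.
rewrite -(nil_reprK a); elim: (repr a) => [i|||x [l El]|x [l El] y [l' El']|x [l El] y [l' El']].
- by exists [:: (1, [:: i])]; rewrite big_seq1 /= nil_word_cons nil_word_nil mulr1.
- by exists [::]; rewrite big_nil.
- by exists [:: (1, [::])]; rewrite big_seq1 /= nil_word_nil.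
- exists [seq (- z.1, z.2) | z <- l]; rewrite -nil_piN -[LHS]/(- nil_pi x) El big_map -sumrN.
  by apply: eq_bigr => z _; rewrite mulrNz.
- by exists (l ++ l'); rewrite -nil_piD -[LHS]/(nil_pi x + nil_pi y) El El' big_cat.
- exists [seq (z.1 * z'.1, z.2 ++ z'.2) | z <- l, z' <- l'].
  rewrite -nil_piM -[LHS]/(nil_pi x * nil_pi y) El El' big_allpairs_dep mulr_suml.
  apply: eq_bigr => z _; rewrite mulr_sumr; apply: eq_bigr => z' _.
  by rewrite nil_word_cat mulrzAl mulrzAr -mulrzA mulrC.
Qed.

Lemma dot_id_rev w p : dot w idq (dot (rev w) idq p) = p.
Proof. by rewrite -{1}(revK w) (dot_rev_id k_gt0). Qed.

Lemma dot_rev_cons i w p : dot (rev (i :: w)) idq p = tau i (dot (rev w) idq p).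
Proof. by rewrite rev_cons -cats1 dot_cat dot_id. Qed.

(** The next letter i can destroy the inversion only if x = y + 1 has class i; its ascent condition
    would then say q < p. *)
Lemma inversion_persists v w p q : red (v ++ w) idq -> p < q ->
  dot (rev w) idq q < dot (rev w) idq p ->
  dot (rev (v ++ w)) idq q < dot (rev (v ++ w)) idq p.
Proof.
move=> + pq inv; elim: v => //= i v IH /andP[/IH {IH} lt ui].
rewrite !dot_rev_cons; set x := dot _ _ p in lt *; set y := dot _ _ q in lt *.
have hx : dot (v ++ w) idq x = p by exact: dot_id_rev.
have hy : dot (v ++ w) idq y = q by exact: dot_id_rev.
have nxy : cl k x = i -> x != y + 1.
  move=> e; apply/eqP => xy; move: ui; rewrite (upE _ e) hx.
  by rewrite xy addrK hy; lia.
have nS b : cl k b = i -> cl k (b + 1) <> i by move=> <- /eqP; rewrite (negbTE (clS_neq _ _)).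
rewrite /tau; case: (eqVneq (cl k x) i) => [ex|nx]; case: (eqVneq (cl k y) i) => [ey|ny].
- by lia.
- case: (eqVneq (cl k (y + 1)) i) => [ey1|_]; last by have := nxy ex; lia.
  have := nxy ex; have : x <> y + 2.
    by move=> xE; apply: (nS (y + 1)) => //; rewrite -ex xE; congr cl; ring.
  by lia.
- by case: ifP; lia.
- case: (eqVneq (cl k (y + 1)) i) => [ey1|_]; last by case: ifP; lia.
  have : x <> y + 1 by move=> xE; rewrite xE ey1 eqxx in nx.
  by case: ifP; lia.
Qed.

(* Values decrease by the displacement of the inverse of w, which turns the
   inversions of w into ascents. *)
Definition witness w : X.
Proof.
exists (fun p => base p - (dot (rev w) idq p - p)) => p.
by rewrite !qfunDn; ring.
Defined.

Lemma witness_reachable w : reachable (witness w).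
Proof.
apply: charge0_reachable => //; rewrite /charge /=.
rewrite sumrB sumrB -/(charge base) (charge_base k_gt0) sub0r.
have := charge_dot k_gt0 (rev w) idq; rewrite /charge /= => ->.
by rewrite subrr oppr0.
Qed.

(** A letter i compares the values that come from two positions p < q inverted by the whole word.
    The difference of the witness at q and p is a sum of a nonnegative term from [base], a positive
    one from the inversion, and q - p > 0. *)
Lemma red_witness w : red w idq -> red w (witness w).
Proof.
suff H v u : red (v ++ w) idq -> u = v ++ w -> red w (witness u) by move=> rw; exact: (H [::]).
elim: w v => // i w IH v rw uE /=.
have -> /= : red w (witness u) by apply: (IH (rcons v i)); rewrite cat_rcons.
rewrite /up !(dot_id w (witness u)) /=.
have := rw; rewrite red_cat => /andP[/= /andP[rw' ui] _].
set p := dot w idq (i%:Z - 1); set q := dot w idq i%:Z.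
have pq : p < q by [].
have inv : dot (rev (i :: w)) idq q < dot (rev (i :: w)) idq p.
  rewrite !dot_rev_cons !(dot_rev_id k_gt0) tau_at ?cl_ord // tau_pred ?subrK ?cl_ord //; lia.
have := inversion_persists rw pq inv; rewrite -uE.
have := base_homo k (ltW pq); rewrite /=; lia.
Qed.

(** Terms are removed one group element at a time. On [witness w] the words equal to w contribute
    the total coefficient c at the core [dot w (witness w)]. A word x reaching the same core
    satisfies x v = w v, where v leads from [base] to the witness, and so equals w; hence c = 0. *)
Theorem act_faithful (a : nilCox k) :
  (forall phi G, reachable G -> act a phi G = 0) -> a = 0.
Proof.
have [l] := nil_span a; have [m] := ubnP (size l).
elim: m l a => // m IH [|[z w] l] a; rewrite ltnS => szl aE a0; first by rewrite aE big_nil.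
case: (boolP (red w idq)) => [rw|nrw]; last first.
  by apply: (IH l) => //; rewrite aE big_cons /= nil_word0 // mul0rz add0r.
pose P (x : int * seq 'I_k.+1) := red x.2 idq && `[< dot x.2 idq = dot w idq >].
pose c := z + \sum_(x <- l | P x) x.1.
have aE' : a = nil_word w *~ c + \sum_(x <- l | ~~ P x) nil_word x.2 *~ x.1.
  rewrite aE big_cons /= (bigID P) /= addrA; congr (_ + _).
  rewrite mulrzDr mulrz_sumr; congr (_ + _); apply: eq_bigr => x /andP[rx /asboolP Ex].
  congr (_ *~ _); apply: nil_word_brd.
  exact: (matsumoto k_gt0 (n_gt0 k) (id_dominant k_gt0)).
have [v rv Ev] := witness_reachable w; have rww := red_witness rw.
pose phi (H : X) : int := if `[< H = dot w (witness w) >] then 1 else 0.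
have c0 : c = 0.
  have := a0 phi _ (witness_reachable w).
  rewrite aE' (actD k_gt0) (actMn k_gt0) (act_word k_gt0) rww {1}/phi asboolT // mul1r.
  rewrite (act_sum k_gt0) big1 ?addr0 // => x nP.
  rewrite (actMn k_gt0) (act_word k_gt0); case: ifP => rx; last by rewrite mul0r.
  rewrite /phi; case: asboolP => Ex; last by rewrite mul0r.
  case/negP: nP; rewrite Ev in rx rww Ex.
  have rxv : red (x.2 ++ v) base by rewrite red_cat rv.
  have rwv : red (w ++ v) base by rewrite red_cat rv.
  apply/andP; split.
    apply/negPn/negP => /(nil_word0 k_gt0) x0.
    have := @red_word_inj k k_gt0 (x.2 ++ v) (x.2 ++ v) rxv erefl.
    have := act_word k_gt0 (x.2 ++ v) (fun=> 1) base.
    by rewrite rxv nil_word_cat x0 mul0r (act0 k_gt0).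
  have Exv : dot (x.2 ++ v) base = dot (w ++ v) base by rewrite !dot_cat.
  have b := matsumoto k_gt0 (isT : 0 < 1 :> int) (base_dominant k_gt0) rxv rwv Exv.
  have {b} := dot_brd k_gt0 idq b; rewrite !dot_cat => Eid.
  apply/asboolP/qper_eq => p; apply: (@dot_id_inj k k_gt0 v).
  by rewrite -!(dot_id _ (dot v idq)) Eid.
apply: (IH [seq x <- l | ~~ P x]) => //.
  by apply: leq_trans szl; rewrite size_filter ltnS count_size.
by rewrite aE' c0 mulr0z add0r big_filter.
Qed.

End Faithful.

(** * The action of X_R *)

Section RowMoves.
Variable k : nat.
Hypothesis k_gt0 : (0 < k)%N.
Variable N : int.
Local Notation n := (k.+1%:Z).
Local Notation X := (qper k N).
Implicit Types (G H : X).

Lemma row_move (a : int) m H : (m <= k)%N ->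
  [/\ red (row_word k a m) H <-> forall t : nat, (t < m)%N -> H (a - 1) < H (a + t%:Z),
      forall p : int, a - 1 <= p < a - 1 + m%:Z -> dot (row_word k a m) H p = H (p + 1),
      dot (row_word k a m) H (a - 1 + m%:Z) = H (a - 1)
    & forall p : int, a - 1 + m%:Z < p < a - 1 + n -> dot (row_word k a m) H p = H p].
Proof.
elim: m => [|m IH] mk.
  by split=> // [p|]; [lia | rewrite addr0].
have [rm v1 v2 v3] := IH (ltnW mk); rewrite row_wordS.
set K := dot (row_word k a m) H in v1 v2 v3 *; pose b := a + m%:Z.
have e : cl k b = cl k b by [].
have Kb : K b = H b by apply: v3; rewrite /b; lia.
have Kb1 : K (b - 1) = H (a - 1) by rewrite -v2; congr (K _); rewrite /b; ring.
have rE : red (cl k b :: row_word k a m) H = red (row_word k a m) H && (K (b - 1) < K b).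
  by rewrite -(upE _ e).
have dE p : dot (cl k b :: row_word k a m) H p = sact (cl k b) K p by [].
clearbody K; split=> [|p pa||p pa].
- rewrite rE Kb Kb1; split=> [/andP[/rm lt ltb] t|lt].
    by rewrite ltnS leq_eqVlt => /orP[/eqP->//|]; exact: lt.
  apply/andP; split; last exact: lt.
  by apply/rm => t tm; apply: lt; exact: ltnW.
- rewrite dE; case: (eqVneq p (b - 1)) => [->|pb1]; first by rewrite sact_pred // Kb subrK.
  have n0 : cl k p != cl k b by apply: window_neq; rewrite /b; lia.
  have n1 : cl k (p + 1) != cl k b by apply: window_neq; rewrite /b in pb1 *; lia.
  by rewrite sact_other // v1 //; move: pb1; rewrite /b; lia.
- by rewrite dE (_ : _ + _ = b) ?sact_at //; rewrite /b; lia.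
rewrite dE; have n0 : cl k p != cl k b by apply: window_neq; rewrite /b; lia.
have n1 : cl k (p + 1) != cl k b by apply: window_neq; rewrite /b; lia.
by rewrite sact_other // v3 //; lia.
Qed.

End RowMoves.

(** * The words of the skew shapes (R,nu)/nu *)

Section SkewWords.
Variables (k c r : nat).
Hypothesis c_gt0 : (0 < c)%N.
Hypothesis r_gt0 : (0 < r)%N.
Hypothesis cr : (c + r = k.+1)%N.
Local Notation n := (k.+1%:Z).

Let k_gt0 : (0 < k)%N. Proof. by lia. Qed.

Lemma part_rect p : part (rect c r) p = if (p < r)%N then c else 0%N.
Proof. by rewrite /part nth_nseq. Qed.

Section Tracking.
Variable nu : seq nat.
Hypothesis pnu : is_partition nu.
Hypothesis nuR : sub_diagram nu (rect c r).

Let snu : sorted geq nu. Proof. by case/andP: pnu. Qed.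

Lemma part_le p : (part nu p <= c)%N.
Proof. by have := nuR p; rewrite part_rect; case: ifP => // _ /leq_trans; apply. Qed.

Lemma part_ge_r p : (r <= p)%N -> part nu p = 0%N.
Proof. by move=> rp; have := nuR p; rewrite part_rect ltnNge rp leqn0 => /eqP. Qed.

Lemma size_le_r : (size nu <= r)%N.
Proof. by rewrite leqNgt -part_gt0 // part_ge_r. Qed.

Lemma conj_le_r q : (conj_part nu q <= r)%N.
Proof. by rewrite leqNgt conj_partP // part_ge_r. Qed.

(* The boxes of the t first rows of R \ nu, resp. of the copy of nu below R. *)
Fixpoint upper_word t := if t is t'.+1 then
  row_word k ((part nu t')%:Z - t'%:Z) (c - part nu t') ++ upper_word t' else [::].
Fixpoint lower_word t := if t is t'.+1 then
  row_word k (c%:Z - t'%:Z) (part nu t') ++ lower_word t' else [::].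

(** Row r + t of (R,nu) starts at content - r - t, which is c - t modulo n; hence the form of
    [lower_word]. *)
Lemma skew_wordE : skew_word k (rect c r ++ nu) nu = lower_word r ++ upper_word r.
Proof.
pose row p := [seq content k p q
  | q <- rev (iota (part nu p) (part (rect c r ++ nu) p - part nu p))].
have rowE p : row p = row_word k ((part nu p)%:Z - p%:Z) (part (rect c r ++ nu) p - part nu p).
  rewrite /row /row_word -[X in iota X]addn0 iotaDl -map_rev -map_comp.
  by apply: eq_map => t /=; rewrite contentE; congr cl; lia.
have up t : (t <= r)%N -> flatten [seq row p | p <- rev (iota 0 t)] = upper_word t.
  elim: t => // t IH tr; rewrite -[in iota 0 _]addn1 iotaD rev_cat /= IH ?(ltnW tr) // add0n.
  by rewrite rowE {2}/part nth_cat size_nseq tr nth_nseq tr.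
have low t : flatten [seq row p | p <- rev (iota r t)] = lower_word t.
  elim: t => // t IH; rewrite -[in iota r _]addn1 iotaD rev_cat /= IH rowE.
  rewrite part_ge_r ?leq_addr // {1}/part nth_cat size_nseq ltnNge leq_addr /= addKn subn0.
  rewrite sub0r /row_word; congr (_ ++ _); apply: eq_map => u.
  by rewrite -(clDn k); congr cl; lia.
have lowE t : (size nu <= t)%N -> lower_word t = lower_word (size nu).
  elim: t => [|t IH]; first by rewrite leqn0 => /eqP ->.
  rewrite leq_eqVlt => /orP[/eqP ->//|st]; rewrite /= /part nth_default // IH //.
rewrite (lowE _ size_le_r) -low -(up r) // /skew_word size_cat size_nseq.
by rewrite iotaD rev_cat map_cat flatten_cat add0n.
Qed.

Section Configurations.
Variable N : int.
Local Notation X := (qper k N).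
Variable G : X.

Local Notation y p := (bead nu p).
Local Notation x q := (q%:Z - (conj_part nu q)%:Z).

(** Row t carries the value of bead t up to position c - 1 - t, past the gaps of the columns q >=
    nu_t, each of which goes down by one. So after t rows the gap of column q stands at q minus the
    maximum of t and the length of that column. *)
Lemma upper_word_move t : (t <= r)%N ->
  [/\ red (upper_word t) G <-> forall p q, (p < t)%N -> (part nu p <= q < c)%N -> G (y p) < G (x q),
      forall p, (p < t)%N -> dot (upper_word t) G (c%:Z - 1 - p%:Z) = G (y p),
      forall p, (t <= p < r)%N -> dot (upper_word t) G (y p) = G (y p)
    & forall q, (q < c)%N ->
        dot (upper_word t) G (q%:Z - (maxn t (conj_part nu q))%:Z) = G (x q)].
Proof.
elim: t => [|t IH] tr.
  by split=> // q qc; rewrite max0n.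
have {IH} [rt yt yt' xt] := IH (ltnW tr).
set S := dot (upper_word t) G in yt yt' xt.
have yE : (part nu t)%:Z - t%:Z - 1 = y t by [].
have mk : (c - part nu t <= k)%N by lia.
have pt := part_le t.
have [rm v1 v2 v3] := row_move k_gt0 ((part nu t)%:Z - t%:Z) S mk.
rewrite yE in rm v1 v2 v3.
have tS : (t <= t < r)%N by rewrite leqnn.
have conjt q : (t < conj_part nu q)%N = (q < part nu t)%N by exact: conj_partP.
have xt' q : (part nu t <= q < c)%N -> S (q%:Z - t%:Z) = G (x q).
  move=> /andP[tq qc]; rewrite -xt //; congr (S _).
  by have := conjt q; rewrite ltnNge [RHS]ltnNge tq; lia.
have dE p : dot (upper_word t.+1) G p =
    dot (row_word k ((part nu t)%:Z - t%:Z) (c - part nu t)) S p by rewrite /= dot_cat.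
have rE : red (upper_word t.+1) G = red (upper_word t) G &&
    red (row_word k ((part nu t)%:Z - t%:Z) (c - part nu t)) S by rewrite /= red_cat.
clearbody S.
split=> [|p|p|q qc].
- rewrite rE; split=> [/andP[/rt h1 /rm h2] p q|h].
    rewrite ltnS leq_eqVlt => /orP[/eqP-> qp|]; last exact: h1.
    have := h2 (q - part nu t)%N ltac:(lia); rewrite yt' // -xt' //.
    by rewrite (_ : _ + _ = q%:Z - t%:Z) //; lia.
  apply/andP; split; first by apply/rt => p q pt' ; apply: h; exact: ltnW.
  apply/rm => u um; rewrite yt' // (_ : _ + _ = (part nu t + u)%N%:Z - t%:Z); last by lia.
  by rewrite xt'; [apply: h | ]; lia.
- rewrite ltnS leq_eqVlt dE => /orP[/eqP->|pt'].
    by rewrite -(yt' t) // -v2; congr (dot _ _ _); rewrite /bead; lia.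
  by rewrite v3 ?yt //; rewrite /bead; lia.
(* The position lies below the window of [row_move], so the values are compared one period
   higher. *)
- move=> /andP[tp pr]; rewrite dE; apply: (addIr N); rewrite -!qfunDn.
  rewrite v3; first by rewrite qfunDn yt' ?qfunDn //; lia.
  by have := bead_lt snu tp; rewrite /bead; lia.
rewrite dE; case: (leqP (part nu t) q) => tq.
  have ct : (conj_part nu q <= t)%N by rewrite leqNgt conjt -leqNgt.
  rewrite -xt' ?tq // (_ : maxn _ _ = t.+1); last by lia.
  rewrite v1; last by rewrite /bead; lia.
  by congr (S _); lia.
have ct : (t < conj_part nu q)%N by rewrite conjt.
rewrite -xt // (_ : maxn t.+1 _ = conj_part nu q); last by lia.
rewrite (_ : maxn t _ = conj_part nu q); last by lia.
apply: (addIr N); rewrite -!qfunDn v3 //.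
by have := conj_le_r q; rewrite /bead; lia.
Qed.

(** After the rows of R \ nu the gaps stand at q - r, that is, one period higher, at q + c with
    value increased by N, right above the beads. Row t of the copy of nu carries bead t past those
    of the columns q < nu_t. *)
Lemma lower_word_move t : (t <= r)%N -> let S := dot (upper_word r) G in
  [/\ red (lower_word t) S <-> forall p q, (p < t)%N -> (q < part nu p)%N -> G (y p) < G (x q) + N,
      forall p, (p < t)%N -> dot (lower_word t) S (c%:Z - 1 - p%:Z + (part nu p)%:Z) = G (y p),
      forall p, (t <= p < r)%N -> dot (lower_word t) S (c%:Z - 1 - p%:Z) = G (y p)
    & forall q, (q < c)%N ->
        dot (lower_word t) S (q%:Z + c%:Z - (minn t (conj_part nu q))%:Z) = G (x q) + N].
Proof.
elim: t => [|t IH] tr S.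
  have [_ yr _ xr] := upper_word_move (leqnn r).
  split=> // q qc.
  rewrite -xr // -qfunDn min0n (maxn_idPl (conj_le_r q)) [dot _ _]/=; congr (S _); lia.
have {IH} [rt yt yt' xt] := IH (ltnW tr).
rewrite -/S in rt yt yt' xt.
have mk : (part nu t <= k)%N by have := part_le t; lia.
have pt := part_le t.
have [rm v1 v2 v3] := row_move k_gt0 (c%:Z - t%:Z) (dot (lower_word t) S) mk.
have tS : (t <= t < r)%N by rewrite leqnn.
have conjt q : (t < conj_part nu q)%N = (q < part nu t)%N by exact: conj_partP.
have aE : c%:Z - t%:Z - 1 = c%:Z - 1 - t%:Z by ring.
have xt' q : (q < part nu t)%N -> dot (lower_word t) S (c%:Z - t%:Z + q%:Z) = G (x q) + N.
  move=> qt; rewrite -xt; last by lia.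
  by congr (dot _ _ _); have := conjt q; rewrite qt; lia.
have dE p : dot (lower_word t.+1) S p =
    dot (row_word k (c%:Z - t%:Z) (part nu t)) (dot (lower_word t) S) p by rewrite /= dot_cat.
have rE : red (lower_word t.+1) S = red (lower_word t) S &&
    red (row_word k (c%:Z - t%:Z) (part nu t)) (dot (lower_word t) S) by rewrite /= red_cat.
rewrite aE in rm v1 v2 v3; move: (dot (lower_word t) S) rm v1 v2 v3 yt yt' xt xt' dE rE.
move=> K rm v1 v2 v3 yt yt' xt xt' dE rE; clearbody S.
split=> [|p|p|q qc].
- rewrite rE; split=> [/andP[/rt h1 /rm h2] p q|h].
    rewrite ltnS leq_eqVlt => /orP[/eqP-> qp|]; last exact: h1.
    by have := h2 q qp; rewrite yt' // xt'.
  apply/andP; split; first by apply/rt => p q pt' ; apply: h; exact: ltnW.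
  by apply/rm => u um; rewrite yt' // xt'; [apply: h |].
- rewrite ltnS leq_eqVlt dE => /orP[/eqP->|pt']; first by rewrite v2 yt'.
  rewrite v3 ?yt //.
  by have := part_anti snu (ltnW pt'); have := part_le p; lia.
- move=> /andP[tp pr]; rewrite dE; apply: (addIr N); rewrite -!qfunDn.
  by rewrite v3; [rewrite qfunDn yt' ?qfunDn //; lia | lia].
rewrite dE; case: (ltnP q (part nu t)) => tq.
  have ct : (t < conj_part nu q)%N by rewrite conjt.
  rewrite -xt' // (minn_idPl ct).
  by rewrite v1; [congr (K _); lia | lia].
have ct : (conj_part nu q <= t)%N by rewrite leqNgt conjt -leqNgt.
rewrite -xt // (minn_idPr ct) (minn_idPr (leqW ct)) v3 //.
by have := conj_le_r q; lia.
Qed.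

(* The letters move the values at beads up by c and the values at gaps down by r. *)
Lemma skew_word_move : let w := skew_word k (rect c r ++ nu) nu in
  [/\ red w G <-> forall p q, (p < r)%N -> (q < c)%N ->
        G (y p) < G (x q) + (if (part nu p <= q)%N then 0 else N),
      forall p, (p < r)%N -> dot w G (y p + c%:Z) = G (y p)
    & forall q, (q < c)%N -> dot w G (x q + c%:Z) = G (x q) + N].
Proof.
move=> w; rewrite /w skew_wordE red_cat dot_cat.
have [ru _ _ _] := upper_word_move (leqnn r).
have [rl yl _ xl] := lower_word_move (leqnn r).
split=> [|p pr|q qc].
- split=> [/andP[/ru h1 /rl h2] p q pr qc|h].
    case: leqP => pq; first by rewrite addr0 h1 // pq.
    by rewrite h2.
  apply/andP; split.
    by apply/ru => p q pr /andP[pq qc]; have := h p q pr qc; rewrite pq addr0.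
  apply/rl => p q pr qp; have := h p q pr (leq_trans qp (part_le p)).
  by rewrite leqNgt qp.
- by rewrite -yl //; congr (dot _ _ _); rewrite /bead; lia.
by rewrite -xl // (minn_idPr (conj_le_r q)); congr (dot _ _ _); lia.
Qed.

End Configurations.

Lemma skew_word_red_id : red (skew_word k (rect c r ++ nu) nu) (id_qper k).
Proof.
have [rw _ _] := skew_word_move (id_qper k); apply/rw => p q pr qc.
have := conj_partP p q snu; rewrite /= /bead.
by have := part_le p; have := conj_le_r q; case: (leqP (part nu p) q); lia.
Qed.

End Tracking.
End SkewWords.

(** * Exactly one nu contributes *)

Section RectangleSum.
Variables (k c r : nat).
Hypothesis c_gt0 : (0 < c)%N.
Hypothesis r_gt0 : (0 < r)%N.
Hypothesis cr : (c + r = k.+1)%N.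
Local Notation n := (k.+1%:Z).
Local Notation X := (qper k 1).
Local Notation base := (base k).
Implicit Types (G H : X) (nu la : seq nat).

Let k_gt0 : (0 < k)%N. Proof. by lia. Qed.

Definition in_rect nu := is_partition nu /\ sub_diagram nu (rect c r).

Lemma in_rect_sorted nu : in_rect nu -> sorted geq nu.
Proof. by case=> /andP[]. Qed.

Lemma in_rect_part_le nu p : in_rect nu -> (part nu p <= c)%N.
Proof. by case=> _ /part_le. Qed.

Lemma in_rect_part0 nu p : in_rect nu -> (r <= p)%N -> part nu p = 0%N.
Proof. by case=> _ /part_ge_r h; exact: h. Qed.

Lemma window_bead nu p : in_rect nu -> (p < r)%N -> - r%:Z <= bead nu p < c%:Z.
Proof. by move=> iR pr; have := in_rect_part_le p iR; rewrite /bead; lia. Qed.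

Lemma bead_window nu p : in_rect nu -> - r%:Z <= bead nu p -> (p < r)%N.
Proof.
by move=> iR; rewrite ltnNge => h; apply/negP => rp; move: h; rewrite /bead in_rect_part0 //; lia.
Qed.

Lemma window_gap nu q : in_rect nu -> (q < c)%N ->
  - r%:Z <= q%:Z - (conj_part nu q)%:Z < c%:Z.
Proof. by move=> [pn sn] qc; have := conj_le_r pn sn q; lia. Qed.

Lemma window_cases nu (b : int) : in_rect nu -> - r%:Z <= b < c%:Z ->
  (exists2 p, (p < r)%N & b = bead nu p) \/
  (exists2 q, (q < c)%N & b = q%:Z - (conj_part nu q)%:Z).
Proof.
move=> iR bw; have snu := in_rect_sorted iR.
have [[p bp]|nb] := EM (exists p, b = bead nu p).
  by left; exists p => //; apply: (bead_window iR); lia.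
have [p|q bq] := @empty_column nu b snu; first by apply/eqP => E; case: nb; exists p.
right; exists q => //; rewrite ltnNge; apply/negP => qc.
have := conj_partP 0 q snu; have := in_rect_part_le 0 iR; lia.
Qed.

Local Notation skew nu := (skew_word k (rect c r ++ nu) nu).

Definition high_beads G nu := forall b : int, - r%:Z <= b < c%:Z ->
  high r G b <-> exists p, b = bead nu p.

(** Both positions lie in the window from -r to c - 1 of length n. There lev x < lev y means G y < G
    x if y < x, and G y < G x + 1 if y > x; the first case is nu_p <= q. *)
Lemma skew_lev G nu p q : in_rect nu -> (p < r)%N -> (q < c)%N ->
  (G (bead nu p) < G (q%:Z - (conj_part nu q)%:Z) + (if (part nu p <= q)%N then 0 else 1)) =
  (lev G (q%:Z - (conj_part nu q)%:Z) < lev G (bead nu p)).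
Proof.
move=> iR pr qc; have := window_bead iR pr; have := window_gap iR qc.
have := conj_partP p q (in_rect_sorted iR); rewrite /lev.
have : (part nu p <= q)%N = (bead nu p < q%:Z - (conj_part nu q)%:Z).
  by have := conj_partP p q (in_rect_sorted iR); rewrite /bead; case: (leqP (part nu p) q); lia.
have := bead_neq_empty p q (in_rect_sorted iR).
move: (bead nu p) (q%:Z - (conj_part nu q)%:Z) => y x yx -> _.
move: (G y) (G x) => u v wx wy.
by case: (ltP y x) => h; apply/idP/idP; nia.
Qed.

Lemma cl_bead_inj nu (m : nat) : sorted geq nu ->
  (forall p, (p < m)%N -> - r%:Z <= bead nu p < c%:Z) ->
  injective (fun p : 'I_m => cl k (bead nu p)).
Proof.
move=> snu w p q /cl_inj E; have wp := w p (ltn_ord p); have wq := w q (ltn_ord q).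
by apply/val_inj/(bead_inj snu)/E; lia.
Qed.

(** The r beads and c gaps in the window represent each class once, so all bead levels exceed all
    gap levels exactly when the classes of the beads are the r highest. *)
Lemma red_skewP G nu : in_rect nu -> red (skew nu) G <-> high_beads G nu.
Proof.
move=> iR; have snu := in_rect_sorted iR.
have [rw _ _] := skew_word_move c_gt0 r_gt0 cr (proj1 iR) (proj2 iR) G.
have levP : red (skew nu) G <-> forall p q, (p < r)%N -> (q < c)%N ->
    lev G (q%:Z - (conj_part nu q)%:Z) < lev G (bead nu p).
  rewrite rw; split=> h p q pr qc; first by rewrite -skew_lev // h.
  by rewrite skew_lev // h.
rewrite levP; split=> [lt b bw|hb p q pr qc]; last first.
  rewrite ltNge; apply/negP => /(high_mono (r := r)) mono.
  have /mono : high r G (bead nu p) by apply/hb; [exact: window_bead | exists p].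
  case/(hb _ (window_gap iR qc)) => p' /esym/eqP.
  by rewrite (negbTE (bead_neq_empty _ _ snu)).
have inj := cl_bead_inj snu (fun p => @window_bead nu p iR).
case: (window_cases iR bw) => [[p pr bp]|[q qc bq]].
  split=> [_|_]; first by exists p.
  rewrite bp /high; pose p0 := Ordinal pr.
  apply: (@leq_ltn_trans #|(fun p' : 'I_r => cl k (bead nu p')) @: predC1 p0|).
    apply/subset_leq_card/fintype.subsetP => j; rewrite finset.inE => lt_j.
    have [b' b'w b'j] := window_rep k_gt0 (c%:Z - 1) j.
    have lb' : lev G j%:Z = lev G b' by apply: lev_cl; rewrite cl_ord b'j.
    rewrite lb' in lt_j.
    have [[p' p'r E]|[q qc E]] := window_cases iR (b := b') ltac:(lia).
      apply/imsetP; exists (Ordinal p'r); rewrite /= -?E ?b'j // finset.inE.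
      by apply: contraTneq lt_j => [[p'p]]; rewrite E p'p ltxx.
    by have := lt p q pr qc; rewrite -E; lia.
  by apply: leq_ltn_trans (leq_imset_card _ _) _; rewrite cardC1 card_ord; lia.
split=> [|[p E]]; last by have := bead_neq_empty p q snu; rewrite -bq E eqxx.
rewrite /high ltnNge => /negP[].
rewrite -[leqLHS]card_ord -(card_imset _ inj) bq.
apply/subset_leq_card/fintype.subsetP => _ /imsetP[p _ ->].
rewrite finset.inE (@lev_cl k G (cl k (bead nu p))%:Z (bead nu p)) ?cl_ord //.
exact: lt.
Qed.

Lemma dot_skew G nu : in_rect nu -> red (skew nu) G -> dot (skew nu) G = rect_op r G.
Proof.
move=> iR rG; have hb := iffLR (red_skewP G iR) rG; have snu := in_rect_sorted iR.
have [_ my mx] := skew_word_move c_gt0 r_gt0 cr (proj1 iR) (proj2 iR) G.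
apply: qper_eq => p.
have [b bw /clP[m E]] := window_rep k_gt0 (c%:Z - 1) (cl k (p - c%:Z)).
have -> : p = b + c%:Z + m * n by rewrite -[p](subrK c%:Z) E; ring.
rewrite !qfunDM; congr (_ + _).
have bw' : - r%:Z <= b < c%:Z by lia.
have -> : rect_op r G (b + c%:Z) = G b + 1 - (high r G b)%:Z.
  by rewrite /= (_ : b + c%:Z + r%:Z = b + n) ?qfunDn ?(@high_cl k r G _ b) ?clDn //; lia.
case: (window_cases iR bw') => [[p' p'r E']|[q qc E']].
  have -> : high r G b by apply/hb => //; exists p'.
  by rewrite E' my // addrK.
have -> : high r G b = false.
  apply/negP => /(hb _ bw')[p' E'']; have := bead_neq_empty p' q snu.
  by rewrite -E' E'' eqxx.
by rewrite E' mx // subr0.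
Qed.

(** A level determines its class, so the n levels are distinct and the number of levels above a
    given one takes each value below n once. *)
Lemma card_high G : #|[pred j : 'I_k.+1 | high r G j%:Z]| = r.
Proof.
pose rk (j : 'I_k.+1) := #|[pred i : 'I_k.+1 | (lev G j%:Z < lev G i%:Z)%R]|.
have rk_lt j : (rk j < k.+1)%N.
  apply: (@leq_ltn_trans #|predC1 j|); last by rewrite cardC1 card_ord.
  apply/subset_leq_card/fintype.subsetP => i; rewrite !finset.inE.
  by apply: contraTneq => ->; rewrite ltxx.
have rk_mono (i j : 'I_k.+1) : lev G i%:Z < lev G j%:Z -> (rk j < rk i)%N.
  move=> lt; apply/proper_card/properP; split.
    by apply/fintype.subsetP => l; rewrite !finset.inE; exact: lt_trans.
  by exists j; rewrite !finset.inE ?ltxx.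
have inj : injective (fun j => Ordinal (rk_lt j)).
  move=> i j [E]; rewrite -(cl_ord i) -(cl_ord j) -(cl_lev G i%:Z) -(cl_lev G j%:Z).
  by case: (ltgtP (lev G i%:Z) (lev G j%:Z)) => [/rk_mono|/rk_mono|->] //; rewrite E ltnn.
have rk_r : (r <= k.+1)%N by lia.
transitivity (\sum_(t < k.+1 | (t < r)%N) 1)%N.
  by rewrite (reindex_inj inj) -sum1_card; apply: eq_bigl => j; rewrite finset.inE.
by rewrite (big_ord_narrow rk_r) sum_nat_const card_ord muln1.
Qed.

(** The core of the nu that fits G: the shift by r makes [base] vanish on the window from -r to c -
    1, so the beads there are the high positions, while everything below the window is a bead and
    nothing above it is. *)
Definition core_of_high G : X.
Proof.
exists (fun p => base (p + r%:Z) - (high r G p)%:Z) => p.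
by rewrite addrAC qfunDn (@high_cl k r G _ p) ?clDn //; ring.
Defined.

Lemma core_of_highE G (p : int) : core_of_high G p = base (p + r%:Z) - (high r G p)%:Z.
Proof. by []. Qed.

(** Over the positions from 0 to n - 1 the shifted [base] is 0 on the first c and 1 on the last r;
    the r high classes cancel this sum. *)
Lemma core_of_high_reachable G : reachable (core_of_high G).
Proof.
apply: charge0_reachable => //; rewrite /charge.
rewrite (eq_bigr (fun j : 'I_k.+1 => base (j%:Z + r%:Z) - (high r G j%:Z)%:Z)) // sumrB.
have -> : \sum_(j : 'I_k.+1) (high r G j%:Z)%:Z = r%:Z.
  rewrite -[in RHS](card_high G) -sum1_card -[RHS]natz natr_sum [RHS]big_mkcond /=.
  by apply: eq_bigr => j _; rewrite finset.inE; case: (high _ _ _).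
apply/eqP; rewrite subr_eq0; apply/eqP.
rewrite -(big_mkord xpredT (fun j => base (j%:Z + r%:Z))) (big_cat_nat (n := c)) //; last by lia.
rewrite big_nat_cond big1 ?add0r; last by move=> j; rewrite andbT => jc; rewrite (baseE (m := 0)) //; lia.
rewrite big_nat_cond (eq_bigr (fun=> 1)); last by move=> j; rewrite andbT => jc; rewrite (baseE (m := 1)) //; lia.
by rewrite -big_nat_cond sumr_const_nat -cr addKn natz.
Qed.

Lemma core_of_high_neg G (b : int) : - r%:Z <= b < c%:Z -> (core_of_high G b < 0) = high r G b.
Proof.
move=> bw; rewrite core_of_highE (baseE (m := 0)) ?sub0r; last by lia.
by case: (high _ _ _).
Qed.

Lemma core_of_high_below G (b : int) : b < - r%:Z -> core_of_high G b < 0.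
Proof.
move=> br; have := @base_homo k (b + r%:Z) (-1) ltac:(lia).
by rewrite core_of_highE [base (-1)](baseE (m := -1)); lia.
Qed.

Lemma core_of_high_above G (b : int) : c%:Z <= b -> 0 <= core_of_high G b.
Proof.
move=> bc; have := @base_homo k n (b + r%:Z) ltac:(lia).
by rewrite core_of_highE [base n](baseE (m := 1)); [case: (high _ _ _); lia | lia].
Qed.

Lemma high_beads_diagram G nu : in_rect nu -> high_beads G nu -> diagram_of nu (core_of_high G).
Proof.
move=> iR hb; split; first by case: iR.
move=> b; case: (ltP b (- r%:Z)) => br.
  split=> _; last exact: core_of_high_below.
  by exists (absz (- b - 1)%R); rewrite /bead in_rect_part0 //; lia.
case: (ltP b c%:Z) => bc; first by rewrite core_of_high_neg ?br //; apply: hb; rewrite br.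
split=> [|[p E]]; first by rewrite ltNge core_of_high_above.
by have := in_rect_part_le p iR; rewrite E /bead in bc; lia.
Qed.

(** The diagram of [core_of_high G] fits in R: it has no bead from c on, and an (r+1)-th nonempty
    row would put r + 1 beads, of distinct high classes, into the window. *)
Lemma high_beads_ex G : exists2 nu, in_rect nu & high_beads G nu.
Proof.
have [nu dn] := reachable_diagram k_gt0 (core_of_high_reachable G).
have [pn dn'] := dn; have snu : sorted geq nu by case/andP: pn.
have neg p : core_of_high G (bead nu p) < 0 by apply/dn'; exists p.
have lt_c p : bead nu p < c%:Z.
  by rewrite ltNge; apply/negP => /(core_of_high_above G); rewrite leNgt neg.
have part_r : part nu r = 0%N.
  apply/eqP; rewrite -leqn0 leqNgt; apply/negP => nr.
  have w p : (p < r.+1)%N -> - r%:Z <= bead nu p < c%:Z.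
    by move=> pr; rewrite lt_c andbT; have := part_anti snu (pr : (p <= r)%N); rewrite /bead; lia.
  have inj := cl_bead_inj snu w.
  suff : (r.+1 <= r)%N by rewrite ltnn.
  rewrite -[leqRHS](card_high G) -[leqLHS]card_ord -(card_imset _ inj).
  apply/subset_leq_card/fintype.subsetP => _ /imsetP[p _ ->].
  rewrite finset.inE (@high_cl k r G _ (bead nu p)) ?cl_ord //.
  by rewrite -core_of_high_neg //; exact: w.
exists nu; last by move=> b bw; rewrite -core_of_high_neg.
split=> // p; rewrite part_rect; case: ltnP => pr.
  by have := lt_c 0%N; have := part_anti snu (leq0n p); rewrite /bead; lia.
by have := part_anti snu pr; rewrite part_r.
Qed.

(** Partitions inside R are coded by nonincreasing functions, so that the sum runs over a finite
    type. *)
Definition fun_shape (f : {ffun 'I_r -> 'I_c.+1}) : seq nat :=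
  [seq x <- [seq (f p : nat) | p <- enum 'I_r] | 0 < x]%N.

Definition fun_sorted (f : {ffun 'I_r -> 'I_c.+1}) := sorted geq [seq (f p : nat) | p <- enum 'I_r].

Lemma fun_shape_part f p : fun_sorted f -> part (fun_shape f) p =
  if insub p is Some i then f i : nat else 0%N.
Proof.
move=> sf; rewrite part_filter // /part; case: insubP => [i pr ip|].
  by rewrite (nth_map i) ?size_enum_ord // -ip nth_ord_enum.
by rewrite -leqNgt => rp; rewrite nth_default // size_map size_enum_ord.
Qed.

Lemma in_rect_fun nu : in_rect nu <-> exists2 f, fun_sorted f & fun_shape f = nu.
Proof.
split=> [iR|[f sf <-]]; last first.
  split; first exact: filter_partition.
  move=> p; rewrite fun_shape_part // part_rect; case: insubP => [i -> _|//].
  by rewrite -ltnS.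
pose f := [ffun i : 'I_r => inord (part nu i) : 'I_c.+1].
have fE i : f i = part nu i :> nat.
  by rewrite ffunE inordK // ltnS; exact: in_rect_part_le.
have sf : fun_sorted f.
  apply/(sortedP 0%N) => p; rewrite size_map size_enum_ord => pr.
  have pr' : (p < r)%N by exact: ltnW.
  have nE q : (q < r)%N -> nth 0%N [seq (f p : nat) | p <- enum 'I_r] q = part nu q.
    by move=> qr; rewrite (nth_map (Ordinal pr)) ?size_enum_ord // fE nth_enum_ord.
  rewrite !nE //; exact/part_anti/leqnSn/in_rect_sorted.
exists f => //; apply: part_inj; [exact: filter_partition | by case: iR |].
move=> p; rewrite fun_shape_part //; case: insubP => [i _ <-|]; first exact: fE.
by rewrite -leqNgt => rp; rewrite in_rect_part0.
Qed.

Lemma fun_shape_inj : {in fun_sorted &, injective fun_shape}.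
Proof.
move=> f g sf sg E; apply/ffunP => i; apply/val_inj.
have := congr1 (part ^~ i) E; rewrite /= !fun_shape_part // valK.
by [].
Qed.

Definition rect_sum : nilCox k := \sum_(f | fun_sorted f)
  nil_of (V_skew k (rect c r ++ fun_shape f) (fun_shape f)).

Lemma act_rect_sum phi G : act rect_sum phi G = phi (rect_op r G).
Proof.
rewrite /rect_sum (act_sum k_gt0).
have iRf f : fun_sorted f -> in_rect (fun_shape f) by move=> sf; apply/in_rect_fun; exists f.
have actE f : fun_sorted f -> act (nil_of (V_skew k (rect c r ++ fun_shape f) (fun_shape f))) phi G =
    if red (skew (fun_shape f)) G then phi (rect_op r G) else 0.
  move=> /iRf iR; rewrite nil_ofE //; last exact: (skew_word_red_id c_gt0 r_gt0 cr (proj1 iR) (proj2 iR)).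
  by rewrite (act_word k_gt0); case: ifP => // rG; rewrite dot_skew.
have [nu iR hb] := high_beads_ex G.
have [f0 sf0 E0] := iffLR (in_rect_fun nu) iR.
rewrite (bigD1 f0) //= actE // E0 (iffRL (red_skewP G iR) hb) big1 ?addr0 // => f /andP[sf ff0].
rewrite actE //; case: ifP => // /(iffLR (red_skewP G (iRf _ sf))) hb'.
case/eqP: ff0; apply: fun_shape_inj => //; rewrite E0.
exact: diagram_fun (high_beads_diagram (iRf _ sf) hb') (high_beads_diagram iR hb).
Qed.

Lemma nil_in_rect : in_rect [::].
Proof. by split=> // p; rewrite /part nth_nil. Qed.

Lemma rect_partition : is_partition (rect c r).
Proof.
apply/andP; split; last by rewrite mem_nseq negb_and eq_sym -lt0n c_gt0 orbT.
by apply/(sortedP 0%N) => p; rewrite size_nseq => pr; rewrite !nth_nseq pr (ltnW pr) /=.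
Qed.

(** The term of the empty nu, whose word is that of R, acts as nonzero on the empty core and so
    computes [rect_op r base]: over the period from c - r to 2c - 1 the values are r times -1, then
    c times 1. *)
Lemma diagram_rect : reachable (rect_op r base) /\ diagram_of (rect c r) (rect_op r base).
Proof.
have iR := nil_in_rect.
have [rw my mx] := skew_word_move c_gt0 r_gt0 cr (proj1 iR) (proj2 iR) base.
have rb : red (skew [::]) base.
  apply/rw => p q pr qc; rewrite /bead /part nth_nil leq0n addr0.
  rewrite (_ : conj_part [::] q = 0%N) //.
  by rewrite (baseE (m := -1)) ?(baseE (m := 0)) //; lia.
rewrite -(dot_skew iR rb); split; first exact: reachable_dot.
set F := dot _ base in my mx *.
have Fy (b : int) : (c%:Z - r%:Z <= b < c%:Z) -> F b = -1.
  move=> bw; have := my (absz (c%:Z - 1 - b)%R) ltac:(lia).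
  rewrite /bead /part nth_nil gez0_abs; last by lia.
  rewrite (_ : _ + c%:Z = b); last by ring.
  by move=> ->; apply: baseE; lia.
have Fx (b : int) : (c%:Z <= b < c%:Z + c%:Z) -> F b = 1.
  move=> bw; have := mx (absz (b - c%:Z)%R) ltac:(lia).
  rewrite (_ : conj_part [::] _ = 0%N) // gez0_abs; last by lia.
  rewrite (_ : _ + c%:Z = b); last by ring.
  by move=> ->; rewrite (baseE (m := 0)) //; lia.
split=> [|b]; first exact: rect_partition.
have [b' b'w /clP[m E]] := window_rep k_gt0 (c%:Z + c%:Z - 1) (cl k b).
have Fb : F b = F b' + m by rewrite E qfunDM mulr1.
have beadE p : bead (rect c r) p = (if (p < r)%N then c%:Z else 0) - p%:Z - 1.
  by rewrite /bead part_rect; case: ifP.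
split=> [neg|[p]].
  case: (ltP b' c%:Z) => b'c.
    have m0 : m <= 0 by rewrite Fb Fy in neg; lia.
    have [m00|m1] : m = 0 \/ m <= -1 by lia.
      by exists (absz (c%:Z - 1 - b)%R); rewrite beadE ifT; [|rewrite m00 in E]; lia.
    have mn : m * n <= - n by nia.
    by exists (absz (- b - 1)%R); rewrite beadE ifF; [lia | apply/negbTE; rewrite -leqNgt; lia].
  have m1 : m <= -2 by rewrite Fb Fx in neg; lia.
  have mn : m * n <= - n - n by nia.
  by exists (absz (- b - 1)%R); rewrite beadE ifF; [lia | apply/negbTE; rewrite -leqNgt; lia].
rewrite beadE; case: ltnP => pr Eb; rewrite Fb.
  have m0 : m = 0 by nia.
  by rewrite m0 in E *; rewrite addr0 Fy //; lia.
case: (ltP b' c%:Z) => b'c; first by rewrite Fy; nia.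
by rewrite Fx; nia.
Qed.

(** Hooks in R have length at most c + r - 1 = k, so every cell counts and the core R corresponds to
    R itself. *)
Lemma shape_of_rect : shape_of (rect_op r base) = rect c r.
Proof.
have [_ dR] := diagram_rect; rewrite (shape_ofE k_gt0 dR).
apply: (@eq_from_nth _ 0%N); rewrite size_map size_iota // => p.
rewrite size_nseq => pr; rewrite (nth_map 0%N) ?size_iota ?size_nseq // nth_iota ?size_nseq //.
rewrite add0n part_rect pr nth_nseq pr -[RHS](size_iota 0 c); apply/eqP; rewrite -all_count.
apply/allP => q; rewrite mem_iota add0n => /andP[_ qc].
have cq : (conj_part (rect c r) q <= r)%N.
  by rewrite leqNgt conj_partP ?part_rect ?ltnn //; case/andP: rect_partition.
by rewrite /hook part_rect pr; lia.
Qed.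

End RectangleSum.

Theorem theorem4p12 (k c r : nat)
    (hk : (1 <= k)%N) (hc : (1 <= c)%N) (hr : (1 <= r)%N) (hcr : (c + r = k.+1)%N)
    (s : seq nat -> nilCox k) (hs : is_kSchur s) :
  s (rect c r) =
  \sum_(nu \in [set nu | is_partition nu /\ sub_diagram nu (rect c r)]%classic)
    nil_of (V_skew k (rect c r ++ nu) nu).
Proof.
have [reachR _] := diagram_rect hc hr hcr.
rewrite (fsbig_finType_image (A := in_rect c r) _ _ (in_rect_fun c r) (@fun_shape_inj c r)).
apply/eqP; rewrite -subr_eq0; apply/eqP/(act_faithful hk) => phi G reachG.
rewrite -{1}(shape_of_rect hc hr hcr) (actB hk) (act_sk_rect hk hs) //.
by rewrite -/(rect_sum k c r) (act_rect_sum hc hr hcr) subrr.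
Qed.
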